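(* Consider the Wishart prior $\Pi=\mathcal{W}_p(I,p+b-1)$ on $\Omega$ with integer $b=O(1)$. Assume $\|\Sigma^*\|\vee\|\Omega^*\|=O(1)$ and $p^3/n=o(1)$. Then $$P_{\Sigma^*}^n\sup_{t\in\mathbb{R}}\left|\Pi\left(\sqrt{\frac{n}{2p}}\,\big(\log\det(\Sigma)-\log\det(\hat\Sigma)\big)\le t\,\Big|\,X^n\right)-\mathbb{P}(Z\le t)\right|\to0,$$ where $\hat\Sigma$ is the sample covariance matrix and $Z\sim N(0,1)$.
   Context: $X^n=(X_1,\dots,X_n)$ are i.i.d. $N(0,\Sigma^* )$ in $\mathbb{R}^p$, $\Omega^*=(\Sigma^* )^{-1}$, $\hat\Sigma=\frac1n\sum_{i=1}^nX_iX_i^T$. For a precision matrix $\Omega$, write $\Sigma=\Omega^{-1}$. The Wishart prior $\mathcal{W}_p(I,p+b-1)$ has density on symmetric positive semi-definite matrices (with respect to Lebesgue measure) $$\frac{d\Pi(\Omega)}{d\Omega}\propto\exp\Big(\frac{b-2}{2}\log\det(\Omega)-\frac12\mathrm{tr}(\Omega)\Big)$$ (well defined for integers $b\ge1$). The posterior is $\Pi(B|X^n)=\int_B e^{l_n(\Omega)}d\Pi(\Omega)/\int e^{l_n(\Omega)}d\Pi(\Omega)$ with $l_n(\Omega)=\frac n2\log\det(\Omega)-\frac n2\mathrm{tr}(\Omega\hat\Sigma)$. Asymptotics are as $n,p\to\infty$ jointly; $P_{\Sigma^*}^n$ applied to a random variable denotes expectation under the sampling distribution. $\|\cdot\|$ is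 the spectral norm, $a\vee b=\max(a,b)$. *)

(* Defs.v *)
From HB Require Import structures.
From mathcomp Require Import all_boot all_order all_algebra.
From mathcomp Require Import all_classical all_reals all_analysis measurable_realfun.

Set Implicit Arguments.
Unset Strict Implicit.
Unset Printing Implicit Defensive.

Import Order.TTheory GRing.Theory Num.Theory.
Import numFieldNormedType.Exports.
Local Open Scope classical_set_scope.
Local Open Scope ring_scope.

(* The Borel sigma-algebra on matrices, given, as the library does for tuples,
   as the smallest one for which all the entries are measurable.              *)
Definition measure_matrix_display : measure_display -> measure_display.
Proof. exact. Qed.

Section measurable_matrix.
Context {d} {T : measurableType d} (m n : nat).

Definition matrix_entry_preimages : set_system 'M[T]_(m, n) :=
  \bigcup_ij preimage_set_system setT
    (fun M : 'M[T]_(m, n) => M ij.1 ij.2) measurable.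

Let mx_set0 : <<s matrix_entry_preimages >> set0.
Proof. exact: sigma_algebra0. Qed.

Let mx_setC A : <<s matrix_entry_preimages >> A ->
  <<s matrix_entry_preimages >> (~` A).
Proof. exact: sigma_algebraC. Qed.

Let mx_bigcup (F : (set 'M[T]_(m, n))^nat) :
  (forall i, <<s matrix_entry_preimages >> (F i)) ->
  <<s matrix_entry_preimages >> (\bigcup_i F i).
Proof. exact: sigma_algebra_bigcup. Qed.

HB.instance Definition _ := @isMeasurable.Build (measure_matrix_display d)
  'M[T]_(m, n) <<s matrix_entry_preimages >> mx_set0 mx_setC mx_bigcup.

Lemma measurable_fun_matrix d' (U : measurableType d') (f : U -> 'M[T]_(m, n)) :
  (forall i j, measurable_fun setT (fun u => f u i j)) ->
  measurable_fun setT f.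
Proof.
move=> mf; apply: (@measurability _ _ _ _ setT f matrix_entry_preimages) => //.
move=> _ [_ [[i j] _ [B mB <-]] <-] /=.
rewrite !setTI; have := mf i j measurableT B mB.
by rewrite setTI.
Qed.

End measurable_matrix.

Section lebesgue.
Context {R : realType}.
Local Open Scope ereal_scope.

Definition tuple_cons n (xt : measurableTypeR R * n.-tuple R) : n.+1.-tuple R :=
  [tuple of (xt.1 : R) :: xt.2].

Lemma measurable_tuple_cons n : measurable_fun setT (@tuple_cons n).
Proof. by apply: measurable_cons => //; exact: measurable_fst. Qed.

Section cons_measure.
Variables (n : nat) (nu : {sigma_finite_measure set (n.-tuple R) -> \bar R}).

Definition cons_measure (A : set (n.+1.-tuple R)) : \bar R :=
  (@lebesgue_measure R \x nu) (@tuple_cons n @^-1` A).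

Let mu := measure_function_pushforward__canonical__measure_function_Measure
  (@lebesgue_measure R \x nu) (@measurable_tuple_cons n).

HB.instance Definition _ := isMeasure.Build _ _ _ cons_measure
  (measure0 mu) (measure_ge0 mu) (@measure_semi_sigma_additive _ _ _ mu).

Let cons_measure_sigma_finite : sigma_finite setT cons_measure.
Proof.
have /sigma_finiteP[F [TF ndF Foo]] := sigma_finiteT (@lebesgue_measure R).
have /sigma_finiteP[G [TG ndG Goo]] := sigma_finiteT nu.
pose uncons (t : n.+1.-tuple R) : measurableTypeR R * n.-tuple R :=
  (thead t : R, [tuple of behead t]).
have muncons : measurable_fun setT uncons.
  apply/measurable_fun_pairP; split; first exact: measurable_tnth.
  exact: measurable_behead.
exists (fun k => uncons @^-1` (F k `*` G k)).
  rewrite -preimage_bigcup (_ : \bigcup_k _ = setT) ?preimage_setT//.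
  rewrite -setXTT TF TG predeqE => -[x y]; split.
    by move=> [k _ []/= ? ?]; split; exists k.
  move=> [/= [k _ Fkx] [l _ Gly]]; exists (maxn k l) => //; split.
  - by move: x Fkx; exact/subsetPset/ndF/leq_maxl.
  - by move: y Gly; exact/subsetPset/ndG/leq_maxr.
move=> k; have [mF Fk] := Foo k; have [mG Gk] := Goo k; split.
  by rewrite -[X in measurable X]setTI; apply: muncons => //; exact: measurableX.
rewrite /cons_measure -comp_preimage (_ : uncons \o _ = id) ?preimage_id.
  by rewrite product_measure1E// lte_mul_pinfty// ge0_fin_numE.
by apply/funext => -[x t]; congr pair; apply/val_inj.
Qed.

HB.instance Definition _ := Measure_isSigmaFinite.Build _ _ _ cons_measure
  cons_measure_sigma_finite.
End cons_measure.

Fixpoint lebesgue_tuple n : {sigma_finite_measure set (n.-tuple R) -> \bar R} :=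
  if n is n'.+1 then cons_measure (lebesgue_tuple n')
  else \d_([tuple] : 0.-tuple R).

Definition col_of_tuple p (w : p.-tuple R) : 'cV[R]_p := \col_i tnth w i.

Lemma measurable_col_of_tuple p : measurable_fun setT (@col_of_tuple p).
Proof.
apply: measurable_fun_matrix => i j.
rewrite (_ : (fun _ => _) = (@tnth _ R ^~ i)).
  exact: measurable_tnth.
by apply/funext => w; rewrite mxE.
Qed.

(* Half-vectorization: the entry (i, j) with i <= j of a symmetric matrix is the
   coordinate of index 'C(j.+1, 2) + i = j (j + 1) / 2 + i, so that
   p (p + 1) / 2 = 'C(p.+1, 2) coordinates determine the matrix.              *)
Definition sym_of_tuple p (w : 'C(p.+1, 2).-tuple R) : 'M[R]_p :=
  (\matrix_(i, j) nth 0 w ('C((maxn i j).+1, 2) + minn i j))%R.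

Lemma measurable_sym_of_tuple p : measurable_fun setT (@sym_of_tuple p).
Proof.
apply: measurable_fun_matrix => i j.
under eq_fun do rewrite mxE.
set k := ('C((maxn i j).+1, 2) + minn i j)%N.
have [kp|pk] := ltnP k 'C(p.+1, 2); last first.
  rewrite (_ : (fun _ => _) = cst 0%R); first exact: measurable_cst.
  by apply/funext => w; rewrite nth_default// size_tuple.
rewrite (_ : (fun _ => _) = (@tnth _ R ^~ (Ordinal kp))).
  exact: measurable_tnth.
by apply/funext => w; rewrite (tnth_nth 0%R).
Qed.

Definition lebesgue_col p (A : set 'cV[R]_p) : \bar R :=
  pushforward (lebesgue_tuple p) (@col_of_tuple p) A.

(* Lebesgue measure \prod_(i <= j) dM_ij on the symmetric matrices, seen as a
   measure on the space of all square matrices.                               *)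
Definition lebesgue_sym p (A : set 'M[R]_p) : \bar R :=
  pushforward (lebesgue_tuple 'C(p.+1, 2)) (@sym_of_tuple p) A.

Arguments lebesgue_col : clear implicits.
Arguments lebesgue_sym : clear implicits.

Section instances.
Variable p : nat.

Let mucol := measure_function_pushforward__canonical__measure_function_Measure
  (lebesgue_tuple p) (@measurable_col_of_tuple p).

HB.instance Definition _ := isMeasure.Build _ _ _ (lebesgue_col p)
  (measure0 mucol) (measure_ge0 mucol) (@measure_semi_sigma_additive _ _ _ mucol).

Let musym := measure_function_pushforward__canonical__measure_function_Measure
  (lebesgue_tuple 'C(p.+1, 2)) (@measurable_sym_of_tuple p).

HB.instance Definition _ := isMeasure.Build _ _ _ (lebesgue_sym p)
  (measure0 musym) (measure_ge0 musym) (@measure_semi_sigma_additive _ _ _ musym).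

End instances.

End lebesgue.
Arguments lebesgue_col {R} p A.
Arguments lebesgue_sym {R} p A.

Section matrices.
Context {R : realType}.

Definition l2norm p (x : 'cV[R]_p) : R := Num.sqrt (\sum_i x i 0 ^+ 2).

Definition spectral_norm p (M : 'M[R]_p) : R :=
  sup [set l2norm (M *m x) | x in [set x | l2norm x <= 1]].

Definition posdef p : set 'M[R]_p :=
  [set M | M^T = M /\ forall x : 'cV_p, x != 0 -> 0 < (x^T *m M *m x) 0 0].

Definition psd p : set 'M[R]_p :=
  [set M | M^T = M /\ forall x : 'cV_p, 0 <= (x^T *m M *m x) 0 0].

Lemma measurable_entry p (i j : 'I_p) :
  measurable_fun setT (fun M : 'M[R]_p => M i j).
Proof.
move=> _ B mB; rewrite setTI; apply: sub_sigma_algebra.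
by exists (i, j) => //; exists B => //=; rewrite setTI.
Qed.

Lemma measurable_det p : measurable_fun setT (fun M : 'M[R]_p => \det M).
Proof.
rewrite /determinant; apply: measurable_sum => s.
apply: measurable_funM; first exact: measurable_cst.
by apply: measurable_prod => i _; exact: measurable_entry.
Qed.

Lemma measurable_trace p : measurable_fun setT (fun M : 'M[R]_p => \tr M).
Proof. by apply: measurable_sum => i; exact: measurable_entry. Qed.

Let quadE p (M : 'M[R]_p) (x : 'cV_p) :
  (x^T *m M *m x) 0 0 = \sum_j (\sum_i x i 0 * M i j) * x j 0.
Proof.
rewrite mxE; apply: eq_bigr => j _; rewrite mxE; congr (_ * _).
by apply: eq_bigr => i _; rewrite mxE.
Qed.

Let continuous_quad p (M : 'M[R]_p) :
  continuous (fun x : 'cV[R]_p => (x^T *m M *m x) 0 0).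
Proof.
rewrite (_ : (fun _ => _) =
    (fun x : 'cV[R]_p => \sum_j (\sum_i x i 0 * M i j) * x j 0)); last first.
  by apply/funext => x; rewrite quadE.
move=> x; have addR_cts : continuous (fun u : R * R => u.1 + u.2).
  exact: add_continuous.
apply: (@cvg_big R _ +%R 0 predT addR_cts _ (nbhs x)) => j _.
apply: (@cvgM R); last exact: coord_continuous.
apply: (@cvg_big R _ +%R 0 predT addR_cts _ (nbhs x)) => i _.
by apply: (@cvgM R); [exact: coord_continuous|exact: cvg_cst].
Qed.

Let measurable_quad p (x : 'cV[R]_p) :
  measurable [set M : 'M[R]_p | 0 <= (x^T *m M *m x) 0 0].
Proof.
have mq : measurable_fun setT (fun M : 'M[R]_p => (x^T *m M *m x) 0 0).
  rewrite (_ : (fun _ => _) =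
      (fun M : 'M[R]_p => \sum_j (\sum_i x i 0 * M i j) * x j 0)); last first.
    by apply/funext => M; rewrite quadE.
  apply: measurable_sum => j; apply: measurable_funM; last exact: measurable_cst.
  apply: measurable_sum => i; apply: measurable_funM; first exact: measurable_cst.
  exact: measurable_entry.
have := mq measurableT `[0, +oo[%classic (measurable_itv _).
by rewrite setTI; congr measurable; apply/seteqP; split => M /=;
  rewrite in_itv/= andbT.
Qed.

Lemma measurable_psd p : measurable (@psd p).
Proof.
pose Q (v : 'cV[rat]_p) := [set M : 'M[R]_p |
  0 <= ((map_mx ratr v)^T *m M *m map_mx ratr v) 0 0].
rewrite (_ : @psd p = (\bigcap_ij [set M : 'M[R]_p | M ij.2 ij.1 = M ij.1 ij.2])
    `&` \bigcap_v Q v); last first.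
  apply/seteqP; split=> M /= [sM pM].
    by split=> [[i j] _ /=|v _]; [rewrite -[in RHS]sM mxE|exact: pM].
  split; first by apply/matrixP => i j; rewrite mxE; exact: (sM (i, j)).
  move=> x; rewrite leNgt; apply/negP => xM.
  have : \forall y \near x, (y^T *m M *m y) 0 0 < 0.
    exact: cvgr_lt (@continuous_quad p M x) _ xM.
  move=> /nbhs_ballP[e /= e0 xe].
  have ratP i : exists q : rat, ball (x i 0) e (ratr q).
    have xie : x i 0 < x i 0 + e by rewrite ltrDl.
    have [q] := rat_in_itvoo xie; rewrite in_itv/= => /andP[xq qx].
    by exists q; rewrite /ball/= distrC gtr0_norm ?subr_gt0// ltrBlDl.
  have [q qP] := choice ratP.
  have bq : ball x e (map_mx ratr (\col_i q i)).
    by split => // i j; rewrite ord1 !mxE; exact: qP.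
  by have := xe _ bq; rewrite /= ltNge (pM (\col_i q i)).
apply: measurableI.
- apply: fin_bigcap_measurable => // -[i j] _ /=.
  have := measurable_fun_eqr (measurable_entry j i) (measurable_entry i j).
  move=> /(_ measurableT [set true]); rewrite setTI => /(_ I).
  by congr measurable; apply/seteqP; split => M /= /eqP.
- rewrite -[X in measurable X]setCK setC_bigcap; apply: measurableC.
  apply: countable_bigcupT_measurable => // v; apply: measurableC.
  exact: measurable_quad.
Qed.

End matrices.

Section model.
Context {R : realType}.

Definition multinormal_pdf p (S : 'M[R]_p) (x : 'cV[R]_p) : R :=
  (Num.sqrt ((2 * pi) ^+ p * \det S))^-1 *
  expR (- (x^T *m invmx S *m x) 0 0 / 2).

(* The centered Gaussian law N(0, S), for S positive definite. *)
Definition multinormal_prob p (S : 'M[R]_p) (A : set 'cV[R]_p) : \bar R :=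
  (\int[lebesgue_col p]_(x in A) (multinormal_pdf S x)%:E)%E.

Definition mutual_independence d (T : measurableType d) (P : probability T R)
    n d' (U : measurableType d') (X : 'I_n -> {mfun T >-> U}) : Prop :=
  forall (J : {set 'I_n}) (A : 'I_n -> set U), (forall i, measurable (A i)) ->
    P (\bigcap_(i in [set` J]) (X i @^-1` A i)) =
    (\prod_(i in J) P (X i @^-1` A i))%E.

Definition iid_normal d (T : measurableType d) (P : probability T R)
    n p (S : 'M[R]_p) (X : 'I_n -> {mfun T >-> 'cV[R]_p}) : Prop :=
  mutual_independence P X /\
  forall i A, measurable A -> distribution P (X i) A = multinormal_prob S A.

Definition sample_cov n p (x : 'I_n -> 'cV[R]_p) : 'M[R]_p :=
  n%:R^-1 *: \sum_i (x i *m (x i)^T).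

Definition wishart_fun p (b : nat) (O : 'M[R]_p) : R :=
  expR ((b%:R - 2) / 2 * ln (\det O) - \tr O / 2).

Definition wishart_pdf p (b : nat) (O : 'M[R]_p) : R :=
  (fine (\int[lebesgue_sym p]_(O in @psd R p) (wishart_fun b O)%:E)%E)^-1 *
  wishart_fun b O.

(* The law W_p(I, p + b - 1). The singular matrices of psd, for which
   ln (\det O) is a junk value, form a null set. *)
Definition wishart p (b : nat) (B : set 'M[R]_p) : \bar R :=
  (\int[lebesgue_sym p]_(O in B `&` @psd R p) (wishart_pdf b O)%:E)%E.

Arguments wishart p b B : clear implicits.

Section wishart_measure.
Variables p b : nat.

Let wishart_pdf_ge0 (O : 'M[R]_p) : 0 <= wishart_pdf b O.
Proof.
rewrite mulr_ge0 ?expR_ge0// invr_ge0 fine_ge0// integral_ge0// => M _.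
by rewrite lee_fin expR_ge0.
Qed.

Let measurable_wishart_pdf : measurable_fun setT (@wishart_pdf p b).
Proof.
apply: measurable_funM; first exact: measurable_cst.
apply: measurableT_comp; first exact: measurable_expR.
apply: measurable_funB; apply: measurable_funM => //.
  exact: measurableT_comp (@measurable_ln R) (@measurable_det R p).
exact: measurable_trace.
Qed.

Let wishart0 : wishart p b set0 = 0%E.
Proof. by rewrite /wishart set0I integral_set0. Qed.

Let wishart_ge0 B : (0 <= wishart p b B)%E.
Proof. by apply: integral_ge0 => O _; rewrite lee_fin. Qed.

Let wishart_sigma_additive : semi_sigma_additive (wishart p b).
Proof.
move=> F mF tF mUF; rewrite /wishart setI_bigcupl ge0_integral_bigcup//=.
- by apply: is_cvg_ereal_nneg_natsum_cond => n _ _; exact: wishart_ge0.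
- by move=> n; apply: measurableI => //; exact: measurable_psd.
- by apply/measurable_EFinP; exact: measurable_funTS.
- by move=> O _; rewrite lee_fin.
- exact: trivIset_setIr.
Qed.

HB.instance Definition _ := isMeasure.Build _ _ _
  (wishart p b) wishart0 wishart_ge0 wishart_sigma_additive.

End wishart_measure.

Definition loglik n p (x : 'I_n -> 'cV[R]_p) (O : 'M[R]_p) : R :=
  n%:R / 2 * ln (\det O) - n%:R / 2 * \tr (O *m sample_cov x).

Definition posterior n p (Pi : {measure set 'M[R]_p -> \bar R}) (x : 'I_n -> 'cV[R]_p)
    (B : set 'M[R]_p) : R :=
  fine (\int[Pi]_(O in B) (expR (loglik x O))%:E)%E /
  fine (\int[Pi]_O (expR (loglik x O))%:E)%E.

(* sqrt (n / (2p)) (log det Sigma - log det Sigma^) as a function of the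
   precision matrix O = Sigma^-1. *)
Definition scaled_logdet_error n p (x : 'I_n -> 'cV[R]_p) (O : 'M[R]_p) : R :=
  Num.sqrt (n%:R / (2 * p%:R)) *
  (ln (\det (invmx O)) - ln (\det (sample_cov x))).

Definition std_normal_cdf (t : R) : R := fine (normal_prob 0 1 `]-oo, t]).

End model.
Arguments wishart {R} p b B.

(* Main.v *)
From HB Require Import structures.
Require Import Defs.
From mathcomp Require Import all_boot all_order all_algebra.
From mathcomp Require Import all_classical all_reals all_analysis measurable_realfun.
From mathcomp Require Import ring lra.

(** The prior is conjugate. Up to a constant, the posterior density at O is
    det(O)^((n+b-2)/2) exp(- tr(O A)/2) on the positive semi-definite matrices,
    where A = n S + I and S is the sample covariance. Under such a Wishart law
    log det(O) + log det(A) is a sum of p independent logarithms of gamma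
    variables, of shapes (n+b+j)/2 for j < p and rate 1/2. [wishart_logdet_integral] proves
    this by peeling off the last row and column: for O with blocks O', v, v^T, o
    one has det(O) = det(O') (o - v^T O'^-1 v), and O is positive semi-definite
    exactly when the pivot o - v^T O'^-1 v is nonnegative. The pivot contributes
    a gamma factor, the integral over v is Gaussian, and what remains is the
    integral of the same form in dimension p - 1, with A replaced by its Schur
    complement.

    Centered at the logarithm of its mean, the logarithm of a gamma variable of
    shape (n+b+j)/2 has a density proportional to exp(- c (e^x - 1 - x)), which
    is at L1 distance O(n^(-1/2) + (b+j)/n) of the density of N(0, 2/n)
    ([log_gamma_l1]). Replacing the p factors one at a time costs the sum of
    these distances, and p factors N(0, 2/n) convolve to N(0, 2p/n), which the
    factor sqrt(n/(2p)) of the statement turns into N(0, 1). Hence, for fixed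
    data, the distance between the two distribution functions is at most
    O(p n^(-1/2) + p (b+p)/n) plus sqrt(n/(2p)) times the centering error
      | sum_(j < p) log(n+b+j) - log det(A) + log det(S) |
    ([posterior_bound]). As soon as S >= lam I the centering error is at most
    p (b+p)/n + p/(n lam) ([logdet_shift_bound]), so that everything is
    O(sqrt(p^3/n)).

    The sampling distribution only has to provide the bound S >= lam I. If the
    spectral norms of Sigma and of its inverse are at most C, then Sigma >= I/C,
    and lam = 1/(2C) works as soon as the Frobenius norm of S - Sigma is at most
    lam. By polarization the entries of S - Sigma are combinations of the errors
    of averages of squared Gaussian projections, whose second moments are
    O(1/n), so the bound fails with probability O(p^2/n)
    ([sample_cov_lower_bound]). In that case the distance is at most 1, as is
    always true. *)

Set Implicit Arguments.
Unset Strict Implicit.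
Unset Printing Implicit Defensive.

Import Order.TTheory GRing.Theory Num.Theory.
Import numFieldNormedType.Exports.
Local Open Scope classical_set_scope.
Local Open Scope ring_scope.

(** * Integration against densities *)

Section density.
Local Open Scope ereal_scope.
Context d (T : measurableType d) (R : realType).
Variables (mu nu : {measure set T -> \bar R}) (h : T -> R).
Hypotheses (mh : measurable_fun setT h) (h0 : forall x, (0 <= h x)%R).
Hypothesis nuE : forall A, measurable A -> nu A = \int[mu]_(x in A) (h x)%:E.

Import HBNNSimple.

(** Both sides are monotone limits along simple functions, and on indicators the
    identity is the hypothesis on [nu]. *)
Lemma integral_density (f : T -> \bar R) :
  measurable_fun setT f -> (forall x, 0 <= f x) ->
  \int[nu]_x f x = \int[mu]_x (f x * (h x)%:E).
Proof.
move=> mf f0.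
pose g := nnsfun_approx measurableT mf.
have gf x : (EFin \o g n) x @[n --> \oo] --> f x by exact: cvg_nnsfun_approx.
transitivity (limn (fun n => \int[nu]_x (g n x)%:E)).
  rewrite -monotone_convergence//.
  - by apply: eq_integral => x _; apply/esym/cvg_lim => //; exact: gf.
  - by move=> n; exact/measurable_EFinP.
  - by move=> n x _; rewrite lee_fin.
  - by move=> x _ a b ab; rewrite lee_fin; exact/lefP/nd_nnsfun_approx.
have mhE : measurable_fun setT (EFin \o h) by exact/measurable_EFinP.
have nd x : {homo (fun n => (g n x)%:E * (h x)%:E) : a b / (a <= b)%N >-> a <= b}.
  move=> a b ab; apply: lee_wpmul2r; rewrite lee_fin//.
  exact/lefP/nd_nnsfun_approx.
have limE x : limn (fun n => (g n x)%:E * (h x)%:E) = f x * (h x)%:E.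
  by apply/cvg_lim => //; apply: cvgeZr => //; exact: gf.
have -> : \int[mu]_x (f x * (h x)%:E) = limn (fun n => \int[mu]_x ((g n x)%:E * (h x)%:E)).
  rewrite -monotone_convergence//.
  - by apply: eq_integral => x _; rewrite limE.
  - by move=> n; apply: emeasurable_funM => //; exact/measurable_EFinP.
  - by move=> n x _; rewrite /= mule_ge0 ?lee_fin.
congr (limn _); apply/funext => n.
have gE x : (g n x)%:E = \sum_(y \in range (g n)) (y * \1_(g n @^-1` [set y]) x)%:E.
  by rewrite fsumEFin// -fimfunE.
under eq_integral do rewrite gE.
have ghE x : (g n x)%:E * (h x)%:E =
    \sum_(y \in range (g n)) (y * \1_(g n @^-1` [set y]) x)%:E * (h x)%:E.
  by rewrite gE ge0_mule_fsuml// => y; exact: nnfun_muleindic_ge0.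
under [RHS]eq_integral do rewrite ghE.
rewrite !ge0_integral_fsum//.
- apply: eq_fsbigr => y /[!inE] -[t _ gty].
  have y0 : (0 <= y)%R by rewrite -gty.
  have my : measurable (g n @^-1` [set y]) by exact: measurable_funPTI.
  under eq_integral do rewrite EFinM.
  under [RHS]eq_integral do rewrite EFinM -muleA.
  rewrite !ge0_integralZl//.
  + rewrite integral_indic// setIT nuE// integral_mkcond; congr (_ * _); apply: eq_integral => x _.
    by rewrite muleC epatch_indic/=.
  + by apply: emeasurable_funM => //; apply/measurable_EFinP; exact: measurable_indic.
  + by move=> x _; rewrite mule_ge0 ?lee_fin.
  + by apply/measurable_EFinP; exact: measurable_indic.
- by move=> y; apply: emeasurable_funM => //; apply/measurable_EFinP/measurable_funM.
- by move=> y x _; rewrite mule_ge0 ?lee_fin// -lee_fin nnfun_muleindic_ge0.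
- by move=> y; apply/measurable_EFinP/measurable_funM.
- by move=> y x _; rewrite nnfun_muleindic_ge0.
Qed.

End density.

(** Having the weight as a measure makes the uniqueness theorems for measures
    applicable to weighted integrals, as in the changes of variable below. *)
Lemma density_measure_ex d (T : measurableType d) (R : realType)
    (mu : {measure set T -> \bar R}) (h : T -> R) :
  measurable_fun setT h -> (forall x, 0 <= h x) ->
  exists nu : {measure set T -> \bar R},
    forall A, nu A = (\int[mu]_(x in A) (h x)%:E)%E.
Proof.
move=> mh h0; pose D A := (\int[mu]_(x in A) (h x)%:E)%E.
have D0 : D set0 = 0%E by rewrite /D integral_set0.
have Dge0 A : (0 <= D A)%E by apply: integral_ge0 => x _; rewrite lee_fin.
have Dadd : semi_sigma_additive D.
  move=> F mF tF mUF; rewrite /D ge0_integral_bigcup//=.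
  - by apply: is_cvg_ereal_nneg_natsum_cond => n _ _; exact: Dge0.
  - by apply/measurable_EFinP; exact: measurable_funTS.
  - by move=> x _; rewrite lee_fin.
pose m := isMeasure.Build _ _ _ D D0 Dge0 Dadd.
pose nu : {measure set T -> \bar R} := HB.pack D m.
by exists nu.
Qed.

(** * Changes of variable on the real line *)

Section lebesgue_line.
Context {R : realType}.
Local Notation mu := (@lebesgue_measure R).
Local Open Scope ereal_scope.

(** Lebesgue measure is the only measure that gives intervals their lengths, so
    it is equal to its image by [phi]. *)
Lemma integral_lebesgue_pushforward (phi : measurableTypeR R -> measurableTypeR R)
    (f : R -> \bar R) :
  measurable_fun setT phi ->
  (forall a b : R, (a < b)%R -> pushforward mu phi `]a, b] = (b - a)%:E) ->
  measurable_fun setT f -> (forall x, 0 <= f x) ->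
  \int[mu]_x f (phi x) = \int[mu]_x f x.
Proof.
move=> mphi phiE mf f0.
pose nu := measure_function_pushforward__canonical__measure_function_Measure mu mphi.
transitivity (\int[nu]_x f x).
  by rewrite ge0_integral_pushforward// => ? _.
apply/esym/eq_measure_integral => A mA _.
apply: (@lebesgue_measure_unique _ nu) => // _ [[a b]] _ <-.
rewrite lebesgue_measure_itv/= lte_fin; case: ltP => [ab|ba].
  by rewrite phiE// EFinN EFinB.
by rewrite set_itv_ge ?bnd_simp -?leNgt// measure0.
Qed.

Lemma integral_lebesgue_addr (a : R) (f : R -> \bar R) :
  measurable_fun setT f -> (forall x, 0 <= f x) ->
  \int[mu]_x f (x + a)%R = \int[mu]_x f x.
Proof.
apply: (@integral_lebesgue_pushforward (fun x => (x + a)%R)).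
  exact: measurable_funD.
move=> u v uv; rewrite /pushforward.
rewrite (_ : _ @^-1` _ = `](u - a)%R, (v - a)%R]%classic); last first.
  by apply/seteqP; split=> x /=; rewrite !in_itv/= ltrBlDr lerBrDr.
rewrite lebesgue_measure_itv/= lte_fin ltrD2r uv -EFinB; congr EFin; ring.
Qed.

Lemma integral_lebesgue_opp (f : R -> \bar R) :
  measurable_fun setT f -> (forall x, 0 <= f x) ->
  \int[mu]_x f (- x)%R = \int[mu]_x f x.
Proof.
apply: (@integral_lebesgue_pushforward (fun x => (- x)%R)).
  exact: measurable_funN.
move=> u v uv; have := @lebesgue_measureN R `]u, v]%classic (measurable_itv _).
by rewrite lebesgue_measure_itv/= lte_fin uv EFinB.
Qed.

Lemma integral_expR_Nitv (u v : R) : (u < v)%R ->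
  \int[mu]_(x in `]u, v]) (expR x)%:E = (expR v - expR u)%:E.
Proof.
move=> uv; rewrite integral_itv_obnd_cbnd; last first.
  by apply/measurable_EFinP; exact: measurable_funTS (@measurable_expR R).
rewrite (@continuous_FTC2 _ expR expR)//.
- exact/continuous_subspaceT/continuous_expR.
- split.
  + by move=> x _; exact: derivable_expR.
  + exact/cvg_at_right_filter/continuous_expR.
  + exact/cvg_at_left_filter/continuous_expR.
- by move=> x _; rewrite derive1E derive_val.
Qed.

Lemma integral_lebesgue_expR (f : R -> \bar R) :
  measurable_fun setT f -> (forall x, 0 <= f x) ->
  \int[mu]_(y in `]0%R, +oo[) f y = \int[mu]_x (f (expR x) * (expR x)%:E).
Proof.
move=> mf f0.
have mpos : measurable (`]0%R, +oo[%classic : set (measurableTypeR R)) by [].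
have mln : measurable_fun setT (@ln R : measurableTypeR R -> measurableTypeR R).
  exact: measurable_ln.
(* The image by ln of Lebesgue measure on ]0, +oo[ and the measure of density
   expR both give ]u, v] the mass expR v - expR u. *)
pose pos := measure_function_mrestr__canonical__measure_function_Measure mu mpos.
pose kappa := measure_function_pushforward__canonical__measure_function_Measure pos mln.
have [nu nuE] := density_measure_ex mu (@measurable_expR R) (@expR_ge0 R).
have mfe : measurable_fun setT (f \o @expR R).
  by apply: measurableT_comp => //; exact: measurable_expR.
have kE A : measurable A -> kappa A = nu A.
  pose g (k : nat) : set (measurableTypeR R) := `](- k%:R)%R, (k%:R)%R]%classic.
  have kitv (u v : R) : (u < v)%R -> kappa `]u, v]%classic = (expR v - expR u)%:E.
    move=> uv; rewrite /kappa/= /pushforward /mrestr/=.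
    rewrite (_ : _ `&` _ = `]expR u, expR v]%classic); last first.
      apply/seteqP; split=> x /=; rewrite !in_itv/= ?andbT.
        by move=> [+ x0]; rewrite -ltr_expR -(ler_expR _ v) lnK.
      move=> /andP[ux xv]; have x0 : (0 < x)%R := lt_trans (expR_gt0 u) ux.
      by split => //; rewrite -ltr_expR -(ler_expR _ v) lnK// ux xv.
    by rewrite lebesgue_measure_itv/= lte_fin ltr_expR uv EFinB.
  move=> mA; have := (@measure_unique _ R (measurableTypeR R) (@ocitv R) g _ _ _ _ kappa nu); apply => //.
  - exact: ocitvI.
  - by move=> k; exact: is_ocitv.
  - by apply/seteqP; split => // x _; rewrite /g bigcup_itvT.
  - move=> _ [[u v] _ <-]/=; have [uv|vu] := ltP u v.
      by rewrite nuE integral_expR_Nitv// -kitv.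
    have -> : `]u, v]%classic = set0 by rewrite set_itv_ge ?bnd_simp -?leNgt.
    by rewrite !measure0.
  - move=> k; rewrite /g; case: k => [|k].
      by rewrite [X in kappa X](_ : _ = set0) ?measure0 ?set_itv_ge ?bnd_simp ?oppr0 ?ltxx.
    by rewrite kitv ?ltry// (@lt_trans _ _ 0%R)// ltrNl oppr0.
transitivity (\int[kappa]_x f (expR x)).
  rewrite ge0_integral_pushforward//= preimage_setT.
  rewrite (@integral_density _ _ _ mu pos (\1_`]0%R, +oo[)) //.
  - rewrite [LHS]integral_mkcond; congr (integral _ _ _); apply/funext => x.
    rewrite patchE indicE mem_setE in_itv/= andbT.
    by case: ltP => x0; rewrite ?mule0// mule1 lnK.
  - by move=> A mA; rewrite integral_indic// setIC.
  - exact: (measurableT_comp mfe mln).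
transitivity (\int[nu]_x (f \o @expR R) x).
  by apply: eq_measure_integral => A mA _; rewrite kE.
apply: (@integral_density _ _ _ mu nu _ (@measurable_expR R) (@expR_ge0 R) _ (f \o @expR R)) => //.
by move=> x; exact: f0.
Qed.

End lebesgue_line.

(** * Fubini theorems for Lebesgue measure on tuples *)

Section lebesgue_tuples.
Context {R : realType}.
Local Notation mu := (@lebesgue_measure R).
Local Open Scope ereal_scope.

Lemma measurable_cat_tuple m n :
  measurable_fun setT (fun x : m.-tuple R * n.-tuple R => cat_tuple x.1 x.2).
Proof.
apply/measurable_fun_tnthP => i.
have [im|mi] := ltnP i m.
  rewrite (_ : _ \o _ = (fun x : m.-tuple R => tnth x (Ordinal im)) \o fst); last first.
    apply/funext => x; rewrite /= !(tnth_nth 0%R) /= nth_cat size_tuple im//.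
  by apply: measurableT_comp; [exact: measurable_tnth|exact: measurable_fst].
have imn : (i - m < n)%N by rewrite ltn_subLR.
rewrite (_ : _ \o _ = (fun x : n.-tuple R => tnth x (Ordinal imn)) \o snd); last first.
  apply/funext => x; rewrite /= !(tnth_nth 0%R) /= nth_cat size_tuple ltnNge mi//.
by apply: measurableT_comp; [exact: measurable_tnth|exact: measurable_snd].
Qed.

Lemma integral_lebesgue_tuple0 (f : 0.-tuple R -> \bar R) :
  measurable_fun setT f -> \int[lebesgue_tuple 0]_w f w = f [tuple].
Proof. by move=> mf; rewrite integral_dirac// diracT mul1e. Qed.

Lemma integral_lebesgue_tupleS n (f : n.+1.-tuple R -> \bar R) :
  measurable_fun setT f -> (forall w, 0 <= f w) ->
  \int[lebesgue_tuple n.+1]_w f w =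
  \int[mu]_x \int[lebesgue_tuple n]_t f [tuple of x :: t].
Proof.
move=> mf f0.
have mc := @measurable_tuple_cons R n.
transitivity (\int[pushforward (mu \x lebesgue_tuple n) (@tuple_cons R n)]_w f w).
  exact: eq_measure_integral.
rewrite ge0_integral_pushforward// preimage_setT fubini_tonelli1//.
  exact: measurableT_comp.
by move=> x; exact: f0.
Qed.

Lemma measurable_tuple_section m n (F : (m + n).-tuple R -> \bar R) :
  measurable_fun setT F -> (forall w, 0 <= F w) ->
  measurable_fun setT
    (fun u : m.-tuple R => \int[lebesgue_tuple n]_v F (cat_tuple u v)).
Proof.
move=> mF F0.
apply: (@measurable_fun_fubini_tonelli_F _ _ _ _ _ (lebesgue_tuple n)
  (fun x => F (cat_tuple x.1 x.2))) => //.
by apply: measurableT_comp => //; exact: measurable_cat_tuple.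
Qed.

(** The coordinates of a tuple are integrated one after the other from the left,
    so an induction on the length of the first part regroups them. *)
Lemma integral_lebesgue_tupleD m n (F : (m + n).-tuple R -> \bar R) :
  measurable_fun setT F -> (forall w, 0 <= F w) ->
  \int[lebesgue_tuple (m + n)]_w F w =
  \int[lebesgue_tuple m]_u \int[lebesgue_tuple n]_v F (cat_tuple u v).
Proof.
elim: m F => [|m IH] F mF F0.
  rewrite integral_lebesgue_tuple0; last exact: measurable_tuple_section.
  by apply: eq_integral => v _; congr F; exact/val_inj.
rewrite (@integral_lebesgue_tupleS (m + n))// integral_lebesgue_tupleS; last 2 first.
- exact: measurable_tuple_section.
- by move=> w; exact: integral_ge0.
apply: eq_integral => x _.
rewrite (IH (fun w => F [tuple of x :: w])) //; last first.
  apply: measurableT_comp => //; apply: (@measurable_cons _ _ _ _ (cst x) _ id) => //.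
apply: eq_integral => u _; apply: eq_integral => v _.
by congr F; exact/val_inj.
Qed.

(** The integrand is a function of sequences, so that tuples whose lengths are
    only provably equal can be exchanged without casts. *)
Lemma integral_lebesgue_tuple_cat m n N (F : seq R -> \bar R) : N = (m + n)%N ->
  measurable_fun setT (fun w : N.-tuple R => F w) -> (forall w, 0 <= F w) ->
  \int[lebesgue_tuple N]_w F w =
  \int[lebesgue_tuple m]_u \int[lebesgue_tuple n]_v F (u ++ v)%SEQ.
Proof. by move=> -> mF F0; rewrite (integral_lebesgue_tupleD mF). Qed.

Lemma integral_lebesgue_col p (f : 'cV[R]_p -> \bar R) :
  measurable_fun setT f -> (forall x, 0 <= f x) ->
  \int[lebesgue_col p]_x f x = \int[lebesgue_tuple p]_w f (col_of_tuple w).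
Proof.
move=> mf f0.
rewrite -[LHS]/(\int[pushforward (lebesgue_tuple p) (@col_of_tuple R p)]_x f x).
by rewrite ge0_integral_pushforward//; exact: measurable_col_of_tuple.
Qed.

Lemma integral_lebesgue_sym p (f : 'M[R]_p -> \bar R) :
  measurable_fun setT f -> (forall x, 0 <= f x) ->
  \int[lebesgue_sym p]_x f x =
  \int[lebesgue_tuple 'C(p.+1, 2)]_w f (sym_of_tuple w).
Proof.
move=> mf f0.
rewrite -[LHS]/(\int[pushforward (lebesgue_tuple 'C(p.+1, 2)) (@sym_of_tuple R p)]_x f x).
by rewrite ge0_integral_pushforward//; exact: measurable_sym_of_tuple.
Qed.

End lebesgue_tuples.

(** * Block decomposition of Lebesgue measure on vectors and symmetric matrices *)

Section measurable_matrix_functions.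
Context {R : realType} {d} {U : measurableType d}.

Lemma measurable_mxentry m n (i : 'I_m) (j : 'I_n) :
  measurable_fun setT (fun M : 'M[R]_(m, n) => M i j).
Proof.
move=> _ B mB; rewrite setTI; apply: sub_sigma_algebra.
by exists (i, j) => //; exists B => //=; rewrite setTI.
Qed.

Lemma measurable_fun_mxentry m n (A : U -> 'M[R]_(m, n)) i j :
  measurable_fun setT A -> measurable_fun setT (fun u => A u i j).
Proof. by move=> mA; exact: measurableT_comp (measurable_mxentry i j) mA. Qed.

Lemma measurable_fun_addmx m n (A B : U -> 'M[R]_(m, n)) :
  measurable_fun setT A -> measurable_fun setT B ->
  measurable_fun setT (fun u => A u + B u).
Proof.
move=> mA mB; apply: measurable_fun_matrix => i j.
under eq_fun do rewrite mxE.
by apply: measurable_funD; exact: measurable_fun_mxentry.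
Qed.

Lemma measurable_fun_mulmx m n p (A : U -> 'M[R]_(m, n)) (B : U -> 'M[R]_(n, p)) :
  measurable_fun setT A -> measurable_fun setT B ->
  measurable_fun setT (fun u => A u *m B u).
Proof.
move=> mA mB; apply: measurable_fun_matrix => i j.
under eq_fun do rewrite mxE.
by apply: measurable_sum => k; apply: measurable_funM; exact: measurable_fun_mxentry.
Qed.

Lemma measurable_fun_trmx m n (A : U -> 'M[R]_(m, n)) :
  measurable_fun setT A -> measurable_fun setT (fun u => (A u)^T).
Proof.
move=> mA; apply: measurable_fun_matrix => i j.
by under eq_fun do rewrite mxE; exact: measurable_fun_mxentry.
Qed.

Lemma measurable_fun_scalar_mx (f : U -> R) :
  measurable_fun setT f -> measurable_fun setT (fun u => (f u)%:M : 'M[R]_1).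
Proof.
move=> mf; apply: measurable_fun_matrix => i j.
by under eq_fun do rewrite mxE !ord1 mulr1n.
Qed.

Lemma measurable_fun_col_mx m n p (A : U -> 'M[R]_(m, p)) (B : U -> 'M[R]_(n, p)) :
  measurable_fun setT A -> measurable_fun setT B ->
  measurable_fun setT (fun u => col_mx (A u) (B u)).
Proof.
move=> mA mB; apply: measurable_fun_matrix => i j.
under eq_fun do rewrite mxE.
by case: (fintype.split i) => k; exact: measurable_fun_mxentry.
Qed.

Lemma measurable_fun_row_mx m n p (A : U -> 'M[R]_(p, m)) (B : U -> 'M[R]_(p, n)) :
  measurable_fun setT A -> measurable_fun setT B ->
  measurable_fun setT (fun u => row_mx (A u) (B u)).
Proof.
move=> mA mB; apply: measurable_fun_matrix => i j.
under eq_fun do rewrite mxE.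
by case: (fintype.split j) => k; exact: measurable_fun_mxentry.
Qed.

Lemma measurable_fun_sym_block p (A : U -> 'M[R]_p) (v : U -> 'cV[R]_p) (o : U -> R) :
  measurable_fun setT A -> measurable_fun setT v -> measurable_fun setT o ->
  measurable_fun setT (fun u => block_mx (A u) (v u) (v u)^T (o u)%:M : 'M[R]_(p + 1)).
Proof.
move=> mA mv mo; apply: measurable_fun_col_mx; apply: measurable_fun_row_mx => //.
- exact: measurable_fun_trmx.
- exact: measurable_fun_scalar_mx.
Qed.

End measurable_matrix_functions.

Section lebesgue_blocks.
Context {R : realType}.
Local Notation mu := (@lebesgue_measure R).
Local Open Scope ereal_scope.

Lemma measurable_lebesgue_col_section p d (U : measurableType d)
    (F : U -> 'cV[R]_p -> \bar R) :
  measurable_fun setT (fun x : U * 'cV[R]_p => F x.1 x.2) ->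
  (forall u x, 0 <= F u x) ->
  measurable_fun setT (fun u => \int[lebesgue_col p]_x F u x).
Proof.
move=> mF F0.
rewrite (_ : (fun u => _) =
    (fun u => \int[lebesgue_tuple p]_w F u (col_of_tuple w))); last first.
  apply/funext => u; rewrite integral_lebesgue_col//.
  exact: (measurable_fun_pair2 u mF).
apply: (@measurable_fun_fubini_tonelli_F _ _ _ _ _ (lebesgue_tuple p)
  (fun x => F x.1 (col_of_tuple x.2))) => //.
rewrite (_ : (fun _ => _) = (fun x => F x.1 x.2) \o (fun x => (x.1, col_of_tuple x.2)))//.
apply: (measurableT_comp mF); apply/measurable_fun_pairP; split => /=; first exact: measurable_fst.
exact: (measurableT_comp (@measurable_col_of_tuple R p) (@measurable_snd _ _ _ _)).
Qed.

Lemma col_of_tuple_cons p (x : R) (t : p.-tuple R) :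
  col_of_tuple [tuple of x :: t] = col_mx x%:M (col_of_tuple t) :> 'cV[R]_(1 + p).
Proof.
apply/matrixP => i j; rewrite ord1 !mxE; case: fintype.splitP => k /= ik.
  rewrite mxE !ord1 mulr1n (_ : i = ord0) ?tnth0//; apply/val_inj.
  by rewrite /= ik ord1.
rewrite mxE !(tnth_nth 0%R)/= (_ : nat_of_ord i = k.+1)//.
Qed.

Lemma integral_lebesgue_colS p (f : 'cV[R]_(1 + p) -> \bar R) :
  measurable_fun setT f -> (forall x, 0 <= f x) ->
  \int[lebesgue_col (1 + p)]_x f x =
  \int[mu]_a \int[lebesgue_col p]_t f (col_mx a%:M t).
Proof.
move=> mf f0; rewrite integral_lebesgue_col// integral_lebesgue_tupleS//; last first.
  by apply: measurableT_comp => //; exact: measurable_col_of_tuple.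
apply: eq_integral => a _; rewrite integral_lebesgue_col//; last first.
  apply: measurableT_comp => //; apply: measurable_fun_col_mx => //.
by apply: eq_integral => t _; rewrite col_of_tuple_cons.
Qed.

Lemma measurable_lebesgue_section d (U : measurableType d)
    (F : U -> R -> \bar R) :
  measurable_fun setT (fun x : U * R => F x.1 x.2) ->
  (forall u x, 0 <= F u x) ->
  measurable_fun setT (fun u => \int[mu]_x F u x).
Proof.
move=> mF F0.
exact: (@measurable_fun_fubini_tonelli_F _ _ _ _ _ mu (fun x => F x.1 x.2)).
Qed.

Lemma integral_lebesgue_col_addr p (v : 'cV[R]_p) (f : 'cV[R]_p -> \bar R) :
  measurable_fun setT f -> (forall x, 0 <= f x) ->
  \int[lebesgue_col p]_x f (x + v)%R = \int[lebesgue_col p]_x f x.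
Proof.
elim: p v f => [|p IH] v f mf f0.
  by apply: eq_integral => x _; congr f; apply/matrixP => -[].
have mD q (w : 'cV[R]_q) : measurable_fun setT (fun x : 'cV[R]_q => (x + w)%R).
  exact: measurable_fun_addmx.
rewrite !(@integral_lebesgue_colS p)//; last first.
  exact: (measurableT_comp mf (mD _ v)).
pose g : 'cV[R]_(1 + p) -> \bar R := f.
have mg : measurable_fun setT g := mf.
pose v1 : R := (v : 'cV_(1 + p)) 0%R 0%R.
pose v2 : 'cV_p := dsubmx (v : 'cV_(1 + p)).
have mcol (a : R) : measurable_fun setT (fun t : 'cV[R]_p => col_mx a%:M t).
  by apply: measurable_fun_col_mx => //; exact: measurable_cst.
transitivity (\int[mu]_a \int[lebesgue_col p]_t f (col_mx (a + v1)%:M t)).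
  apply: eq_integral => a _.
  rewrite -(IH v2 (fun t => g (col_mx (a + v1)%:M t)))//; last first.
    exact: (measurableT_comp mg (mcol _)).
  apply: eq_integral => t _; congr g.
  apply/matrixP => i j; rewrite !ord1 !mxE; case: fintype.splitP => k /= ik; rewrite !mxE.
    rewrite !ord1 !mulr1n; congr (_ + v _ _)%R; apply/val_inj.
    by rewrite -[LHS]/(nat_of_ord i) ik ord1.
  by congr (_ + v _ _)%R; apply/val_inj.
apply: (@integral_lebesgue_addr R v1 (fun a => \int[lebesgue_col p]_t f (col_mx a%:M t))).
  apply: (measurable_lebesgue_col_section (F := fun (a : R) t => f (col_mx a%:M t))) => //.
  apply: (measurableT_comp mg); apply: measurable_fun_col_mx.
    by apply: measurable_fun_scalar_mx; exact: measurable_fst.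
  exact: measurable_snd.
by move=> a; exact: integral_ge0.
Qed.

(** Half-vectorization stores the upper triangle column by column, so bordering a
    symmetric matrix appends the coordinates of the new column to the tuple. *)
Lemma sym_of_tuple_cat p (u : 'C(p.+1, 2).-tuple R) (v : p.-tuple R) (o : 1.-tuple R) N
    (w : N.-tuple R) (eN : N = 'C((p + 1).+1, 2)) : w = (u ++ (v ++ o))%SEQ :> seq R ->
  sym_of_tuple (tcast eN w) =
  block_mx (sym_of_tuple u) (col_of_tuple v) (col_of_tuple v)^T (thead o)%:M
    :> 'M[R]_(p + 1).
Proof.
move=> wE; apply/matrixP => i j.
(* The entries of the upper left block only use the first 'C(p.+1, 2)
   coordinates. *)
have idx (k l : nat) : (k < p)%N -> (l < p)%N ->
    ('C((maxn k l).+1, 2) + minn k l < 'C(p.+1, 2))%N.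
  move=> kp lp; apply: (@leq_trans 'C((maxn k l).+2, 2)).
    by rewrite [X in (_ < X)%N]binS bin1 ltn_add2l ltnS geq_min leq_maxl.
  by apply: leq_bin2l; rewrite ltnS gtn_max kp.
rewrite !mxE val_tcast wE nth_cat size_tuple.
case: fintype.splitP => k /= ik; rewrite mxE; case: fintype.splitP => l /= jl;
  rewrite ?mxE ik jl ?ord1 ?addn0.
- by rewrite idx.
- rewrite (maxn_idPr _) ?(minn_idPl _) ?(ltnW (ltn_ord k))//.
  by rewrite ltnNge leq_addr/= addKn nth_cat size_tuple ltn_ord (tnth_nth 0%R).
- rewrite (maxn_idPl _) ?(minn_idPr _) ?(ltnW (ltn_ord l))//.
  by rewrite ltnNge leq_addr/= addKn nth_cat size_tuple ltn_ord (tnth_nth 0%R).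
- rewrite maxnn minnn ltnNge leq_addr/= addKn nth_cat size_tuple ltnn subnn.
  by rewrite /thead (tnth_nth 0%R) mulr1n.
Qed.

Lemma measurable_lebesgue_block_section p (f : 'M[R]_(p + 1) -> \bar R) :
  measurable_fun setT f -> (forall x, 0 <= f x) ->
  measurable_fun setT (fun x : 'M[R]_p * 'cV[R]_p =>
    \int[mu]_o f (block_mx x.1 x.2 x.2^T o%:M)).
Proof.
move=> mf f0.
have mf3 : measurable_fun setT (fun x : 'M[R]_p * 'cV[R]_p * R =>
    f (block_mx x.1.1 x.1.2 x.1.2^T x.2%:M)).
  apply: (measurableT_comp mf); apply: measurable_fun_sym_block.
  - exact: (measurableT_comp (@measurable_fst _ _ _ _) (@measurable_fst _ _ _ _)).
  - exact: (measurableT_comp (@measurable_snd _ _ _ _) (@measurable_fst _ _ _ _)).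
  - exact: measurable_snd.
exact: (measurable_lebesgue_section (F := fun (x : 'M[R]_p * 'cV[R]_p) (o : R) =>
  f (block_mx x.1 x.2 x.2^T o%:M))).
Qed.

Lemma measurable_lebesgue_sym_section p (f : 'M[R]_(p + 1) -> \bar R) :
  measurable_fun setT f -> (forall x, 0 <= f x) ->
  measurable_fun setT (fun O : 'M[R]_p =>
    \int[lebesgue_col p]_v \int[mu]_o f (block_mx O v v^T o%:M)).
Proof.
move=> mf f0; have mf2 := measurable_lebesgue_block_section mf f0.
apply: (measurable_lebesgue_col_section (F := fun O v =>
  \int[mu]_o f (block_mx O v v^T o%:M))) => // O v.
exact: integral_ge0.
Qed.

(** The measure-theoretic form of bordering: dO = dO' dv do. This is what makes
    inductions on the size of a random symmetric matrix possible. *)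
Lemma integral_lebesgue_symS p (f : 'M[R]_(p + 1) -> \bar R) :
  measurable_fun setT f -> (forall x, 0 <= f x) ->
  \int[lebesgue_sym (p + 1)]_O f O =
  \int[lebesgue_sym p]_O \int[lebesgue_col p]_v \int[mu]_o
    f (block_mx O v v^T o%:M).
Proof.
move=> mf f0.
have eN : 'C((p + 1).+1, 2) = ('C(p.+1, 2) + (p + 1))%N.
  by rewrite addn1 binS bin1.
have mf2 := measurable_lebesgue_block_section mf f0.
have mf1 := measurable_lebesgue_sym_section mf f0.
rewrite [RHS]integral_lebesgue_sym//; last first.
  by move=> O; apply: integral_ge0 => v _; exact: integral_ge0.
rewrite integral_lebesgue_sym//.
pose F (w : seq R) := f (\matrix_(i, j) nth 0%R w ('C((maxn i j).+1, 2) + minn i j)).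
rewrite -[LHS]/(\int[lebesgue_tuple 'C((p + 1).+1, 2)]_w F w).
have mF N : N = 'C((p + 1).+1, 2) -> measurable_fun setT (fun w : N.-tuple R => F w).
  by move=> ->; exact: (measurableT_comp mf (@measurable_sym_of_tuple R (p + 1))).
rewrite (integral_lebesgue_tuple_cat eN (mF _ (erefl _)))//.
apply: eq_integral => u _.
have mFu : measurable_fun setT (fun v : (p + 1).-tuple R => F (u ++ v)%SEQ).
  apply: (@measurableT_comp _ _ _ _ _ _ (fun w : ('C(p.+1, 2) + (p + 1)).-tuple R => F w)
    _ (fun v => cat_tuple u v)).
    exact: mF.
  exact: (measurable_fun_pair2 _ (@measurable_cat_tuple R _ _)).
rewrite (integral_lebesgue_tuple_cat (F := fun s => F (u ++ s)%SEQ) (erefl _) mFu)//.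
rewrite integral_lebesgue_col//; last 2 first.
- exact: (measurable_fun_pair2 _ mf2).
- by move=> v; exact: integral_ge0.
apply: eq_integral => v _.
have mFuv : measurable_fun setT (fun o : 1.-tuple R => F (u ++ (v ++ o))%SEQ).
  apply: (@measurableT_comp _ _ _ _ _ _ (fun w : (p + 1).-tuple R => F (u ++ w)%SEQ)
    _ (fun o => cat_tuple v o)) => //.
  exact: (measurable_fun_pair2 _ (@measurable_cat_tuple R _ _)).
have F0 w : 0 <= F w by exact: f0.
rewrite (integral_lebesgue_tupleS mFuv)//.
apply: eq_integral => o _; rewrite integral_lebesgue_tuple0; last first.
  apply: (measurableT_comp mFuv).
  by apply: (@measurable_cons _ _ _ _ (cst o) _ id).
set w := cat_tuple u (cat_tuple v [tuple o]).
rewrite -(@sym_of_tuple_cat p u v [tuple o] _ w (esym eN))//.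
by rewrite /F/sym_of_tuple; congr f; apply/matrixP => i j; rewrite !mxE val_tcast.
all: by move=> ?; exact: f0.
Qed.

End lebesgue_blocks.

(** * Quadratic forms and Schur complements *)

Lemma quadratic_ge0_slope (R : realFieldType) (s q : R) : 0 < s -> 0 <= q ->
  ~ (forall t, 0 <= 2 * t * s + t ^+ 2 * q).
Proof.
(* The minimum is at - s / q; 1 + q avoids a division by 0. *)
move=> s0 q0 /(_ (- (s / (1 + q)))).
have -> : 2 * (- (s / (1 + q))) * s + (- (s / (1 + q))) ^+ 2 * q =
  - ((s / (1 + q)) ^+ 2 * (2 + q)) by field; lra.
apply/negP; rewrite -ltNge oppr_lt0 mulr_gt0//; last by lra.
by rewrite exprn_gt0// divr_gt0//; lra.
Qed.

Section quadratic_forms.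
Context {R : realType}.

Definition quad p (M : 'M[R]_p) (x : 'cV[R]_p) : R := (x^T *m M *m x) 0 0.

Lemma quadD p (M N : 'M[R]_p) x : quad (M + N) x = quad M x + quad N x.
Proof. by rewrite /quad mulmxDr mulmxDl mxE. Qed.

Lemma quadZ p a (M : 'M[R]_p) x : quad (a *: M) x = a * quad M x.
Proof. by rewrite /quad -scalemxAr -scalemxAl mxE. Qed.

Lemma quad_scale p (M : 'M[R]_p) a x : quad M (a *: x) = a ^+ 2 * quad M x.
Proof.
rewrite /quad; have -> : (a *: x)^T = a *: x^T by exact: linearZ.
by rewrite -scalemxAr -!scalemxAl !mxE expr2 mulrA.
Qed.

Lemma quad0 p (M : 'M[R]_p) : quad M 0 = 0.
Proof. by rewrite /quad mulmx0 mxE. Qed.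

Lemma mul_mx11 (x y : 'M[R]_1) : (x *m y) 0 0 = x 0 0 * y 0 0.
Proof. by rewrite mxE big_ord_recl big_ord0 addr0. Qed.

Lemma quad_outer p (v x : 'cV[R]_p) : quad (v *m v^T) x = ((v^T *m x) 0 0) ^+ 2.
Proof.
rewrite /quad mulmxA -mulmxA mul_mx11 expr2; congr (_ * _).
by rewrite -[x^T *m v]trmxK trmx_mul trmxK mxE.
Qed.

Lemma quad_addl p (M : 'M[R]_p) x y : M^T = M ->
  quad M (x + y) = quad M x + 2 * (y^T *m M *m x) 0 0 + quad M y.
Proof.
move=> sM; rewrite /quad; have -> : (x + y)^T = x^T + y^T by exact: raddfD.
have D (A B : 'M[R]_1) : (A + B) 0 0 = A 0 0 + B 0 0 by rewrite mxE.
rewrite !mulmxDl !mulmxDr !D.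
have -> : (x^T *m M *m y) 0 0 = (y^T *m M *m x) 0 0.
  have -> : x^T *m M *m y = (y^T *m M *m x)^T by rewrite !trmx_mul trmxK sM mulmxA.
  by rewrite mxE.
by ring.
Qed.

Lemma posdef_sym p (M : 'M[R]_p) : posdef M -> M^T = M. Proof. by case. Qed.

Lemma posdef_quad_gt0 p (M : 'M[R]_p) x : posdef M -> x != 0 -> 0 < quad M x.
Proof. by case=> _; apply. Qed.

Lemma psd_quad_ge0 p (M : 'M[R]_p) x : psd M -> 0 <= quad M x.
Proof. by case=> _; apply. Qed.

Lemma posdef_psd p (M : 'M[R]_p) : posdef M -> psd M.
Proof.
move=> pM; split=> [|x]; first exact: posdef_sym.
have [->|x0] := eqVneq x 0; first by rewrite mulmx0 mxE.
exact/ltW/(posdef_quad_gt0 pM).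
Qed.

(** If [quad M x = 0], then t |-> quad M (x + t M x) is nonnegative and vanishes at
    0, where its slope is 2 |M x|^2; hence M x = 0. *)
Lemma psd_unit_posdef p (M : 'M[R]_p) : psd M -> M \in unitmx -> posdef M.
Proof.
move=> pM uM; have sM : M^T = M by case: pM.
split=> // x x0; rewrite -/(quad M x) lt_neqAle psd_quad_ge0// andbT eq_sym.
apply/eqP => qx; apply/negP: x0; rewrite negbK.
suff Mx0 : M *m x = 0 by rewrite -(mulKmx uM x) Mx0 mulmx0.
set y := M *m x; apply/eqP; apply: contraT => y0.
have yy : 0 < (y^T *m y) 0 0.
  rewrite mxE; have [i yi] : exists i, y i 0 != 0.
    apply/existsP; apply: contraNT y0; rewrite negb_exists => /forallP yi.
    by apply/eqP/colP => i; have := yi i; rewrite negbK => /eqP ->; rewrite mxE.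
  rewrite (bigD1 i)//= mxE ltr_wpDr//; last by rewrite -expr2 exprn_even_gt0.
  by apply: sumr_ge0 => j _; rewrite mxE -expr2 sqr_ge0.
have key (t : R) : 0 <= 2 * t * (y^T *m y) 0 0 + t ^+ 2 * quad M y.
  have := psd_quad_ge0 (x + t *: y) pM.
  rewrite quad_addl// [quad M x]qx add0r quad_scale.
  have -> : (t *: y)^T = t *: y^T by exact: linearZ.
  by rewrite -!scalemxAl [X in 2 * X]mxE -mulmxA mulrA.
by case: (quadratic_ge0_slope yy (psd_quad_ge0 y pM) key).
Qed.

Lemma sym_blockE p (M : 'M[R]_(p + 1)) : M^T = M ->
  M = block_mx (ulsubmx M) (ursubmx M) (ursubmx M)^T (drsubmx M 0 0)%:M.
Proof.
move=> sM; rewrite -mx11_scalar trmx_ursub sM submxK//.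
Qed.

Lemma quad_block p (M : 'M[R]_p) (v x : 'cV[R]_p) (a s : R) :
  quad (block_mx M v v^T a%:M) (col_mx x s%:M) =
  quad M x + 2 * s * (v^T *m x) 0 0 + a * s ^+ 2.
Proof.
rewrite /quad tr_col_mx mul_row_block mul_row_col !mulmxDl.
have D (A B : 'M[R]_1) : (A + B) 0 0 = A 0 0 + B 0 0 by rewrite mxE.
rewrite !D !tr_scalar_mx -!mulmxA !mul_mx11 !mulmxA mul_mx11.
have -> : (x^T *m v) 0 0 = (v^T *m x) 0 0.
  by rewrite -[x^T *m v]trmxK trmx_mul trmxK mxE.
have sE (b : R) : (b%:M : 'M[R]_1) 0 0 = b by rewrite mxE mulr1n.
by rewrite !sE; ring.
Qed.

Lemma quad_block_schur p (M : 'M[R]_p) (v x : 'cV[R]_p) (a s : R) : a != 0 ->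
  quad (block_mx M v v^T a%:M) (col_mx x s%:M) =
  a * (s + (v^T *m x) 0 0 / a) ^+ 2 + quad (M - a^-1 *: (v *m v^T)) x.
Proof.
move=> a0; rewrite quad_block quadD -scaleNr quadZ quad_outer.
by field.
Qed.

Lemma det_block_schur p (M : 'M[R]_p) (v : 'cV[R]_p) (a : R) : a != 0 ->
  \det (block_mx M v v^T a%:M) = a * \det (M - a^-1 *: (v *m v^T)).
Proof.
move=> a0.
have -> : block_mx M v v^T a%:M = block_mx 1%:M (a^-1 *: v) 0 1%:M *m
   block_mx (M - a^-1 *: (v *m v^T)) 0 v^T a%:M.
  rewrite mulmx_block !mul1mx !mul0mx !add0r -scalemxAl subrK.
  by rewrite -scalemxAl mul_mx_scalar scalerA mulVf// scale1r.
by rewrite det_mulmx det_ublock !det1 !mul1r det_lblock det_scalar1 mulrC.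
Qed.

Lemma posdef_block p (M : 'M[R]_p) (v : 'cV[R]_p) (a : R) :
  posdef (block_mx M v v^T a%:M) -> 0 < a /\ posdef (M - a^-1 *: (v *m v^T)).
Proof.
move=> pB; have a0 : 0 < a.
  have := posdef_quad_gt0 (x := col_mx 0 1%:M) pB.
  rewrite quad_block quad0 mulmx0 mxE mulr0 !add0r expr1n mulr1; apply.
  apply/eqP => /matrixP /(_ (rshift p 0) 0) /eqP.
  by rewrite col_mxEd !mxE eqxx oner_eq0.
split=> //; split.
  have := posdef_sym pB; rewrite tr_block_mx => /eq_block_mx[sM _ _ _].
  rewrite linearB/= sM linearZ/= trmx_mul trmxK//.
move=> x x0; rewrite -/(quad _ x).
have := posdef_quad_gt0 (x := col_mx x (- ((v^T *m x) 0 0 / a))%:M) pB.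
rewrite quad_block_schur ?gt_eqF// addNr expr0n mulr0 add0r; apply.
apply: contra x0 => /eqP /matrixP x0; apply/eqP/matrixP => i j.
by have := x0 (lshift 1 i) j; rewrite col_mxEu !mxE.
Qed.

(** Pivoting on the last diagonal entry replaces a positive definite matrix by its
    Schur complement, which is positive definite of smaller size. *)
Lemma posdef_ind (P : forall p, 'M[R]_p -> Prop) :
  (forall M : 'M[R]_0, P 0%N M) ->
  (forall p (M : 'M[R]_p) v a, 0 < a -> posdef (block_mx M v v^T a%:M) ->
    posdef (M - a^-1 *: (v *m v^T)) -> P p (M - a^-1 *: (v *m v^T)) ->
    P (p + 1)%N (block_mx M v v^T a%:M)) ->
  forall p (M : 'M[R]_p), posdef M -> P p M.
Proof.
move=> P0 PS; elim=> [|p IH] M pM; first exact: P0.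
move: M pM; rewrite -addn1 => M pM.
have e := sym_blockE (posdef_sym pM); move: pM; rewrite {}e => pM.
by have [a0 pS] := posdef_block pM; apply: PS => //; exact: IH.
Qed.

Lemma posdef_det_gt0 p (M : 'M[R]_p) : posdef M -> 0 < \det M.
Proof.
move: p M; apply: posdef_ind => [M|p M v a a0 pB pS IH].
  by rewrite det_mx00.
by rewrite det_block_schur ?gt_eqF// mulr_gt0.
Qed.

Lemma posdef_unit p (M : 'M[R]_p) : posdef M -> M \in unitmx.
Proof. by move=> /posdef_det_gt0 d0; rewrite unitmxE unitfE gt_eqF. Qed.

(** The form of the inverse at x is the form of M at [invmx M *m x]. *)
Lemma posdef_inv p (M : 'M[R]_p) : posdef M -> posdef (invmx M).
Proof.
move=> pM; have uM := posdef_unit pM; split=> [|x x0].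
  by rewrite trmx_inv posdef_sym.
have := posdef_quad_gt0 (x := invmx M *m x) pM.
rewrite /quad trmx_mul trmx_inv posdef_sym// -!mulmxA mulKVmx//; apply.
by apply: contra x0 => /eqP Mx; rewrite -(mulKVmx uM x) Mx mulmx0.
Qed.

Lemma posdefD p (M N : 'M[R]_p) : posdef M -> psd N -> posdef (M + N).
Proof.
move=> pM pN; split; first by rewrite linearD/= posdef_sym//; case: pN => ->.
move=> x x0; rewrite -/(quad _ x) quadD ltr_wpDr//; last exact: posdef_quad_gt0.
exact: psd_quad_ge0.
Qed.

Lemma posdefZ p a (M : 'M[R]_p) : 0 < a -> posdef M -> posdef (a *: M).
Proof.
move=> a0 pM; split; first by rewrite linearZ/= posdef_sym.
by move=> x x0; rewrite -/(quad _ x) quadZ mulr_gt0// posdef_quad_gt0.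
Qed.

Lemma quad1E p (u : 'cV[R]_p) : quad 1%:M u = \sum_i u i 0 ^+ 2.
Proof. by rewrite /quad mulmx1 mxE; apply: eq_bigr => i _; rewrite mxE expr2. Qed.

Lemma quad1_ge0 p (u : 'cV[R]_p) : 0 <= quad 1%:M u.
Proof. by rewrite quad1E; apply: sumr_ge0 => i _; exact: sqr_ge0. Qed.

Lemma quad1_gt0 p (u : 'cV[R]_p) : u != 0 -> 0 < quad 1%:M u.
Proof.
move=> u0; rewrite lt_neqAle quad1_ge0 andbT eq_sym quad1E psumr_neq0; last first.
  by move=> i _; exact: sqr_ge0.
apply/hasP; have [i ui] : exists i, u i 0 != 0.
  apply/existsP; apply: contraNT u0; rewrite negb_exists => /forallP ui.
  by apply/eqP/colP => i; have := ui i; rewrite negbK => /eqP ->; rewrite mxE.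
by exists i; rewrite ?mem_index_enum//= exprn_even_gt0.
Qed.

Lemma psd1 p : psd (1%:M : 'M[R]_p).
Proof. by split; [rewrite tr_scalar_mx|move=> u; exact: quad1_ge0]. Qed.

Lemma posdef1 p : posdef (1%:M : 'M[R]_p).
Proof. exact: psd_unit_posdef (psd1 p) (unitmx1 R p). Qed.

End quadratic_forms.

(** * Gaussian integrals *)

Section gaussian_integral.
Context {R : realType}.
Local Notation mu := (@lebesgue_measure R).

Lemma measurable_quad d (U : measurableType d) p (A : U -> 'M[R]_p) (x : U -> 'cV[R]_p) :
  measurable_fun setT A -> measurable_fun setT x ->
  measurable_fun setT (fun u => quad (A u) (x u)).
Proof.
move=> mA mx; apply: measurable_fun_mxentry; apply: measurable_fun_mulmx => //.
by apply: measurable_fun_mulmx => //; exact: measurable_fun_trmx.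
Qed.

Lemma measurable_expR_quad p (M : 'M[R]_p) :
  measurable_fun setT (fun x => (expR (- quad M x / 2))%:E).
Proof.
apply/measurable_EFinP; apply: measurableT_comp; first exact: measurable_expR.
apply: measurable_funM => //; apply: measurable_funN.
by apply: measurable_quad => //; exact: measurable_cst.
Qed.

Lemma integral_gauss_line (a m : R) : 0 < a ->
  (\int[mu]_s (expR (- (a * (s + m) ^+ 2) / 2))%:E = (Num.sqrt (2 * pi / a))%:E)%E.
Proof.
move=> a0.
rewrite (@integral_lebesgue_addr _ m (fun s => (expR (- (a * s ^+ 2) / 2))%:E)); last 2 first.
- apply/measurable_EFinP; apply: measurableT_comp; first exact: measurable_expR.
  apply: measurable_funM => //; apply: measurable_funN; apply: measurable_funM => //.
- by move=> x; rewrite lee_fin expR_ge0.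
have s0 : (Num.sqrt a)^-1 != 0 by rewrite invr_neq0// gt_eqF// sqrtr_gt0.
have := integral_normal_pdf 0 (Num.sqrt a)^-1.
rewrite normal_pdfE//.
under eq_integral do rewrite EFinM.
have sE : (Num.sqrt a)^-1 ^+ 2 = a^-1 by rewrite exprVn sqr_sqrtr// ltW.
rewrite ge0_integralZl//=; last 3 first.
- by apply/measurable_EFinP; exact: measurable_normal_fun.
- by move=> x _; rewrite lee_fin normal_fun_ge0.
- by rewrite lee_fin normal_peak_ge0.
have np0 : 0 < normal_peak (Num.sqrt a)^-1 by exact: normal_peak_gt0.
move=> /(congr1 (fun y => ((normal_peak (Num.sqrt a)^-1)^-1%:E * y)%E)).
rewrite muleA -EFinM mulVf ?gt_eqF// mul1e mule1 /normal_peak invrK sE.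
rewrite -mulrnAr -mulr_natr (_ : a^-1 * _ = 2 * pi / a) => [<-|]; last by ring.
apply: eq_integral => x _; congr (expR _)%:E; rewrite subr0 sE.
by rewrite -mulr_natr; field; rewrite gt_eqF.
Qed.

Lemma integral_lebesgue_col_rcons p (f : 'cV[R]_(p + 1) -> \bar R) :
  measurable_fun setT f -> (forall x, 0 <= f x)%E ->
  (\int[lebesgue_col (p + 1)]_x f x =
   \int[lebesgue_col p]_t \int[mu]_s f (col_mx t s%:M))%E.
Proof.
move=> mf f0.
have mf2 : measurable_fun setT (fun x : 'cV[R]_p * R => f (col_mx x.1 x.2%:M)).
  apply: (measurableT_comp mf); apply: measurable_fun_col_mx; first exact: measurable_fst.
  by apply: measurable_fun_scalar_mx; exact: measurable_snd.
have mf1 : measurable_fun setT (fun t : 'cV[R]_p => \int[mu]_s f (col_mx t s%:M))%E.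
  exact: (measurable_lebesgue_section (F := fun t s => f (col_mx t s%:M))).
rewrite integral_lebesgue_col// [RHS]integral_lebesgue_col//; last first.
  by move=> t; exact: integral_ge0.
pose F (w : seq R) := f (\col_i nth 0 w i).
have FE : (fun w : (p + 1).-tuple R => f (col_of_tuple w)) =
    (fun w : (p + 1).-tuple R => F w).
  by apply/funext => u; congr f; apply/colP => i; rewrite !mxE (tnth_nth 0).
have F0 w : (0 <= F w)%E by exact: f0.
have mF : measurable_fun setT (fun w : (p + 1).-tuple R => F w).
  rewrite -FE.
  exact: (measurableT_comp mf (@measurable_col_of_tuple _ _)).
rewrite FE (integral_lebesgue_tuple_cat (erefl _) mF)//.
apply: eq_integral => v _.
have mFv : measurable_fun setT (fun o : 1.-tuple R => F (v ++ o)%SEQ).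
  apply: (@measurableT_comp _ _ _ _ _ _ (fun w : (p + 1).-tuple R => F w)
    _ (fun o => cat_tuple v o)) => //.
  exact: (measurable_fun_pair2 _ (@measurable_cat_tuple R _ _)).
rewrite (integral_lebesgue_tupleS mFv)//.
apply: eq_integral => o _; rewrite integral_lebesgue_tuple0; last first.
  apply: (measurableT_comp mFv).
  by apply: (@measurable_cons _ _ _ _ (cst o) _ id).
congr f; apply/colP => i; rewrite !mxE nth_cat (size_tuple v).
case: fintype.splitP => k /= ik; rewrite !mxE ik.
  by rewrite (tnth_nth 0).
by rewrite addKn !ord1 mulr1n.
Qed.

(** Completing the square in the last coordinate leaves the form of the Schur
    complement in the other ones. *)
Lemma integral_gauss_quad p (M : 'M[R]_p) : posdef M ->
  (\int[lebesgue_col p]_x (expR (- quad M x / 2))%:E =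
   (Num.sqrt ((2 * pi) ^+ p / \det M))%:E)%E.
Proof.
move: p M; apply: posdef_ind => [M|p M v a a0 pB pS IH].
  rewrite integral_lebesgue_col; [|exact: measurable_expR_quad|
    by move=> x; rewrite lee_fin expR_ge0].
  rewrite integral_lebesgue_tuple0; last first.
    apply: (measurableT_comp (measurable_expR_quad M)).
    exact: measurable_col_of_tuple.
  rewrite expr0 det_mx00 divr1 sqrtr1 /quad (_ : col_of_tuple _ = 0).
    by rewrite mulmx0 mxE oppr0 mul0r expR0.
  by apply/matrixP => -[].
rewrite integral_lebesgue_col_rcons; [|exact: measurable_expR_quad|
  by move=> x; rewrite lee_fin expR_ge0].
have dS := posdef_det_gt0 pS.
transitivity (\int[lebesgue_col p]_t ((Num.sqrt (2 * pi / a))%:E *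
    (expR (- quad (M - a^-1 *: (v *m v^T)) t / 2))%:E))%E.
  apply: eq_integral => t _.
  rewrite muleC -(integral_gauss_line ((v^T *m t) 0 0 / a) a0) -ge0_integralZl//.
  - apply: eq_integral => s _.
    by rewrite quad_block_schur ?gt_eqF// -EFinM -expRD; congr (expR _)%:E; ring.
  - apply/measurable_EFinP; apply: measurableT_comp; first exact: measurable_expR.
    apply: measurable_funM => //; apply: measurable_funN; apply: measurable_funM => //.
    by apply: measurable_funX; exact: measurable_funD.
rewrite ge0_integralZl//; last exact: measurable_expR_quad.
rewrite IH -EFinM -sqrtrM; last by rewrite divr_ge0 ?mulr_ge0 ?pi_ge0// ltW.
rewrite det_block_schur ?gt_eqF// addn1 exprS; congr (Num.sqrt _)%:E.
by field; rewrite !gt_eqF.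
Qed.

(** The translation by [invmx M *m al] completes the square. *)
Lemma integral_gauss_quad_lin p (M : 'M[R]_p) (al : 'cV[R]_p) : posdef M ->
  (\int[lebesgue_col p]_x (expR (- (quad M x + 2 * (al^T *m x) 0 0) / 2))%:E =
   (Num.sqrt ((2 * pi) ^+ p / \det M) * expR (quad (invmx M) al / 2))%:E)%E.
Proof.
move=> pM; have uM := posdef_unit pM; have sM := posdef_sym pM.
rewrite EFinM -integral_gauss_quad//.
rewrite -(@integral_lebesgue_col_addr R p (invmx M *m al)
  (fun x => (expR (- quad M x / 2))%:E)); last 2 first.
- exact: measurable_expR_quad.
- by move=> x; rewrite lee_fin expR_ge0.
have mq : measurable_fun setT
    (fun x : 'cV[R]_p => (expR (- quad M (x + invmx M *m al) / 2))%:E).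
  apply: (measurableT_comp (measurable_expR_quad M)).
  by apply: measurable_fun_addmx => //; exact: measurable_cst.
rewrite -(ge0_integralZr _ measurableT mq)//.
apply: eq_integral => x _; rewrite -EFinM -expRD; congr (expR _)%:E.
rewrite quad_addl//.
have -> : (invmx M *m al)^T *m M *m x = al^T *m x.
  by rewrite trmx_mul trmx_inv sM -!mulmxA mulKmx.
have -> : quad M (invmx M *m al) = quad (invmx M) al.
  by rewrite /quad trmx_mul trmx_inv sM -!mulmxA mulKVmx.
by ring.
Qed.

(** The integral of exp(- quad M x / 2) decreases with the form and determines the
    determinant. *)
Lemma det_le_loewner p (M N : 'M[R]_p) : posdef M -> posdef N ->
  (forall x, quad M x <= quad N x) -> \det M <= \det N.
Proof.
move=> pM pN MN; have dM := posdef_det_gt0 pM; have dN := posdef_det_gt0 pN.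
have : (\int[lebesgue_col p]_x (expR (- quad N x / 2))%:E <=
        \int[lebesgue_col p]_x (expR (- quad M x / 2))%:E)%E.
  apply: ge0_le_integral => //.
  - exact: measurable_expR_quad.
  - exact: measurable_expR_quad.
  - by move=> x _; rewrite lee_fin ler_expR ler_wpM2r ?invr_ge0// lerN2.
have tp : 0 < (2 * pi) ^+ p :> R by rewrite exprn_gt0// mulr_gt0// pi_gt0.
rewrite !integral_gauss_quad// lee_fin ler_sqrt; last by rewrite divr_ge0 ?ltW.
by rewrite ler_pM2l// lef_pV2.
Qed.

End gaussian_integral.

(** * Log-gamma densities and pivots of block matrices *)

Section log_gamma_convolution.
Context {R : realType}.
Local Notation mu := (@lebesgue_measure R).

(** The expectation of f (z + Y) for a random Y of density g. Correlating, rather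
    than convolving, lets the random terms of a sum be added one at a time. *)
Definition conv (g : R -> R) (f : R -> \bar R) (z : R) : \bar R :=
  (\int[mu]_x (f (z + x)%R * (g x)%:E))%E.

(** The unnormalized density of log (Y / c) for Y a gamma variable of shape c and
    scale 1. It peaks at 0 with value 1. *)
Definition log_gamma_fun (c x : R) : R := expR (- (c * (expR x - 1 - x))).

Fixpoint conv_log_gamma p (c : R) (f : R -> \bar R) : R -> \bar R :=
  if p is q.+1 then conv_log_gamma q (c + 2^-1) (conv (log_gamma_fun c) f) else f.

Lemma measurable_log_gamma_fun c : measurable_fun setT (log_gamma_fun c).
Proof.
apply: measurableT_comp; first exact: measurable_expR.
apply: measurable_funN; apply: measurable_funM => //.
apply: measurable_funB => //; apply: measurable_funB => //.
Qed.

Lemma log_gamma_fun_ge0 c x : 0 <= log_gamma_fun c x.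
Proof. exact: expR_ge0. Qed.

Lemma conv_ge0 g f z : (forall x, 0 <= g x) -> (forall x, 0 <= f x)%E -> (0 <= conv g f z)%E.
Proof. by move=> g0 f0; apply: integral_ge0 => x _; rewrite mule_ge0 ?lee_fin. Qed.

Lemma measurable_convolute (g : R -> R) (f : R -> \bar R) : measurable_fun setT g -> (forall x, 0 <= g x) ->
  measurable_fun setT f -> (forall x, 0 <= f x)%E -> measurable_fun setT (conv g f).
Proof.
move=> mg g0 mf f0.
rewrite /conv; apply: (@measurable_lebesgue_section R _ R (fun z x => f (z + x)%R * (g x)%:E)%E).
  apply: emeasurable_funM.
    apply: (measurableT_comp mf); apply: measurable_funD.
      exact: measurable_fst.
    exact: measurable_snd.
  by apply/measurable_EFinP; apply: (measurableT_comp mg); exact: measurable_snd.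
by move=> u x; rewrite mule_ge0 ?lee_fin.
Qed.

Lemma conv_addr g f h z : conv g (fun u => f (u + h)) z = conv g f (z + h).
Proof. by rewrite /conv; apply: eq_integral => x _; rewrite addrAC. Qed.

Lemma conv_log_gamma_addr p c f h z :
  conv_log_gamma p c (fun u => f (u + h)) z = conv_log_gamma p c f (z + h).
Proof.
elim: p c f => [//|p IH] c f /=; rewrite -IH; congr (conv_log_gamma p _ _ z).
by apply/funext => u; rewrite conv_addr.
Qed.

(** Substitute y = (2c/a) e^x, where 2c/a is the mean of the gamma law of shape c and
    rate a/2. *)
Lemma integral_gamma_log (f : R -> \bar R) (c a L : R) : 0 < c -> 0 < a ->
  measurable_fun setT f -> (forall x, 0 <= f x)%E ->
  (\int[mu]_(y in `]0%R, +oo[) (f (L + ln y)%R * (expR ((c - 1) * ln y - a * y / 2))%:E) =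
   (expR (c * ln (2 * c / a) - c))%:E * conv (log_gamma_fun c) f (L + ln (2 * c / a))%R)%E.
Proof.
move=> c0 a0 mf f0; set m := ln (2 * c / a).
pose G x : \bar R := (f (L + x)%R * (expR (c * x - a * expR x / 2))%:E)%E.
have mG : measurable_fun setT G.
  apply: emeasurable_funM; first by apply: (measurableT_comp mf); exact: measurable_funD.
  apply/measurable_EFinP; apply: measurableT_comp; first exact: measurable_expR.
  apply: measurable_funB; apply: measurable_funM => //.
  by apply: measurable_funM => //; exact: measurable_expR.
have G0 x : (0 <= G x)%E by rewrite mule_ge0 ?lee_fin ?expR_ge0.
rewrite (integral_lebesgue_expR
  (f := fun y => (f (L + ln y)%R * (expR ((c - 1) * ln y - a * y / 2))%:E)%E)); last 2 first.
- apply: emeasurable_funM.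
    apply: (measurableT_comp mf); apply: measurable_funD => //; exact: measurable_ln.
  apply/measurable_EFinP; apply: measurableT_comp; first exact: measurable_expR.
  by apply: measurable_funB; apply: measurable_funM => //; exact: measurable_funM.
- by move=> x; rewrite mule_ge0 ?lee_fin ?expR_ge0.
transitivity (\int[mu]_x G x)%E.
  apply: eq_integral => x _; rewrite /G expRK -muleA -EFinM -expRD.
  by congr (_ * (expR _)%:E)%E; ring.
rewrite -(integral_lebesgue_addr m mG G0) /conv -ge0_integralZl//.
- apply: eq_integral => x _; rewrite /G muleCA -EFinM -expRD.
  congr (f _ * (expR _)%:E)%E; first by ring.
  rewrite expRD [expR m]lnK ?posrE ?divr_gt0 ?mulr_gt0//.
  by field; rewrite gt_eqF.
- apply: emeasurable_funM.
    by apply: (measurableT_comp mf); exact: measurable_funD.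
  by apply/measurable_EFinP; exact: measurable_log_gamma_fun.
- by move=> x _; rewrite mule_ge0 ?lee_fin ?log_gamma_fun_ge0.
Qed.

End log_gamma_convolution.

Section psd_blocks.
Context {R : realType}.

Lemma quad_block_pivot p (O : 'M[R]_p) (v x : 'cV[R]_p) (o s : R) :
  O^T = O -> O \in unitmx ->
  quad (block_mx O v v^T o%:M) (col_mx x s%:M) =
  quad O (x + s *: (invmx O *m v)) + s ^+ 2 * (o - quad (invmx O) v).
Proof.
move=> sO uO; rewrite quad_block quad_addl// quad_scale.
have -> : (s *: (invmx O *m v))^T = s *: (invmx O *m v)^T by exact: linearZ.
have E1 : (invmx O *m v)^T *m O = v^T.
  by rewrite trmx_mul trmx_inv sO -mulmxA mulVmx// mulmx1.
have Z b (A : 'M[R]_1) : (b *: A) 0 0 = b * A 0 0 by rewrite mxE.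
rewrite -!scalemxAl Z E1.
have -> : quad O (invmx O *m v) = quad (invmx O) v by rewrite /quad E1 mulmxA.
by ring.
Qed.

Lemma det_block_pivot p (O : 'M[R]_p) (v : 'cV[R]_p) (o : R) : O \in unitmx ->
  \det (block_mx O v v^T o%:M) = \det O * (o - quad (invmx O) v).
Proof.
move=> uO.
have -> : block_mx O v v^T o%:M = block_mx 1%:M 0 (v^T *m invmx O) 1%:M *m
   block_mx O v 0 (o - quad (invmx O) v)%:M.
  rewrite mulmx_block !mul1mx !mul0mx !addr0 /quad -!mulmxA mulVmx// mulmx1.
  have -> : (o - (v^T *m (invmx O *m v)) 0 0)%:M =
      o%:M - ((v^T *m (invmx O *m v)) 0 0)%:M :> 'M[R]_1 by exact: raddfB.
  by rewrite -mx11_scalar addrC subrK.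
by rewrite det_mulmx det_lblock !det1 !mul1r det_ublock det_scalar1.
Qed.

(** Restrict the form to vectors whose last coordinate is 0. *)
Lemma psd_block_ul p (O : 'M[R]_p) (v : 'cV[R]_p) (o : R) :
  psd (block_mx O v v^T o%:M) -> psd O.
Proof.
move=> pB; split.
  by case: pB; rewrite tr_block_mx => /eq_block_mx[sM _ _ _] _.
move=> x; have := psd_quad_ge0 (col_mx x 0%:M) pB.
by rewrite quad_block expr0n/= !mulr0 mul0r !addr0.
Qed.

(** By [quad_block_pivot] the form is that of O plus the square of the last
    coordinate times the pivot. *)
Lemma psd_blockE p (O : 'M[R]_p) (v : 'cV[R]_p) (o : R) : posdef O ->
  psd (block_mx O v v^T o%:M) <-> quad (invmx O) v <= o.
Proof.
move=> pO; have uO := posdef_unit pO; have sO := posdef_sym pO; split=> [pB|qo].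
  have := psd_quad_ge0 (col_mx (- (invmx O *m v)) 1%:M) pB.
  by rewrite quad_block_pivot// scale1r addNr quad0 add0r expr1n mul1r subr_ge0.
split=> [|y]; first by rewrite tr_block_mx sO trmxK tr_scalar_mx.
rewrite -/(quad _ y) -[y](@vsubmxK _ p 1 1) [dsubmx y]mx11_scalar quad_block_pivot//.
rewrite addr_ge0//; first exact/psd_quad_ge0/posdef_psd.
by rewrite mulr_ge0 ?sqr_ge0// subr_ge0.
Qed.

Lemma mxtrace_block_mul p (O A : 'M[R]_p) (v al : 'cV[R]_p) (o a : R) :
  \tr (block_mx O v v^T o%:M *m block_mx A al al^T a%:M) =
  \tr (O *m A) + 2 * (al^T *m v) 0 0 + o * a.
Proof.
rewrite mulmx_block mxtrace_block !raddfD/= (mxtrace_mulC v).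
have -> : \tr (al^T *m v) = (al^T *m v) 0 0 by rewrite /mxtrace big_ord_recl big_ord0 addr0.
have -> : \tr (v^T *m al) = (al^T *m v) 0 0.
  by rewrite -mxtrace_tr trmx_mul trmxK /mxtrace big_ord_recl big_ord0 addr0.
have -> : \tr (o%:M *m a%:M : 'M[R]_1) = o * a.
  by rewrite -scalar_mxM mxtrace_scalar.
by ring.
Qed.

Lemma mxtrace_mul_outer p (O : 'M[R]_p) (al : 'cV[R]_p) :
  \tr (O *m (al *m al^T)) = quad O al.
Proof.
by rewrite mulmxA mxtrace_mulC mulmxA /quad /mxtrace big_ord_recl big_ord0 addr0.
Qed.

End psd_blocks.

(** * The log-determinant under a Wishart weight *)

Section wishart_integral.
Context {R : realType}.
Local Notation mu := (@lebesgue_measure R).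
Local Open Scope ereal_scope.

Lemma measurable_det0 p : measurable [set O : 'M[R]_p | (\det O = 0)%R].
Proof.
have := @measurable_det R p measurableT [set 0%R] (measurable_set1 _).
by rewrite setTI.
Qed.

(** For invertible O' the determinant is affine and nonconstant in the corner entry
    o, so it vanishes for one value of o only. *)
Lemma lebesgue_sym_det0 p : lebesgue_sym p [set O : 'M[R]_p | (\det O = 0)%R] = 0.
Proof.
elim: p => [|p IH].
  rewrite (_ : [set O | _] = set0) ?measure0//.
  by apply/seteqP; split => // O /=; rewrite det_mx00 => /eqP; rewrite oner_eq0.
rewrite -addn1; set N' := [set O : 'M[R]_(p + 1) | _].
have mN' : measurable N' := @measurable_det0 (p + 1).
have mi : measurable_fun setT (fun O : 'M[R]_(p + 1) => (\1_N' O : R)%:E).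
  by apply/measurable_EFinP; exact: measurable_indic.
transitivity (\int[lebesgue_sym (p + 1)]_O (\1_N' O : R)%:E).
  by rewrite integral_indic// setIT.
have i0 (O : 'M[R]_(p + 1)) : 0 <= (\1_N' O : R)%:E by rewrite lee_fin.
rewrite integral_lebesgue_symS//.
rewrite (ge0_negligible_integral (@measurable_det0 p) measurableT
  (measurable_lebesgue_sym_section mi i0))//; last first.
  by move=> O _; apply: integral_ge0 => v _; exact: integral_ge0.
apply: integral0_eq => O [_ /= /eqP dO].
have uO : O \in unitmx by rewrite unitmxE unitfE.
apply: integral0_eq => v _.
rewrite -[RHS](@lebesgue_measure_set1 R (quad (invmx O) v)).
rewrite -[X in mu X]setIT -integral_indic//; apply: eq_integral => o _; congr EFin.
rewrite !indicE; congr (_%:R); congr nat_of_bool.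
apply/idP/idP; rewrite !inE /N'/= det_block_pivot//.
  by move/eqP; rewrite mulf_eq0 (negbTE dO)/= subr_eq0 => /eqP.
by move=> ->; rewrite subrr mulr0.
Qed.

Definition wishart_integrand p (s : R) (A : 'M[R]_p) (f : R -> \bar R) (O : 'M[R]_p)
    : \bar R :=
  (\1_(@psd R p) O)%:E *
  (f (ln (\det O)) * (expR (s * ln (\det O) - \tr (O *m A) / 2))%:E).

Lemma wishart_integrand_ge0 p s (A : 'M[R]_p) f O : (forall x, 0 <= f x) ->
  0 <= wishart_integrand s A f O.
Proof. by move=> f0; rewrite !mule_ge0 ?lee_fin ?expR_ge0. Qed.

Lemma measurable_wishart_integrand p s (A : 'M[R]_p) f :
  measurable_fun setT f -> measurable_fun setT (wishart_integrand s A f).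
Proof.
move=> mf.
have mld : measurable_fun setT (fun O : 'M[R]_p => ln (\det O)).
  exact: measurableT_comp (@measurable_ln R) (@measurable_det R p).
apply: emeasurable_funM.
  by apply/measurable_EFinP; apply: measurable_indic; exact: measurable_psd.
apply: emeasurable_funM; first exact: (measurableT_comp mf).
apply/measurable_EFinP; apply: measurableT_comp; first exact: measurable_expR.
apply: measurable_funB; apply: measurable_funM => //.
apply: (measurableT_comp (@measurable_trace R p)).
by apply: measurable_fun_mulmx => //; exact: measurable_cst.
Qed.

(** After the translation y = o - v^T O^-1 v, the integrand is a gamma weight in y
    supported on y >= 0. *)
Lemma wishart_integrand_line p (O A : 'M[R]_p) (v al : 'cV[R]_p) (s a : R) f :
  posdef O -> (-1 < s)%R -> (0 < a)%R -> measurable_fun setT f -> (forall x, 0 <= f x) ->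
  \int[mu]_o wishart_integrand s (block_mx A al al^T a%:M) f (block_mx O v v^T o%:M) =
  (expR (- (quad (a *: invmx O) v + 2 * (al^T *m v) 0 0) / 2))%:E *
  ((expR ((s + 1) * ln (2 * (s + 1) / a) - (s + 1)))%:E *
   ((expR (s * ln (\det O) - \tr (O *m A) / 2))%:E *
    conv (log_gamma_fun (s + 1)) f (ln (\det O) + ln (2 * (s + 1) / a)))).
Proof.
move=> pO s1 a0 mf f0; set q := quad (invmx O) v; set L := ln (\det O).
have uO := posdef_unit pO; have dO := posdef_det_gt0 pO.
set E1 := expR (- _ / 2); set E2 := expR (_ - (s + 1)); set E3 := expR (_ - _).
have mW := measurable_wishart_integrand s (block_mx A al al^T a%:M) mf.
have mline : measurable_fun setT (fun o : R =>
    wishart_integrand s (block_mx A al al^T a%:M) f (block_mx O v v^T (o : R)%:M)).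
  apply: (measurableT_comp mW); apply: measurable_fun_sym_block => //.
rewrite -(integral_lebesgue_addr q mline); last first.
  by move=> o; exact: wishart_integrand_ge0.
transitivity (\int[mu]_(y in `]0%R, +oo[) ((E1 * E3)%:E *
  (f (L + ln y)%R * (expR ((s + 1 - 1) * ln y - a * y / 2))%:E))).
  have m0 : measurable ([set 0%R] : set (measurableTypeR R)) by exact: measurable_set1.
  (* At y = 0 the matrix is singular and semi-definite: there the weight has a junk
     value, and this point is removed. *)
  rewrite (@ge0_negligible_integral _ _ _ mu setT [set 0%R]); last 5 first.
  - exact: m0.
  - exact: measurableT.
  - apply: (measurableT_comp mW); apply: measurable_fun_sym_block => //.
    exact: measurable_funD.
  - by move=> o _; exact: wishart_integrand_ge0.
  - exact: lebesgue_measure_set1.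
  rewrite integral_mkcond [RHS]integral_mkcond; apply: eq_integral => y _.
  rewrite !patchE; have [->|y0] := eqVneq y 0%R.
    by rewrite !ifF//; [rewrite mem_setE in_itv/= ltxx|apply/negbTE; rewrite notin_setE => -[_]; exact].
  rewrite ifT; last by rewrite inE; split => //=; exact/eqP.
  rewrite mem_setE in_itv/= andbT; case: ltP => [yp|yn].
    rewrite /wishart_integrand indicE mem_set ?mul1e; last first.
      by apply/(psd_blockE _ _ pO); rewrite lerDr ltW.
    rewrite det_block_pivot// addrK lnM ?posrE// mxtrace_block_mul muleCA -EFinM -!expRD.
    congr (_ * (expR _)%:E); rewrite quadZ -/q -/L; by field.
  rewrite /wishart_integrand indicE memNset ?mul0e// => /(psd_blockE _ _ pO).
  by rewrite lerDr leNgt lt_neqAle y0 yn.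
rewrite ge0_integralZl//; last 3 first.
- apply: emeasurable_funM.
    apply: (measurable_funS measurableT) => //; apply: (measurableT_comp mf).
    by apply: measurable_funD => //; exact: measurable_ln.
  apply: (measurable_funS measurableT) => //.
  apply/measurable_EFinP; apply: measurableT_comp; first exact: measurable_expR.
  by apply: measurable_funB; apply: measurable_funM => //; exact: measurable_funM.
- by move=> y _; rewrite mule_ge0 ?lee_fin ?expR_ge0.
- by rewrite lee_fin mulr_ge0 ?expR_ge0.
rewrite integral_gamma_log//; last by rewrite -ltrBlDr sub0r.
by rewrite EFinM -!muleA; congr (_ * _); rewrite muleCA.
Qed.

(** The integral over v is Gaussian, with matrix a O^-1. It produces the factor
    det(O)^(1/2) that raises the exponent s by 1/2, and the term in al that turns
    A into its Schur complement. *)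
Lemma wishart_integral_block p (O A : 'M[R]_p) (al : 'cV[R]_p) (s a : R) f :
  posdef O -> (-1 < s)%R -> (0 < a)%R -> measurable_fun setT f -> (forall x, 0 <= f x) ->
  \int[lebesgue_col p]_v \int[mu]_o
     wishart_integrand s (block_mx A al al^T a%:M) f (block_mx O v v^T o%:M) =
  (Num.sqrt ((2 * pi / a) ^+ p) * expR ((s + 1) * ln (2 * (s + 1) / a) - (s + 1)))%:E *
  wishart_integrand (s + 2^-1) (A - a^-1 *: (al *m al^T))%R
    (fun z => conv (log_gamma_fun (s + 1)) f (z + ln (2 * (s + 1) / a))%R) O.
Proof.
move=> pO s1 a0 mf f0.
have dO := posdef_det_gt0 pO; have uO := posdef_unit pO.
have pM : posdef (a *: invmx O) by apply: posdefZ => //; exact: posdef_inv.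
under eq_integral do rewrite wishart_integrand_line//.
set C := _ * (_ * conv _ _ _).
have C0 : 0 <= C.
  rewrite !mule_ge0 ?lee_fin ?expR_ge0//; apply: conv_ge0 => //.
  exact: log_gamma_fun_ge0.
have mE : measurable_fun setT (fun v : 'cV[R]_p =>
    (expR (- (quad (a *: invmx O) v + 2 * (al^T *m v) 0 0) / 2))%:E).
  apply/measurable_EFinP; apply: measurableT_comp; first exact: measurable_expR.
  apply: measurable_funM => //; apply: measurable_funN; apply: measurable_funD.
    by apply: measurable_quad => //; exact: measurable_cst.
  apply: measurable_funM => //; apply: measurable_fun_mxentry.
  by apply: measurable_fun_mulmx => //; exact: measurable_cst.
rewrite ge0_integralZr//.
rewrite integral_gauss_quad_lin// /C /wishart_integrand.
rewrite indicE mem_set ?mul1e; last exact: posdef_psd.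
have iM : (invmx (a *: invmx O) = a^-1 *: O)%R.
  by rewrite invmxZ ?invmxK// posdef_unit.
have sqrt_det : Num.sqrt (\det O) = expR (ln (\det O) / 2).
  rewrite -[in LHS](@lnK _ (\det O)) ?posrE// -[X in Num.sqrt (expR X)](@divfK _ 2%R)//.
  by rewrite mulr_natr mulr2n expRD -expr2 sqrtr_sqr ger0_norm ?expR_ge0.
have -> : Num.sqrt ((2 * pi) ^+ p / \det (a *: invmx O)) =
    (Num.sqrt ((2 * pi / a) ^+ p) * expR (ln (\det O) / 2))%R.
  rewrite -sqrt_det -sqrtrM ?exprn_ge0 ?divr_ge0 ?mulr_ge0 ?pi_ge0 ?ltW//.
  rewrite detZ det_inv invfM invrK expr_div_n mulrA//.
rewrite iM quadZ [LHS]muleA [LHS]muleA -!EFinM [RHS]muleCA [LHS]muleC.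
congr (_ * _); rewrite -EFinM; congr EFin.
rewrite -!mulrA; congr (_ * _)%R; rewrite -!expRD; congr expR.
rewrite mulmxBr raddfB/= -scalemxAr mxtraceZ mxtrace_mul_outer.
by field; rewrite gt_eqF.
Qed.

(** Bartlett decomposition of the log-determinant: under the weight of exponent s and
    matrix A, ln (det O) is the sum of - ln (det A) and of p independent logarithms
    of gamma variables of shapes s + 1 + j/2 and rate 1/2. The constant K is that
    of the weight alone, the same for all test functions. *)
Theorem wishart_logdet_integral p (A : 'M[R]_p) (s : R) : posdef A -> (-1 < s)%R ->
  exists2 K : R, (0 < K)%R & forall f : R -> \bar R,
    measurable_fun setT f -> (forall x, 0 <= f x) ->
    \int[lebesgue_sym p]_O wishart_integrand s A f O =
    K%:E * conv_log_gamma p (s + 1) f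
      (\sum_(j < p) ln (2 * (s + 1 + j%:R / 2)) - ln (\det A))%R.
Proof.
move=> pA; move: p A pA s.
apply: posdef_ind => [A|p A al a a0 pB pS IH] s s1.
  exists 1%R => // f mf f0.
  rewrite integral_lebesgue_sym; [|exact: measurable_wishart_integrand|
    by move=> ?; exact: wishart_integrand_ge0].
  rewrite integral_lebesgue_tuple0; last first.
    exact: (measurableT_comp (measurable_wishart_integrand _ _ mf)
      (@measurable_sym_of_tuple R 0)).
  rewrite /wishart_integrand !det_mx00 ln1 big_ord0 subr0 mul1e indicE mem_set; last first.
    split; first by apply/matrixP => -[].
    by move=> x; rewrite mxE big_ord0.
  by rewrite mul1e /mxtrace big_ord0 mulr0 mul0r subr0 expR0 mule1.
have s1' : (-1 < s + 2^-1)%R by rewrite (lt_trans s1)// ltrDl.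
have [K K0 HK] := IH _ s1'.
pose K1 := (Num.sqrt ((2 * pi / a) ^+ p) *
  expR ((s + 1) * ln (2 * (s + 1) / a) - (s + 1)))%R.
have K10 : (0 < K1)%R.
  by rewrite mulr_gt0 ?expR_gt0// sqrtr_gt0 exprn_gt0// divr_gt0// mulr_gt0// pi_gt0.
exists (K1 * K)%R; first exact: mulr_gt0.
move=> f mf f0.
pose h z := conv (log_gamma_fun (s + 1)) f (z + ln (2 * (s + 1) / a))%R.
have mh : measurable_fun setT h.
  have mc : measurable_fun setT (conv (log_gamma_fun (s + 1)) f).
    apply: measurable_convolute => //; first exact: measurable_log_gamma_fun.
    exact: log_gamma_fun_ge0.
  apply: (@measurableT_comp _ _ _ _ _ _ (conv (log_gamma_fun (s + 1)) f) _
    (fun z : R => (z + ln (2 * (s + 1) / a))%R)) => //.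
  exact: measurable_funD.
have h0 z : 0 <= h z by apply: conv_ge0 => //; exact: log_gamma_fun_ge0.
rewrite integral_lebesgue_symS; [|exact: measurable_wishart_integrand|
  by move=> ?; exact: wishart_integrand_ge0].
transitivity (\int[lebesgue_sym p]_O (K1%:E *
    wishart_integrand (s + 2^-1) (A - a^-1 *: (al *m al^T))%R h O)).
  apply: ge0_ae_eq_integral => //.
  - apply: measurable_lebesgue_sym_section; first exact: measurable_wishart_integrand.
    by move=> ?; exact: wishart_integrand_ge0.
  - by apply: emeasurable_funM => //; exact: measurable_wishart_integrand.
  - move=> O _; apply: integral_ge0 => v _; apply: integral_ge0 => o _.
    exact: wishart_integrand_ge0.
  - move=> O _; apply: mule_ge0; first by rewrite lee_fin ltW.
    exact: wishart_integrand_ge0.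
  (* The computation for one border needs an invertible upper left block. *)
  exists [set O : 'M[R]_p | (\det O = 0)%R]; split.
  - exact: measurable_det0.
  - exact: lebesgue_sym_det0.
  move=> O /=; apply: contra_notP => /eqP dO _.
  have [pO|npO] := pselect (psd O).
    apply: wishart_integral_block => //; apply: psd_unit_posdef => //.
    by rewrite unitmxE unitfE.
  rewrite /wishart_integrand indicE memNset// mul0e mule0.
  apply: integral0_eq => v _; apply: integral0_eq => o _.
  by rewrite indicE memNset ?mul0e// => /psd_block_ul.
rewrite ge0_integralZl//; last 3 first.
- exact: measurable_wishart_integrand.
- by move=> O _; exact: wishart_integrand_ge0.
- by rewrite lee_fin ltW.
rewrite HK// EFinM muleA; congr (_ * _).
rewrite det_block_schur ?gt_eqF// addn1 /=.
have -> : (s + 2^-1 + 1 = s + 1 + 2^-1)%R by ring.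
rewrite /h conv_log_gamma_addr; congr (conv_log_gamma p _ _ _).
have s10 : (0 < s + 1)%R by rewrite -ltrBlDr sub0r.
rewrite big_ord_recl ln_div ?posrE ?mulr_gt0//.
rewrite [ln (a * _)]lnM ?posrE ?posdef_det_gt0//.
rewrite mul0r addr0.
have -> : (\sum_(j < p) ln (2 * (s + 1 + (lift ord0 j)%:R / 2)) =
    \sum_(j < p) ln (2 * (s + 1 + 2^-1 + j%:R / 2)))%R.
  apply: eq_bigr => j _; rewrite /= /bump/= natrD; congr (ln (2 * _)).
  by field.
by ring.
Qed.

End wishart_integral.

(** * Elementary bounds on the exponential *)

Section exponential_bounds.
Context {R : realType}.
Implicit Types x y : R.

(** The difference vanishes at 0, and its derivative is nonnegative by
    1 + x <= exp x. *)
Lemma expR_ge_deg2 x : 0 <= x -> 1 + x + x ^+ 2 / 2 <= expR x.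
Proof.
move=> x0; rewrite -subr_ge0.
pose F (y : R) := expR y - (1 + y + y ^+ 2 / 2).
have dF (y : R) : is_derive y 1 F (expR y - (1 + y)).
  rewrite /F; apply: is_derive_eq.
  by rewrite !scaler0 /GRing.scale/=; field.
have -> : 0 = F 0 by rewrite /F expR0 expr0n/= mul0r !addr0 subrr.
apply: (@ger0_derive1_ndecry _ F 0) => //.
- by move=> y _; rewrite derive1E derive_val subr_ge0 expR_ge1Dx.
- by apply: derivable_within_continuous => y _; case: (dF y).
Qed.

Lemma expRN_le_deg2 x : 0 <= x -> expR (- x) <= 1 - x + x ^+ 2 / 2.
Proof.
move=> x0; rewrite expRN; apply: (@le_trans _ _ (1 + x + x ^+ 2 / 2)^-1).
  by rewrite lef_pV2 ?posrE ?expR_gt0 ?expR_ge_deg2//; nra.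
rewrite -div1r ler_pdivrMr; nra.
Qed.

Lemma expRN_ge_deg3 x : 0 <= x -> 1 - x + x ^+ 2 / 2 - x ^+ 3 / 6 <= expR (- x).
Proof.
move=> x0; rewrite -subr_ge0.
pose F (y : R) := expR (- y) - (1 - y + y ^+ 2 / 2 - y ^+ 3 / 6).
have dF (y : R) : is_derive y 1 F (- expR (- y) + (1 - y + y ^+ 2 / 2)).
  rewrite /F; apply: is_derive_eq.
  by rewrite !scaler0 /GRing.scale/=; field.
have -> : 0 = F 0 by rewrite /F oppr0 expR0 !expr0n/= !mul0r; ring.
apply: (@ger0_derive1_ndecry _ F 0) => //.
- move=> y; rewrite in_itv/= andbT => y0; rewrite derive1E derive_val.
  by have := expRN_le_deg2 (ltW y0); lra.
- by apply: derivable_within_continuous => y _; case: (dF y).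
Qed.

(** Invert the bound on exp(-x); the product of the two cubic polynomials exceeds 1
    by x^3 times a polynomial that is nonnegative on [0, 1]. *)
Lemma expR_le_deg3 x : 0 <= x <= 1 -> expR x <= 1 + x + x ^+ 2 / 2 + x ^+ 3.
Proof.
move=> /andP[x0 x1]; have := expRN_ge_deg3 x0.
rewrite expRN => H.
have e0 := expR_gt0 x.
have d0 : 0 < 1 - x + x ^+ 2 / 2 - x ^+ 3 / 6 by nra.
rewrite -[expR x]invrK; apply: (@le_trans _ _ (1 - x + x ^+ 2 / 2 - x ^+ 3 / 6)^-1).
  by rewrite lef_pV2 ?posrE ?invr_gt0.
rewrite -div1r ler_pdivrMr//.
have -> : (1 + x + x ^+ 2 / 2 + x ^+ 3) * (1 - x + x ^+ 2 / 2 - x ^+ 3 / 6) =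
  1 + x ^+ 3 * (5 / 6 - 11 / 12 * x + 5 / 12 * x ^+ 2 - x ^+ 3 / 6) by field.
rewrite lerDl mulr_ge0 ?exprn_ge0//.
nra.
Qed.

Lemma expR_deg2_approx x : `|x| <= 1 ->
  `|expR x - 1 - x - x ^+ 2 / 2| <= `|x| ^+ 3.
Proof.
move=> x1; have [x0|x0] := leP 0 x.
  rewrite (ger0_norm x0) in x1 *.
  have := expR_ge_deg2 x0; have := @expR_le_deg3 x; rewrite x0 x1 => /(_ isT) H1 H2.
  have y3 : 0 <= x ^+ 3 by rewrite exprn_ge0.
  by rewrite ler_norml; apply/andP; split; lra.
have y0 : 0 <= - x by lra.
have := expRN_ge_deg3 y0; have := expRN_le_deg2 y0; rewrite opprK sqrrN => H1 H2.
rewrite (ltr0_norm x0) ler_norml.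
have y3 : 0 <= (- x) ^+ 3 by rewrite exprn_ge0.
by apply/andP; split; lra.
Qed.

Lemma expR_sub_ge x : `|x| <= 1 -> x ^+ 2 / 3 <= expR x - 1 - x.
Proof.
move=> x1; have [x0|x0] := leP 0 x.
  by have := expR_ge_deg2 x0; have := sqr_ge0 x; lra.
have y0 : 0 <= - x by lra.
have := expRN_ge_deg3 y0; rewrite opprK sqrrN (ltr0_norm x0) in x1 * => H.
have : (- x) ^+ 3 <= x ^+ 2 by rewrite -sqrrN exprS ler_piMl// sqr_ge0.
by lra.
Qed.

Lemma expR_sub_ge_line x : x <= -1 -> - x / 3 <= expR x - 1 - x.
Proof.
move=> x1.
have e1 : 3^-1 <= expR (-1) :> R.
  by have := @expRN_ge_deg3 1 ler01; rewrite !expr1n; lra.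
have := expR_ge1Dx (x + 1).
have -> : expR x = expR (-1) * expR (x + 1) by rewrite -expRD; congr expR; ring.
have := expR_gt0 (x + 1); set E := expR (x + 1) => E0 E1.
have : 3^-1 * E <= expR (-1) * E by rewrite ler_pM2r.
by lra.
Qed.

Lemma expRN_dist (a b m : R) : m <= a -> m <= b ->
  `|expR (- a) - expR (- b)| <= `|a - b| * expR (- m).
Proof.
wlog ab : a b / a <= b.
  move=> H ma mb; have [ab|/ltW ba] := leP a b; first exact: H.
  by rewrite distrC [`|a - b|]distrC; exact: H.
move=> ma mb; rewrite ger0_norm ?subr_ge0 ?ler_expR ?lerN2//.
rewrite distrC ger0_norm ?subr_ge0//.
have -> : expR (- b) = expR (- a) * expR (- (b - a)) by rewrite -expRD; congr expR; ring.
rewrite -[X in X - _]mulr1 -mulrBr.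
apply: (@le_trans _ _ (expR (- a) * (b - a))).
  by rewrite ler_pM2l ?expR_gt0//; have := expR_ge1Dx (- (b - a)); lra.
by rewrite mulrC ler_wpM2l ?subr_ge0// ler_expR lerN2.
Qed.

Lemma expRN_le_inv (x : R) : 0 < x -> expR (- x) <= x^-1.
Proof.
move=> x0; rewrite expRN lef_pV2 ?posrE ?expR_gt0//.
by have := expR_ge1Dx x; lra.
Qed.

End exponential_bounds.

(** * Gaussian approximation of log-gamma densities *)

Section log_gamma_gauss.
Context {R : realType}.
Local Notation mu := (@lebesgue_measure R).

Lemma cube_expRN_bound (t : R) : 0 <= t -> t ^+ 3 * expR (- (t ^+ 2 / 12)) <= 150.
Proof.
move=> t0; rewrite expRN ler_pdivrMr ?expR_gt0//.
have u0 : 0 <= t ^+ 2 / 12 by rewrite divr_ge0 ?sqr_ge0.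
have := expR_ge_deg2 u0; set E := expR _ => H.
have E3 : t ^+ 3 <= (t ^+ 2 + t ^+ 4) / 2.
  by have := sqr_ge0 (t * (t - 1)); nra.
have q0 : 0 <= (t ^+ 2 / 12) ^+ 2 by rewrite sqr_ge0.
have E4 : t ^+ 4 = 144 * (t ^+ 2 / 12) ^+ 2 by field.
have E2 : t ^+ 2 = 12 * (t ^+ 2 / 12) by field.
move: E4 E2 E3 H u0 q0; move: (t ^+ 2 / 12) ((t ^+ 2 / 12) ^+ 2) (t ^+ 2) (t ^+ 3) (t ^+ 4).
by move=> *; lra.
Qed.

Lemma sqr_expRN_bound (t : R) : t ^+ 2 * expR (- (t ^+ 2 / 12)) <= 12.
Proof.
rewrite expRN ler_pdivrMr ?expR_gt0//.
by have := expR_ge1Dx (t ^+ 2 / 12); lra.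
Qed.

Variables (N r : R).
Hypotheses (N1 : 1 <= N) (r0 : 0 <= r) (rN : r <= N).
Let c := N / 2 + r / 2.
Let h (x : R) := expR (- (N / 2 * x ^+ 2) / 2).

Let N0 : 0 < N. Proof. exact: lt_le_trans ltr01 N1. Qed.
Let sN0 : 0 < Num.sqrt N. Proof. by rewrite sqrtr_gt0. Qed.
Let sNsq : Num.sqrt N ^+ 2 = N. Proof. by rewrite sqr_sqrtr// ltW. Qed.
Let sN1 : 1 <= Num.sqrt N.
Proof. by rewrite -[leLHS]sqrtr1 ler_sqrt// ltW. Qed.
Let sN_le : Num.sqrt N <= N.
Proof. by rewrite -[leRHS]sNsq expr2 ler_peMl// ltW. Qed.

Let u x := expR (- (N / 6 * x ^+ 2) / 2).

(** Both exponents are at least m = N x^2 / 6, so the mean value bound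
    [expRN_dist] applies. Half of exp(- m) is spent on the cubic term. *)
Let bulk x : `|x| <= 1 ->
  `|log_gamma_fun c x - h x| <= (150 / Num.sqrt N + 3 * r / N) * u x.
Proof.
move=> x1; pose m := N * x ^+ 2 / 6.
set a := c * (expR x - 1 - x); set b := N / 2 * x ^+ 2 / 2.
have x20 := sqr_ge0 x.
have c0 : 0 <= c by move: N1 r0; rewrite /c; lra.
have cN : c <= N by move: rN; rewrite /c; lra.
have ma : m <= a.
  apply: (@le_trans _ _ (c * (x ^+ 2 / 3))); last by rewrite ler_wpM2l// expR_sub_ge.
  rewrite -subr_ge0 (_ : _ - m = r * x ^+ 2 / 6); last by rewrite /m /c; field.
  by rewrite divr_ge0// mulr_ge0.
have mb : m <= b.
  rewrite -subr_ge0 (_ : _ - m = N * x ^+ 2 / 12); last by rewrite /m /b; field.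
  by rewrite divr_ge0// mulr_ge0// ltW.
rewrite /log_gamma_fun /h -/a mulNr -/b.
apply: (le_trans (expRN_dist ma mb)).
have abd : `|a - b| <= N * `|x| ^+ 3 + r * x ^+ 2 / 4.
  have -> : a - b = c * (expR x - 1 - x - x ^+ 2 / 2) + r * x ^+ 2 / 4.
    by rewrite /a /b /c; field.
  rewrite (le_trans (ler_normD _ _))// lerD//.
    rewrite normrM (ger0_norm c0); apply: ler_pM => //; exact: expR_deg2_approx.
  by rewrite ger0_norm// divr_ge0// mulr_ge0.
apply: (@le_trans _ _ ((N * `|x| ^+ 3 + r * x ^+ 2 / 4) * expR (- m))).
  by rewrite ler_pM2r ?expR_gt0.
pose t := Num.sqrt N * `|x|.
have t2 : t ^+ 2 / 12 = N * x ^+ 2 / 12 by rewrite /t exprMn sNsq real_normK ?num_real.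
have uE : u x = expR (- (t ^+ 2 / 12)) by rewrite t2 /u; congr expR; field.
have mE : expR (- m) = u x * u x.
  by rewrite /u -expRD; congr expR; rewrite /m; field.
rewrite mE mulrA ler_wpM2r ?expR_ge0// mulrDl lerD//.
  have -> : N * `|x| ^+ 3 = t ^+ 3 / Num.sqrt N.
    rewrite /t exprMn -[in LHS]sNsq; field; rewrite gt_eqF//.
  rewrite mulrAC uE; apply: ler_wpM2r; first by rewrite invr_ge0 ltW.
  by apply: cube_expRN_bound; rewrite mulr_ge0// ltW.
have -> : r * x ^+ 2 / 4 = r / N / 4 * t ^+ 2.
  rewrite /t exprMn sNsq real_normK ?num_real//; field; rewrite gt_eqF//.
rewrite -mulrA uE (_ : 3 * r / N = r / N / 4 * 12); last by field; rewrite gt_eqF.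
by rewrite ler_wpM2l ?sqr_expRN_bound// !divr_ge0// ltW.
Qed.

Let gauss_tail x : 1 < `|x| -> h x <= 6 / Num.sqrt N * u x.
Proof.
move=> x1; have x2 : 1 <= x ^+ 2 by rewrite -real_normK ?num_real// expr_ge1// ltW.
have -> : h x = expR (- (N * x ^+ 2 / 6)) * u x.
  by rewrite /h /u -expRD; congr expR; field.
rewrite ler_wpM2r ?expR_ge0//.
have Nx : N / 6 <= N * x ^+ 2 / 6.
  by rewrite ler_pM2r// ler_peMr// ltW.
have p0 : 0 < N / 6 by rewrite divr_gt0.
apply: (@le_trans _ _ (expR (- (N / 6)))); first by rewrite ler_expR lerN2.
apply: (le_trans (expRN_le_inv p0)); rewrite invfM invrK mulrC.
by rewrite ler_pM2l// lef_pV2 ?posrE.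
Qed.

Let left_tail x : x < -1 -> log_gamma_fun c x <= 12 / N * expR (- (N / 12 * `|x|)).
Proof.
move=> x1; have x0 : x < 0 by lra.
have := expR_sub_ge_line (ltW x1); set e := expR x - 1 - x => ee.
have cN : N / 2 <= c by move: r0; rewrite /c; lra.
rewrite /log_gamma_fun -/e ltr0_norm//.
have y0 : 0 < - x by lra.
apply: (@le_trans _ _ (expR (- (N / 12 * - x)) * expR (- (N / 12 * - x)))).
  rewrite -expRD ler_expR -opprD lerN2.
  apply: (@le_trans _ _ (N / 2 * (- x / 3))).
    by rewrite le_eqVlt; apply/orP; left; apply/eqP; field.
  by apply: ler_pM => //; rewrite divr_ge0// ltW.
rewrite ler_wpM2r ?expR_ge0//.
have p0 : 0 < N / 12 * - x by rewrite mulr_gt0// divr_gt0.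
apply: (le_trans (expRN_le_inv p0)); rewrite invfM invf_div ler_piMr//.
  by rewrite divr_ge0// ltW.
by rewrite invf_le1//; lra.
Qed.

(** Near 0 the exponents agree up to order three, and both exceed N x^2 / 6; a power
    of sqrt N |x| is absorbed by half of that Gaussian decay. Away from 0 both
    functions are small, but to the left of 0 the decay of the log-gamma function
    is only exponential in |x|, whence the second term. *)
Lemma log_gamma_gauss_pointwise x : `|log_gamma_fun c x - h x| <=
  (156 / Num.sqrt N + 3 * r / N) * expR (- (N / 6 * x ^+ 2) / 2) +
  12 / N * expR (- (N / 12 * `|x|)).
Proof.
rewrite -/(u x).
have u0 : 0 <= u x := expR_ge0 _.
have t0 : 0 <= 12 / N * expR (- (N / 12 * `|x|)).
  by rewrite mulr_ge0 ?expR_ge0// divr_ge0// ltW.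
have A0 : 0 <= 150 / Num.sqrt N * u x by rewrite mulr_ge0// divr_ge0// ltW.
have A6 : 0 <= 6 / Num.sqrt N * u x by rewrite mulr_ge0// divr_ge0// ltW.
have B0 : 0 <= 3 * r / N * u x by rewrite mulr_ge0// divr_ge0// ?mulr_ge0// ltW.
have split156 : 156 / Num.sqrt N * u x = 150 / Num.sqrt N * u x + 6 / Num.sqrt N * u x.
  by field; rewrite gt_eqF.
rewrite mulrDl split156.
have [x1|x1] := leP `|x| 1.
  by apply: (le_trans (bulk x1)); rewrite mulrDl; lra.
have ht := gauss_tail x1.
have h0 : 0 <= h x := expR_ge0 _.
have g0 : 0 <= log_gamma_fun c x := expR_ge0 _.
have [x0|x0] := leP 0 x.
  have gh : log_gamma_fun c x <= h x.
    rewrite /log_gamma_fun /h mulNr ler_expR lerN2.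
    have := expR_ge_deg2 x0 => H.
    apply: (@le_trans _ _ (N / 2 * (expR x - 1 - x))).
      by rewrite -[leLHS]mulrA; apply: ler_wpM2l; [rewrite divr_ge0// ltW|lra].
    apply: ler_wpM2r; last by move: r0; rewrite /c; lra.
    by have := sqr_ge0 x; lra.
  by rewrite ler_norml; apply/andP; split; lra.
have x1' : x < -1 by move: x1; rewrite ltr0_norm//; lra.
have := left_tail x1' => lt.
by rewrite ler_norml; apply/andP; split; lra.
Qed.

End log_gamma_gauss.

Section densities.
Context {R : realType}.
Local Notation mu := (@lebesgue_measure R).

(** The centered Gaussian density of precision (inverse variance) a. *)
Definition gauss_pdf (a x : R) : R := expR (- (a * x ^+ 2) / 2) / Num.sqrt (2 * pi / a).

Lemma measurable_expR_sqr (a : R) : measurable_fun setT (fun x : R => expR (- (a * x ^+ 2) / 2)).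
Proof.
apply: measurableT_comp; first exact: measurable_expR.
by apply: measurable_funM => //; apply: measurable_funN; apply: measurable_funM.
Qed.

Lemma measurable_gauss_pdf a : measurable_fun setT (gauss_pdf a).
Proof. by apply: measurable_funM => //; exact: measurable_expR_sqr. Qed.

Lemma gauss_pdf_ge0 a x : 0 <= gauss_pdf a x.
Proof. by rewrite divr_ge0 ?expR_ge0. Qed.

Lemma integral_expR_sqr (a : R) : 0 < a ->
  (\int[mu]_x (expR (- (a * x ^+ 2) / 2))%:E = (Num.sqrt (2 * pi / a))%:E)%E.
Proof.
move=> a0; rewrite -(integral_gauss_line 0 a0).
by apply: eq_integral => x _; rewrite addr0.
Qed.

Lemma gauss_cst_gt0 (a : R) : 0 < a -> 0 < Num.sqrt (2 * pi / a).
Proof. by move=> a0; rewrite sqrtr_gt0 divr_gt0// mulr_gt0// pi_gt0. Qed.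

Lemma integral_div (g : R -> R) (G : R) : measurable_fun setT g -> (forall x, 0 <= g x) ->
  0 < G -> (\int[mu]_x (g x)%:E = G%:E -> \int[mu]_x (g x / G)%:E = 1)%E.
Proof.
move=> mg g0 G0 iG.
under eq_integral do rewrite mulrC EFinM.
rewrite ge0_integralZl//.
- by rewrite iG -EFinM mulVf// gt_eqF.
- exact/measurable_EFinP.
- by move=> x _; rewrite lee_fin.
- by rewrite lee_fin invr_ge0 ltW.
Qed.

Lemma integral_gauss_pdf a : 0 < a -> (\int[mu]_x (gauss_pdf a x)%:E = 1)%E.
Proof.
move=> a0; apply: integral_div.
- exact: measurable_expR_sqr.
- by move=> x; exact: expR_ge0.
- exact: gauss_cst_gt0.
- exact: integral_expR_sqr.
Qed.

Lemma integral_expR_abs (a : R) : 0 < a ->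
  (\int[mu]_x (expR (- (a * `|x|)))%:E <= (2 / a)%:E)%E.
Proof.
move=> a0; have mp := measurable_exponential_pdf a.
have p0 x : 0 <= exponential_pdf a x by apply: exponential_pdf_ge0; exact: ltW.
have mpN : measurable_fun setT (fun x : R => exponential_pdf a (- x)).
  exact: (measurableT_comp mp (@measurable_funN _ _ _ _ id _)).
apply: (@le_trans _ _ (\int[mu]_x (a^-1%:E *
    ((exponential_pdf a x)%:E + (exponential_pdf a (- x))%:E)))%E).
  apply: ge0_le_integral => //.
  - apply/measurable_EFinP; apply: measurableT_comp; first exact: measurable_expR.
    apply: measurable_funN; apply: measurable_funM => //.
  - apply: emeasurable_funM => //; apply: emeasurable_funD; exact/measurable_EFinP.
  - move=> x _; rewrite -EFinD -EFinM lee_fin ler_pdivlMl//.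
    have [x0|x0] := leP 0 x.
      by rewrite ger0_norm// exponential_pdfE// mulNr lerDl.
    rewrite (ltr0_norm x0) [in leRHS]addrC exponential_pdfE; last by rewrite oppr_ge0 ltW.
    by rewrite mulNr lerDl.
rewrite ge0_integralZl//; last 3 first.
- apply: emeasurable_funD; exact/measurable_EFinP.
- by move=> x _; rewrite adde_ge0 ?lee_fin.
- by rewrite lee_fin invr_ge0 ltW.
rewrite ge0_integralD//; last 4 first.
- by move=> x _; rewrite lee_fin.
- exact/measurable_EFinP.
- by move=> x _; rewrite lee_fin.
- exact/measurable_EFinP.
rewrite (integral_lebesgue_opp (f := fun x => (exponential_pdf a x)%:E)); last 2 first.
- exact/measurable_EFinP.
- by move=> x; rewrite lee_fin.
by rewrite integral_exponential_pdf// -EFinD -EFinM mulrC.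
Qed.

Lemma integral_log_gamma_fun (c : R) : 0 < c ->
  exists2 G, 0 < G & (\int[mu]_x (log_gamma_fun c x)%:E = G%:E)%E.
Proof.
move=> c0; set I := (\int[mu]_x _)%E.
have mg : measurable_fun setT (EFin \o @log_gamma_fun R c).
  by apply/measurable_EFinP; exact: measurable_log_gamma_fun.
have Ioo : (I < +oo)%E.
  apply: (@le_lt_trans _ _ (\int[mu]_x ((expR c)%:E * (expR (- (c * `|x|)))%:E))%E).
    apply: ge0_le_integral => //.
    - by move=> x _; rewrite lee_fin expR_ge0.
    - apply: emeasurable_funM => //; apply/measurable_EFinP.
      apply: measurableT_comp; first exact: measurable_expR.
      apply: measurable_funN; apply: measurable_funM => //.
    - move=> x _; rewrite -EFinM lee_fin /log_gamma_fun -expRD ler_expR.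
      (* Hence the log-gamma function is at most e^c exp(- c |x|). *)
      have : `|x| - 1 <= expR x - 1 - x.
        have [x0|x0] := leP 0 x.
          by rewrite ger0_norm//; have := expR_ge_deg2 x0; have := sqr_ge0 (x - 1); nra.
        by rewrite ltr0_norm//; have := expR_ge0 x; lra.
      by move=> H; have := ler_wpM2l (ltW c0) H; lra.
  rewrite ge0_integralZl//; last first.
    apply/measurable_EFinP; apply: measurableT_comp; first exact: measurable_expR.
    apply: measurable_funN; apply: measurable_funM => //.
  rewrite (@le_lt_trans _ _ ((expR c)%:E * (2 / c)%:E)%E)// -?EFinM ?ltry//.
  by rewrite EFinM lee_wpmul2l ?lee_fin ?expR_ge0// integral_expR_abs.
have I0 : (0 < I)%E.
  apply: (@lt_le_trans _ _ (\int[mu]_x ((expR (- (c * expR 1)))%:E *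
      (\1_(`[0, 1]%classic : set (measurableTypeR R)) x)%:E))%E).
    rewrite ge0_integralZl//; last first.
      by apply/measurable_EFinP; exact: measurable_indic.
    rewrite integral_indic// setIT.
    have m1 : mu `[0%R, 1%R]%classic = 1%E.
      by rewrite lebesgue_measure_itv/= lte_fin ltr01 sube0.
    by rewrite [X in (_ * X)%E]m1 mule1 lte_fin expR_gt0.
  apply: ge0_le_integral => //.
  - by apply: emeasurable_funM => //; apply/measurable_EFinP; exact: measurable_indic.
  - move=> x _; rewrite indicE mem_setE in_itv/=.
    have [/andP[x0 x1]|_] := boolP (0 <= x <= 1); last by rewrite mule0 lee_fin expR_ge0.
    rewrite mule1 lee_fin ler_expR lerN2 ler_pM2l//.
    by have := x1; rewrite -(ler_expR x 1); lra.
exists (fine I); first by rewrite fine_gt0// I0 Ioo.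
by rewrite fineK// ge0_fin_numE// ltW.
Qed.

(** The constants G and H differ by at most D, so normalizing costs no more than the
    distance D itself. *)
Lemma l1_normalized (g h : R -> R) (G H D : R) :
  measurable_fun setT g -> (forall x, 0 <= g x) ->
  measurable_fun setT h -> (forall x, 0 <= h x) -> 0 < G -> 0 < H ->
  (\int[mu]_x (g x)%:E = G%:E)%E -> (\int[mu]_x (h x)%:E = H%:E)%E ->
  (\int[mu]_x `|g x - h x|%:E <= D%:E)%E ->
  (\int[mu]_x `|g x / G - h x / H|%:E <= (2 * D / H)%:E)%E.
Proof.
move=> mg g0 mh h0 G0 H0 iG iH iD.
have md : measurable_fun setT (fun x : R => `|g x - h x|).
  by apply: measurableT_comp; [exact: normr_measurable|exact: measurable_funB].
have mEg : measurable_fun setT (EFin \o g) by exact/measurable_EFinP.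
have mEh : measurable_fun setT (EFin \o h) by exact/measurable_EFinP.
have mEd : measurable_fun setT (fun x : R => `|g x - h x|%:E) by exact/measurable_EFinP.
have GH : `|G - H| <= D.
  have le1 (f1 f2 : R -> R) (F1 F2 : R) : measurable_fun setT (EFin \o f1) ->
      measurable_fun setT (EFin \o f2) -> (forall x, 0 <= f1 x) -> (forall x, 0 <= f2 x) ->
      (forall x, f1 x <= f2 x + `|g x - h x|) ->
      (\int[mu]_x (f1 x)%:E = F1%:E)%E -> (\int[mu]_x (f2 x)%:E = F2%:E)%E -> F1 <= F2 + D.
    move=> m1 m2 p1 p2 f12 i1 i2; rewrite -lee_fin -i1 EFinD -i2.
    apply: (@le_trans _ _ (\int[mu]_x ((f2 x)%:E + `|g x - h x|%:E))%E).
      apply: ge0_le_integral => //.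
      - by move=> x _; rewrite lee_fin.
      - exact: emeasurable_funD.
      - by move=> x _; rewrite -EFinD lee_fin.
    rewrite ge0_integralD//; first by rewrite leeD2l.
    - by move=> x _; rewrite lee_fin.
  rewrite ler_distl; apply/andP; split.
    rewrite lerBlDr; apply: (le1 h g) => //= x.
    by have := ler_norm (h x - g x); rewrite distrC; lra.
  by apply: (le1 g h) => //= x; have := ler_norm (g x - h x); lra.
have pw x : `|g x / G - h x / H| <= H^-1 * `|g x - h x| + (D / (G * H)) * g x.
  have -> : g x / G - h x / H = H^-1 * (g x - h x) + (H - G) / (G * H) * g x.
    by field; rewrite !gt_eqF.
  apply: (le_trans (ler_normD _ _)); rewrite !normrM normfV (gtr0_norm H0) lerD//.
  rewrite (ger0_norm (g0 x)); apply: ler_wpM2r => //.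
  rewrite distrC normfV (gtr0_norm (mulr_gt0 G0 H0)); apply: ler_wpM2r => //.
  by rewrite invr_ge0 mulr_ge0// ltW.
have D0 : 0 <= D by apply: le_trans GH.
apply: (@le_trans _ _ (\int[mu]_x (H^-1%:E * `|g x - h x|%:E + (D / (G * H))%:E * (g x)%:E))%E).
  apply: ge0_le_integral => //.
  - apply/measurable_EFinP; apply: measurableT_comp; first exact: normr_measurable.
    by apply: measurable_funB; apply: measurable_funM.
  - by apply: emeasurable_funD; apply: emeasurable_funM.
  - by move=> x _; rewrite -!EFinM -EFinD lee_fin.
have H10 : (0 <= H^-1%:E)%E by rewrite lee_fin invr_ge0 ltW.
have DG0 : (0 <= (D / (G * H))%:E)%E by rewrite lee_fin divr_ge0// mulr_ge0// ltW.
rewrite ge0_integralD//; last 4 first.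
- by move=> x _; rewrite mule_ge0.
- exact: emeasurable_funM.
- by move=> x _; rewrite mule_ge0// lee_fin.
- exact: emeasurable_funM.
rewrite !ge0_integralZl//; last by move=> x _; rewrite lee_fin.
rewrite iG -EFinM.
apply: (@le_trans _ _ (H^-1%:E * D%:E + (D / (G * H) * G)%:E)%E).
  by rewrite leeD2r// lee_wpmul2l.
rewrite -EFinM -EFinD lee_fin le_eqVlt; apply/orP; left; apply/eqP.
by field; rewrite !gt_eqF.
Qed.

End densities.

Section log_gamma_l1.
Context {R : realType}.
Local Notation mu := (@lebesgue_measure R).

(** Integrate [log_gamma_gauss_pointwise] and divide by the mass sqrt(4 pi / N) of
    the Gaussian function. *)
Lemma log_gamma_l1 (N r : R) : 1 <= N -> 0 <= r -> r <= N ->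
  exists2 G, 0 < G & (\int[mu]_x (log_gamma_fun (N / 2 + r / 2) x)%:E = G%:E /\
    \int[mu]_x `|log_gamma_fun (N / 2 + r / 2) x / G - gauss_pdf (N / 2) x|%:E <=
      (912 / Num.sqrt N + 12 * r / N)%:E)%E.
Proof.
move=> N1 r0 rN; set c := N / 2 + r / 2.
have N0 : 0 < N by exact: lt_le_trans ltr01 N1.
have c0 : 0 < c by rewrite /c; lra.
have [G G0 iG] := integral_log_gamma_fun c0.
exists G => //; split => //.
have s0 : 0 < Num.sqrt N by rewrite sqrtr_gt0.
have sNsq : Num.sqrt N ^+ 2 = N by rewrite sqr_sqrtr// ltW.
pose E1 := 156 / Num.sqrt N + 3 * r / N.
have E10 : 0 <= E1.
  by apply: addr_ge0; apply: divr_ge0; rewrite ?mulr_ge0 ?ler0n// ltW.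
pose D := E1 * Num.sqrt (2 * pi / (N / 6)) + 12 / N * (2 / (N / 12)).
have N20 : 0 < N / 2 by rewrite divr_gt0.
have N60 : 0 < N / 6 by rewrite divr_gt0.
have N120 : 0 < N / 12 by rewrite divr_gt0.
have mabs : measurable_fun setT (fun x : R => (expR (- (N / 12 * `|x|)))%:E).
  apply/measurable_EFinP; apply: measurableT_comp; first exact: measurable_expR.
  by apply: measurable_funN; apply: measurable_funM.
have msqr a : measurable_fun setT (fun x : R => (expR (- (a * x ^+ 2) / 2))%:E).
  by apply/measurable_EFinP; exact: measurable_expR_sqr.
have m1 : measurable_fun setT (fun x : R => E1%:E * (expR (- (N / 6 * x ^+ 2) / 2))%:E)%E.
  by apply: emeasurable_funM => //; exact: msqr.
have m2 : measurable_fun setT (fun x : R => (12 / N)%:E * (expR (- (N / 12 * `|x|)))%:E)%E.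
  exact: emeasurable_funM.
have iD : (\int[mu]_x `|log_gamma_fun c x - expR (- (N / 2 * x ^+ 2) / 2)|%:E <= D%:E)%E.
  apply: (@le_trans _ _ (\int[mu]_x (E1%:E * (expR (- (N / 6 * x ^+ 2) / 2))%:E +
      (12 / N)%:E * (expR (- (N / 12 * `|x|)))%:E))%E).
    apply: ge0_le_integral => //.
    - apply/measurable_EFinP; apply: measurableT_comp; first exact: normr_measurable.
      apply: measurable_funB; first exact: measurable_log_gamma_fun.
      exact: measurable_expR_sqr.
    - exact: emeasurable_funD.
    - by move=> x _; rewrite -!EFinM -EFinD lee_fin; exact: log_gamma_gauss_pointwise.
  have N12 : 0 <= 12 / N by rewrite divr_ge0// ltW.
  rewrite ge0_integralD//; last 2 first.
  - by move=> x _; rewrite mule_ge0 ?lee_fin ?expR_ge0.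
  - by move=> x _; rewrite mule_ge0 ?lee_fin ?expR_ge0.
  rewrite !ge0_integralZl ?lee_fin//; last exact: msqr.
  rewrite integral_expR_sqr// -EFinM /D EFinD leeD2l// [leRHS]EFinM.
  by rewrite lee_wpmul2l ?lee_fin// integral_expR_abs.
apply: (@le_trans _ _ (2 * D / Num.sqrt (2 * pi / (N / 2)))%:E).
  apply: l1_normalized => //.
  - exact: measurable_log_gamma_fun.
  - exact: log_gamma_fun_ge0.
  - exact: measurable_expR_sqr.
  - exact: gauss_cst_gt0.
  - exact: integral_expR_sqr.
rewrite lee_fin; set H := Num.sqrt (2 * pi / (N / 2)).
have H0 : 0 < H by exact: gauss_cst_gt0.
have H2 : Num.sqrt (2 * pi / (N / 6)) <= 2 * H.
  rewrite -[2 in leRHS]ger0_norm// -sqrtr_sqr -sqrtrM ?sqr_ge0//.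
  rewrite ler_sqrt; last by rewrite mulr_ge0 ?sqr_ge0// divr_ge0 ?mulr_ge0 ?pi_ge0// ltW.
  rewrite -subr_ge0 (_ : _ - _ = 4 * pi / N); last by field; rewrite gt_eqF.
  by rewrite divr_ge0 ?mulr_ge0 ?pi_ge0// ltW.
have H1 : 2 / Num.sqrt N <= H.
  have -> : 2 / Num.sqrt N = Num.sqrt (2 ^+ 2 / N).
    by rewrite sqrtrM ?sqr_ge0// sqrtr_sqr ger0_norm// sqrtrV// ltW.
  rewrite ler_sqrt; last by rewrite divr_ge0 ?mulr_ge0 ?pi_ge0// ltW.
  rewrite (_ : 2 * pi / (N / 2) = (2 ^+ 2 * pi) / N); last by field; rewrite gt_eqF.
  by rewrite ler_pM2r ?invr_gt0// ler_peMr ?sqr_ge0//; have := @pi_ge2 R; lra.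
rewrite ler_pdivrMr// /D mulrDr.
apply: (@le_trans _ _ (2 * (E1 * (2 * H)) + 2 * (12 / N * (2 / (N / 12))))).
  by rewrite lerD2r ler_pM2l// ler_wpM2l.
have : 2 * (12 / N * (2 / (N / 12))) <= 288 / Num.sqrt N * H.
  apply: (@le_trans _ _ (288 / Num.sqrt N * (2 / Num.sqrt N))); last first.
    apply: ler_wpM2l; last exact: H1.
    by apply: divr_ge0; [exact: ler0n|exact: ltW].
  rewrite (_ : 288 / _ * _ = 576 / N); last by rewrite -[N in RHS]sNsq; field; rewrite gt_eqF.
  rewrite (_ : 2 * _ = 576 / N / N); last by field; rewrite gt_eqF.
  apply: ler_piMr; last by rewrite invf_le1.
  by apply: divr_ge0; [exact: ler0n|exact: ltW].
have -> : (912 / Num.sqrt N + 12 * r / N) * H = 4 * E1 * H + 288 / Num.sqrt N * H.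
  by rewrite /E1; field; rewrite !gt_eqF.
by lra.
Qed.

End log_gamma_l1.

(** * Stability of iterated convolutions *)

Section conv_iter.
Context {R : realType}.
Local Notation mu := (@lebesgue_measure R).
Local Open Scope ereal_scope.

Definition density (g : R -> R) := [/\ measurable_fun setT g,
  (forall x, 0 <= g x)%R & \int[mu]_x (g x)%:E = 1].

(** The expectation of f (z + Y_0 + ... + Y_(p-1)) for independent Y_j of densities
    [g j]. *)
Fixpoint conv_iter p (g : nat -> R -> R) (f : R -> \bar R) : R -> \bar R :=
  if p is q.+1 then conv_iter q (fun j => g j.+1) (conv (g 0%N) f) else f.

Lemma conv_log_gammaE p c f :
  conv_log_gamma p c f = conv_iter p (fun j => log_gamma_fun (c + j%:R / 2)) f.
Proof.
elim: p c f => [//|p IH] c f.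
rewrite -[LHS]/(conv_log_gamma p (c + 2^-1) (conv (log_gamma_fun c) f)) IH.
have shift j : (c + 2^-1 + j%:R / 2 = c + j.+1%:R / 2)%R.
  by rewrite -[in RHS]addn1 natrD; field.
pose g (j : nat) := log_gamma_fun (c + j%:R / 2)%R.
rewrite -[RHS]/(conv_iter p (fun j => g j.+1) (conv (g 0%N) f)).
have -> : g 0%N = log_gamma_fun c by rewrite /g mul0r addr0.
by congr (conv_iter p _ _); apply/funext => j; rewrite /g -shift.
Qed.

Lemma conv_le1 g f z : density g -> measurable_fun setT f -> (forall x, 0 <= f x <= 1) ->
  conv g f z <= 1.
Proof.
move=> [mg g0 ig] mf f01; rewrite -ig.
have mfz : measurable_fun setT (fun x : R => f (z + x)%R).
  by apply: (measurableT_comp mf); exact: measurable_funD.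
apply: ge0_le_integral => //.
- by move=> x _; have /andP[? _] := f01 (z + x)%R; rewrite mule_ge0 ?lee_fin.
- by apply: emeasurable_funM => //; exact/measurable_EFinP.
- exact/measurable_EFinP.
- move=> x _; have /andP[_ ?] := f01 (z + x)%R.
  by rewrite -[leRHS]mul1e lee_wpmul2r ?lee_fin.
Qed.

Let weighted_dist (y e G H A : R) : (0 <= y <= 1 -> 0 <= A -> G - H <= A ->
  (y + e) * G <= y * H + (A + e * G))%R.
Proof.
move=> /andP[y0 y1] A0 GHA.
have : (y * (G - H) <= A)%R.
  have [GH|GH] := leP 0%R (G - H)%R.
    by apply: (le_trans _ GHA); rewrite ler_piMl.
  by apply: (le_trans _ A0); rewrite mulr_ge0_le0// ltW.
lra.
Qed.

(** Since f' takes its values in [0, 1], changing the density costs at most the L1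
    distance of the densities. *)
Lemma conv_dist g h f f' e de z : density g -> density h ->
  measurable_fun setT f -> measurable_fun setT f' ->
  (forall x, 0 <= f x) -> (forall x, 0 <= f' x <= 1) -> (0 <= e)%R ->
  (forall x, f x <= f' x + e%:E) -> \int[mu]_x `|g x - h x|%:E <= de%:E ->
  conv g f z <= conv h f' z + (e + de)%:E.
Proof.
move=> [mg g0 ig] [mh h0 ih] mf mf' f0 f'01 e0 ff' gh.
have mfz : measurable_fun setT (fun x : R => f (z + x)%R).
  by apply: (measurableT_comp mf); exact: measurable_funD.
have mf'z : measurable_fun setT (fun x : R => f' (z + x)%R).
  by apply: (measurableT_comp mf'); exact: measurable_funD.
have f'0 x : 0 <= f' x by have /andP[] := f'01 x.
have mEg : measurable_fun setT (EFin \o g) by exact/measurable_EFinP.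
have mEh : measurable_fun setT (EFin \o h) by exact/measurable_EFinP.
have mgh : measurable_fun setT (fun x : R => `|g x - h x|%:E).
  apply/measurable_EFinP; apply: measurableT_comp; first exact: normr_measurable.
  exact: measurable_funB.
apply: (@le_trans _ _ (\int[mu]_x (f' (z + x)%R * (h x)%:E +
    (`|g x - h x|%:E + e%:E * (g x)%:E)))).
  apply: ge0_le_integral => //.
  - by move=> x _; rewrite mule_ge0 ?lee_fin.
  - exact: emeasurable_funM.
  - apply: emeasurable_funD; first exact: emeasurable_funM.
    by apply: emeasurable_funD => //; exact: emeasurable_funM.
  - move=> x _; apply: (@le_trans _ _ ((f' (z + x)%R + e%:E) * (g x)%:E)).
      by rewrite lee_wpmul2r ?lee_fin.
    have := f'01 (z + x)%R; case: (f' (z + x)%R) => [y| |]; last 2 first.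
    - by rewrite leye_eq andbF.
    - by rewrite leeNy_eq.
    move=> /= /andP[]; rewrite !lee_fin => y0 y1.
    apply: weighted_dist; rewrite ?y0 ?normr_ge0//; exact: ler_norm.
rewrite ge0_integralD//; last 4 first.
- by move=> x _; rewrite mule_ge0 ?lee_fin.
- exact: emeasurable_funM.
- by move=> x _; rewrite adde_ge0 ?mule_ge0 ?lee_fin.
- by apply: emeasurable_funD => //; exact: emeasurable_funM.
rewrite leeD2l// ge0_integralD//; last 2 first.
- by move=> x _; rewrite mule_ge0 ?lee_fin.
- exact: emeasurable_funM.
rewrite ge0_integralZl//; last by move=> x _; rewrite lee_fin.
by rewrite ig mule1 addeC EFinD leeD2l.
Qed.

Lemma conv_iter_ge0 p (g : nat -> R -> R) f : (forall j x, 0 <= g j x)%R ->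
  (forall x, 0 <= f x) -> forall z, 0 <= conv_iter p g f z.
Proof.
elim: p g f => //= p IH g f g0 f0; apply: IH => // x.
exact: conv_ge0.
Qed.

(** Telescoping: the densities are replaced one at a time. *)
Lemma conv_iter_dist p (g h : nat -> R -> R) f f' e (de : nat -> R) z :
  (forall j, (j < p)%N -> density (g j)) -> (forall j, (j < p)%N -> density (h j)) ->
  measurable_fun setT f -> measurable_fun setT f' ->
  (forall x, 0 <= f x) -> (forall x, 0 <= f' x <= 1) -> (0 <= e)%R ->
  (forall x, f x <= f' x + e%:E) ->
  (forall j, (j < p)%N -> \int[mu]_x `|g j x - h j x|%:E <= (de j)%:E) ->
  conv_iter p g f z <= conv_iter p h f' z + (e + \sum_(j < p) de j)%:E.
Proof.
elim: p g h f f' e de => [|p IH] g h f f' e de dg dh mf mf' f0 f'01 e0 ff' gh /=.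
  by rewrite big_ord0 addr0.
have dg0 := dg 0%N isT; have dh0 := dh 0%N isT.
have [mg g0 _] := dg0; have [mh h0 _] := dh0.
have f'0 x : 0 <= f' x by have /andP[] := f'01 x.
have de0 : (0 <= de 0%N)%R.
  by rewrite -lee_fin; apply: (le_trans _ (gh 0%N isT)); apply: integral_ge0.
rewrite big_ord_recl addrA; apply: (IH _ _ _ _ (e + de 0%N)%R (fun j => de j.+1)).
- by move=> j jp; exact: dg.
- by move=> j jp; exact: dh.
- exact: measurable_convolute.
- exact: measurable_convolute.
- by move=> x; exact: conv_ge0.
- by move=> x; rewrite conv_ge0//=; exact: conv_le1.
- exact: addr_ge0.
- by move=> x; apply: conv_dist => //; exact: gh.
- by move=> j jp; exact: gh.
Qed.

Lemma conv_scale_fun (g : R -> R) f k z : measurable_fun setT g -> (forall x, 0 <= g x)%R ->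
  measurable_fun setT f -> (forall x, 0 <= f x) -> (0 <= k)%R ->
  conv g (fun x => k%:E * f x) z = k%:E * conv g f z.
Proof.
move=> mg g0 mf f0 k0; rewrite /conv -ge0_integralZl//.
- by apply: eq_integral => x _; rewrite muleA.
- apply: emeasurable_funM; last exact/measurable_EFinP.
  by apply: (measurableT_comp mf); exact: measurable_funD.
- by move=> x _; rewrite mule_ge0 ?lee_fin.
Qed.

Lemma conv_iter_normalize p (g : nat -> R -> R) (k : nat -> R) f z :
  (forall j, measurable_fun setT (g j)) -> (forall j x, 0 <= g j x)%R ->
  measurable_fun setT f -> (forall x, 0 <= f x) -> (forall j, 0 < k j)%R ->
  conv_iter p g f z =
  (\prod_(j < p) k j)%:E * conv_iter p (fun j x => g j x / k j)%R f z.
Proof.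
move=> + + + + k0.
have k0' j : (0 <= k j)%R by exact: ltW.
have scal q (h : nat -> R -> R) u a : (forall j, measurable_fun setT (h j)) ->
    (forall j x, 0 <= h j x)%R -> measurable_fun setT u -> (forall x, 0 <= u x) ->
    (0 <= a)%R -> conv_iter q h (fun x => a%:E * u x) z = a%:E * conv_iter q h u z.
  elim: q h u => //= q IH h u mh h0 mu u0 a0.
  rewrite -IH//; last 2 first.
  - exact: measurable_convolute.
  - by move=> x; exact: conv_ge0.
  congr (conv_iter q _ _ z); apply/funext => x; exact: conv_scale_fun.
elim: p g k k0 k0' f => [|p IH] g k k0 k0' f mg g0 mf f0 /=.
  by rewrite big_ord0 mul1e.
rewrite (IH _ (fun j => k j.+1))//; last 2 first.
- exact: measurable_convolute.
- by move=> x; exact: conv_ge0.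
rewrite big_ord_recl mulrC EFinM -muleA; congr (_ * _).
rewrite -scal//; last 4 first.
- by move=> j; exact: measurable_funM.
- by move=> j x; rewrite divr_ge0.
- apply: measurable_convolute => //; first exact: measurable_funM.
  by move=> x; rewrite divr_ge0.
- by move=> x; apply: conv_ge0 => // y; rewrite divr_ge0.
congr (conv_iter p _ _ z); apply/funext => x; rewrite /conv -ge0_integralZl ?lee_fin//.
- apply: eq_integral => y _; rewrite muleCA -EFinM; congr (_ * _%:E)%E.
  by field; rewrite gt_eqF.
- apply: emeasurable_funM; last first.
    by apply/measurable_EFinP; apply: measurable_funM; [exact: mg|exact: measurable_cst].
  by apply: (measurableT_comp mf); exact: measurable_funD.
- by move=> y _; rewrite mule_ge0 ?lee_fin ?divr_ge0.
Qed.

Lemma density_gauss_pdf a : (0 < a)%R -> density (gauss_pdf a).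
Proof.
move=> a0; split; first exact: measurable_gauss_pdf.
- exact: gauss_pdf_ge0.
- exact: integral_gauss_pdf.
Qed.

End conv_iter.

(** * The Gaussian convolution semigroup *)

Section gauss_convolution.
Context {R : realType}.
Local Notation mu := (@lebesgue_measure R).
Local Open Scope ereal_scope.

(** The sum of the two quadratic exponents is completed to a square in x. *)
Lemma gauss_pdf_convolution (v w u : R) : (0 < v)%R -> (0 < w)%R ->
  \int[mu]_x (gauss_pdf w^-1 (u - x) * gauss_pdf v^-1 x)%:E = (gauss_pdf (v + w)^-1 u)%:E.
Proof.
move=> v0 w0; pose a := (v^-1 + w^-1)%R.
have vw0 : (0 < v + w)%R by rewrite addr_gt0.
have a0 : (0 < a)%R by rewrite addr_gt0 ?invr_gt0.
have cv := @gauss_cst_gt0 R v^-1; rewrite invr_gt0 in cv.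
have cw := @gauss_cst_gt0 R w^-1; rewrite invr_gt0 in cw.
pose k := (expR (- (u ^+ 2 / (v + w)) / 2) /
  (Num.sqrt (2 * pi / w^-1) * Num.sqrt (2 * pi / v^-1)))%R.
have k0 : (0 <= k)%R by rewrite divr_ge0 ?expR_ge0// mulr_ge0.
transitivity (\int[mu]_x (k%:E * (expR (- (a * (x + - u / (w * a)) ^+ 2) / 2))%:E)).
  apply: eq_integral => x _; rewrite -EFinM; congr EFin.
  rewrite /gauss_pdf /k mulrACA -invfM -expRD [RHS]mulrAC -expRD.
  congr (expR _ / _)%R.
  by rewrite /a; field; rewrite !gt_eqF//= addrC.
rewrite ge0_integralZl//; last first.
  apply/measurable_EFinP; apply: measurableT_comp; first exact: measurable_expR.
  apply: measurable_funM => //; apply: measurable_funN; apply: measurable_funM => //.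
  by apply: measurable_funX; exact: measurable_funD.
rewrite integral_gauss_line// -EFinM /k /gauss_pdf; congr EFin.
rewrite !invrK -[LHS]mulrA; congr (expR (- _ / 2) * _)%R; first by rewrite mulrC.
have s0 (x : R) : (0 < x -> 0 <= 2 * pi * x)%R.
  by move=> x0; rewrite !mulr_ge0 ?pi_ge0// ltW.
have sn0 (x : R) : (0 < x -> Num.sqrt (2 * pi * x) != 0)%R.
  by move=> x0; rewrite gt_eqF// sqrtr_gt0 !mulr_gt0// pi_gt0.
apply: (mulfI (sn0 _ vw0)); rewrite divff; last exact: sn0.
rewrite mulrCA -sqrtrM ?s0// -sqrtrM ?s0//.
rewrite (_ : (2 * pi * (v + w) * (2 * pi / a))%R = (2 * pi * w * (2 * pi * v))%R).
  by rewrite mulVf// gt_eqF// sqrtr_gt0 !mulr_gt0// pi_gt0.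
by rewrite /a; field; rewrite !gt_eqF//= addrC.
Qed.

(** Fubini reduces the claim to the convolution of the densities. *)
Lemma conv_gauss_conv (v w : R) (f : R -> \bar R) z : (0 < v)%R -> (0 < w)%R ->
  measurable_fun setT f -> (forall x, 0 <= f x) ->
  conv (gauss_pdf v^-1) (conv (gauss_pdf w^-1) f) z = conv (gauss_pdf (v + w)^-1) f z.
Proof.
move=> v0 w0 mf f0.
have mfz : measurable_fun setT (fun x : R => f (z + x)%R).
  by apply: (measurableT_comp mf); exact: measurable_funD.
have mg a : measurable_fun setT (EFin \o @gauss_pdf R a).
  by apply/measurable_EFinP; exact: measurable_gauss_pdf.
pose F (xu : measurableTypeR R * measurableTypeR R) : \bar R :=
  f (z + xu.2)%R * (gauss_pdf w^-1 (xu.2 - xu.1))%:E * (gauss_pdf v^-1 xu.1)%:E.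
have mF : measurable_fun setT F.
  apply: emeasurable_funM; first apply: emeasurable_funM.
  - exact: (measurableT_comp mfz (@measurable_snd _ _ _ _)).
  - have msub : measurable_fun setT
        (fun xu : measurableTypeR R * measurableTypeR R => (xu.2 - xu.1)%R).
      by apply: measurable_funB; [exact: measurable_snd|exact: measurable_fst].
    exact: (measurableT_comp (mg (w^-1)%R) msub).
  - exact: (measurableT_comp (mg (v^-1)%R) (@measurable_fst _ _ _ _)).
have F0 xu : 0 <= F xu by rewrite !mule_ge0 ?lee_fin ?gauss_pdf_ge0.
transitivity (\int[mu]_x \int[mu]_u F (x, u)).
  apply: eq_integral => x _; rewrite /conv.
  have mG : measurable_fun setT (fun u : R => f (z + u)%R * (gauss_pdf w^-1 (u - x))%:E).
    apply: emeasurable_funM => //.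
    have msub : measurable_fun setT (fun u : R => (u - x)%R) by exact: measurable_funB.
    exact: (measurableT_comp (mg (w^-1)%R) msub).
  have G0 u : 0 <= f (z + u)%R * (gauss_pdf w^-1 (u - x))%:E.
    by rewrite mule_ge0 ?lee_fin ?gauss_pdf_ge0.
  have gv : 0 <= (gauss_pdf v^-1 x)%:E by rewrite lee_fin gauss_pdf_ge0.
  transitivity ((\int[mu]_u (f (z + u)%R * (gauss_pdf w^-1 (u - x))%:E)) *
      (gauss_pdf v^-1 x)%:E); last first.
    exact/esym/(ge0_integralZr mu measurableT mG (fun u _ => G0 u) gv).
  congr (_ * _); apply: (etrans _ (integral_lebesgue_addr x mG G0)).
  by apply: eq_integral => y _; rewrite addrK -addrA [(x + y)%R]addrC.
transitivity (\int[mu]_u \int[mu]_x F (x, u)).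
  exact: (fubini_tonelli F mF F0).
apply: eq_integral => u _.
have mgg : measurable_fun setT
    (fun x : R => (gauss_pdf w^-1 (u - x) * gauss_pdf v^-1 x)%:E).
  have msub : measurable_fun setT (fun x : R => (u - x)%R) by exact: measurable_funB.
  apply/measurable_EFinP; apply: measurable_funM; last exact: measurable_gauss_pdf.
  exact: (measurableT_comp (@measurable_gauss_pdf R _) msub).
have gg0 x : 0 <= (gauss_pdf w^-1 (u - x) * gauss_pdf v^-1 x)%:E.
  by rewrite lee_fin mulr_ge0 ?gauss_pdf_ge0.
rewrite -(gauss_pdf_convolution u v0 w0).
transitivity (\int[mu]_x (f (z + u)%R * (gauss_pdf w^-1 (u - x) * gauss_pdf v^-1 x)%:E)).
  by apply: eq_integral => x _; rewrite EFinM muleA.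
exact: (ge0_integralZl mu measurableT mgg (fun x _ => gg0 x) (f0 _)).
Qed.

Lemma conv_iter_gauss p (v : R) (f : R -> \bar R) z : (0 < v)%R ->
  measurable_fun setT f -> (forall x, 0 <= f x) ->
  conv_iter p.+1 (fun=> gauss_pdf v^-1) f z = conv (gauss_pdf (p.+1%:R * v)^-1) f z.
Proof.
move=> v0; elim: p f => [|p IH] f mf f0; first by rewrite /= mul1r.
rewrite -[LHS]/(conv_iter p.+1 (fun=> gauss_pdf v^-1) (conv (gauss_pdf v^-1) f) z).
rewrite IH.
- rewrite conv_gauss_conv//; last by rewrite mulr_gt0.
  by congr (conv (gauss_pdf _) f z); rewrite -[in RHS]addn1 natrD mulrDl mul1r.
- apply: measurable_convolute => //; first exact: measurable_gauss_pdf.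
  exact: gauss_pdf_ge0.
- by move=> x; apply: conv_ge0 => //; exact: gauss_pdf_ge0.
Qed.

Lemma integral_lebesgue_scale (k : R) (f : R -> \bar R) : (0 < k)%R ->
  measurable_fun setT f -> (forall x, 0 <= f x) ->
  \int[mu]_x (f (k * x)%R * k%:E) = \int[mu]_x f x.
Proof.
move=> k0 mf f0.
have mk : measurable_fun setT (fun x : measurableTypeR R => (k * x)%R : measurableTypeR R).
  exact: measurable_funM.
have [nu nuE] := density_measure_ex mu (@measurable_cst _ _ (measurableTypeR R) R setT k)
  (fun=> ltW k0).
have mfk : measurable_fun setT (fun x : R => f (k * x)%R) by exact: (measurableT_comp mf).
transitivity (\int[nu]_x f (k * x)%R).
  apply/esym/(@integral_density _ _ _ mu nu (cst k)) => //.
  - by move=> x; exact: ltW.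
pose rho := measure_function_pushforward__canonical__measure_function_Measure nu mk.
transitivity (\int[rho]_x f x).
  exact/esym/(ge0_integral_pushforward mk nu measurableT mf (fun y _ => f0 y)).
apply/esym/eq_measure_integral => A mA _.
apply: (@lebesgue_measure_unique _ rho) => // _ [[a b]] _ <-.
rewrite lebesgue_measure_itv/= lte_fin; case: ltP => [ab|ba]; last first.
  have -> : `]a, b]%classic = set0 by rewrite set_itv_ge ?bnd_simp -?leNgt.
  by rewrite measure0.
rewrite /rho/= /pushforward nuE.
rewrite (_ : _ @^-1` _ = `](a / k)%R, (b / k)%R]%classic); last first.
  by apply/seteqP; split=> x /=; rewrite !in_itv/= ltr_pdivrMr// ler_pdivlMr// mulrC.
apply/esym/(etrans (integral_cst mu (measurable_itv _) k%:E)).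
have m1 : mu `](a / k)%R, (b / k)%R]%classic = (b / k - a / k)%:E.
  by rewrite lebesgue_measure_itv/= lte_fin ltr_pM2r ?invr_gt0// ab EFinB.
rewrite [X in _ * X]m1 -EFinM -EFinD; congr EFin; field; rewrite gt_eqF//.
Qed.

(** The substitution y = - k x maps the Gaussian of variance k^-2 to the standard
    one. The sign comes from log det of the inverse matrix. *)
Lemma conv_gauss_cdf (k t D z : R) : (0 < k)%R ->
  conv (gauss_pdf (k ^+ 2)) (fun L => (\1_[set L | (k * (- L - D) <= t)%R] L : R)%:E) z =
  normal_prob 0 1 `]-oo, (t + k * (z + D))%R].
Proof.
move=> k0; set c := (t + k * (z + D))%R.
pose F (y : R) : \bar R := (\1_(`]-oo, c]%classic : set (measurableTypeR R)) y * normal_pdf 0 1 y)%:E.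
have mF : measurable_fun setT F.
  apply/measurable_EFinP; apply: measurable_funM; last exact: measurable_normal_pdf.
  exact: measurable_indic.
have F0 y : 0 <= F y by rewrite lee_fin mulr_ge0 ?normal_pdf_ge0.
transitivity (\int[mu]_y F y); last first.
  rewrite /normal_prob [RHS]integral_mkcond; apply: eq_integral => y _.
  by rewrite patchE /F indicE mem_setE; case: ifPn => _; rewrite ?mul1r ?mul0r.
rewrite -(integral_lebesgue_opp mF F0).
rewrite -(integral_lebesgue_scale k0)//; last exact: (measurableT_comp mF (@measurable_funN _ _ _ _ id _)).
apply: eq_integral => x _; rewrite /F -!EFinM -mulrA; congr (_ * _)%:E.
  rewrite !indicE; congr (_%:R); congr nat_of_bool.
  have E : (k * (- (z + x) - D) <= t)%R = (- (k * x) <= c)%R.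
    by rewrite -subr_ge0 -[RHS]subr_ge0; congr (0 <= _)%R; rewrite /c; ring.
  by apply/idP/idP; rewrite !inE/= ?in_itv/= E.
rewrite normal_pdfE ?oner_neq0// /normal_fun /normal_peak /gauss_pdf.
rewrite expr1n mul1r subr0 sqrrN exprMn -[(pi *+ 2)%R]mulr_natr.
have -> : Num.sqrt (2 * pi / k ^+ 2) = (Num.sqrt (pi * 2) / k)%R.
  rewrite [(2 * pi)%R]mulrC sqrtrM ?mulr_ge0 ?pi_ge0// sqrtrV ?sqr_ge0//.
  by rewrite sqrtr_sqr gtr0_norm.
by rewrite invfM invrK mulrA; congr (_ * _)%R; rewrite mulrC.
Qed.

(** The standard normal density is at most (2 pi)^(-1/2) <= 1. *)
Lemma std_normal_cdf_lipschitz (a b : R) :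
  (`|std_normal_cdf a - std_normal_cdf b| <= `|a - b|)%R.
Proof.
wlog ab : a b / (a <= b)%R.
  move=> H; have [ab|/ltW ba] := leP a b; first exact: H.
  by rewrite distrC [`|a - b|%R]distrC; exact: H.
rewrite distrC [`|a - b|%R]distrC (ger0_norm (x := (b - a)%R)) ?subr_ge0//.
have fina (x : R) : normal_prob 0 1 `]-oo, x] \is a fin_num by exact: fin_num_measure.
have eb : normal_prob 0 1 `]-oo, b] = normal_prob 0 1 `]-oo, a] + normal_prob 0 1 `]a, b].
  rewrite -measureU//.
    by congr normal_prob; rewrite -itv_bndbnd_setU// bnd_simp.
  by rewrite -subset0 => x /= []; rewrite !in_itv/= => xa /andP[ax _]; lra.
have fab : normal_prob 0 1 `]a, b] \is a fin_num by exact: fin_num_measure.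
rewrite /std_normal_cdf eb fineD// addrC addKr ger0_norm ?fine_ge0//.
rewrite -lee_fin fineK//.
apply: (@le_trans _ _ (\int[mu]_(x in `]a, b]) (cst 1%E x))).
  apply: ge0_le_integral => //.
  - by move=> x _; rewrite lee_fin normal_pdf_ge0.
  - by apply/measurable_EFinP; apply: measurable_funTS; exact: measurable_normal_pdf.
  - move=> x _; rewrite lee_fin; apply: (le_trans (normal_pdf_ub _ _ (oner_neq0 _))).
    rewrite /normal_peak invf_le1; last first.
      by rewrite sqrtr_gt0 expr1n mul1r pmulrn_lgt0// pi_gt0.
    rewrite -[leLHS]sqrtr1 ler_sqrt expr1n mul1r; last by rewrite mulrn_wge0// pi_ge0.
    by rewrite -mulr_natr; have := @pi_ge2 R; lra.
rewrite integral_cst// mul1e.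
suff m1 : mu `]a, b]%classic = (b - a)%:E by rewrite [leLHS]m1.
rewrite lebesgue_measure_itv/= lte_fin; case: ltP => ba; first by rewrite EFinB.
by have -> : (b = a)%R; [apply/eqP; rewrite eq_le ab ba|rewrite subrr].
Qed.

End gauss_convolution.

(** * Gaussian approximation of sums of log-gamma variables *)

Section conv_log_gamma_gauss.
Context {R : realType}.
Local Notation mu := (@lebesgue_measure R).
Local Open Scope ereal_scope.

Lemma conv_log_gamma_density (c : R) p : (0 < c)%R ->
  exists G : nat -> R, [/\ (forall j, 0 < G j)%R,
    (forall j, \int[mu]_x (log_gamma_fun (c + j%:R / 2) x)%:E = (G j)%:E),
    (forall j, density (fun x => log_gamma_fun (c + j%:R / 2) x / G j)%R) &
    forall f z, measurable_fun setT f -> (forall x, 0 <= f x) ->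
      conv_log_gamma p c f z = (\prod_(j < p) G j)%:E *
        conv_iter p (fun j x => log_gamma_fun (c + j%:R / 2) x / G j)%R f z].
Proof.
move=> c0.
have cj j : (0 < c + j%:R / 2)%R by rewrite ltr_wpDr// divr_ge0.
have ex j : exists g : R, (0 < g)%R /\
    \int[mu]_x (log_gamma_fun (c + j%:R / 2) x)%:E = g%:E.
  by have [g g0 ig] := integral_log_gamma_fun (cj j); exists g.
have [G HG] := choice ex.
have G0 j : (0 < G j)%R by have [] := HG j.
have iG j : \int[mu]_x (log_gamma_fun (c + j%:R / 2) x)%:E = (G j)%:E by have [] := HG j.
exists G; split => //.
- move=> j; split.
  + by apply: measurable_funM => //; exact: measurable_log_gamma_fun.
  + by move=> x; rewrite divr_ge0 ?log_gamma_fun_ge0// ltW.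
  + by apply: integral_div => //; [exact: measurable_log_gamma_fun|exact: log_gamma_fun_ge0].
- move=> f z mf f0; rewrite conv_log_gammaE; apply: conv_iter_normalize => //.
  + by move=> j; exact: measurable_log_gamma_fun.
  + by move=> j x; exact: log_gamma_fun_ge0.
Qed.

Lemma conv_iter_cst1 p (g : nat -> R -> R) z : (forall j, density (g j)) ->
  conv_iter p g (fun=> 1) z = 1.
Proof.
elim: p g => [//|p IH] g dg.
rewrite -[LHS]/(conv_iter p (fun j => g j.+1) (conv (g 0%N) (fun=> 1)) z).
have -> : conv (g 0%N) (fun=> 1) = fun=> 1.
  apply/funext => u; have [_ _ ig] := dg 0%N.
  by rewrite /conv -[RHS]ig; apply: eq_integral => x _; rewrite mul1e.
by apply: IH => j; exact: dg.
Qed.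

(** Each of the p factors is replaced by a Gaussian of variance 2/N; their sum has
    variance 2p/N. The two bounds follow from the symmetric roles of the densities
    in [conv_iter_dist]. *)
Lemma log_gamma_iter_gauss p (N r : R) (f : R -> \bar R) z
    (G : nat -> R) : (1 <= N)%R -> (0 <= r)%R -> (r + p%:R <= N)%R -> (0 < p)%N ->
  measurable_fun setT f -> (forall x, 0 <= f x <= 1) ->
  (forall j, 0 < G j)%R ->
  (forall j, \int[mu]_x (log_gamma_fun ((N + r) / 2 + j%:R / 2) x)%:E = (G j)%:E) ->
  let C := conv_iter p (fun j x => log_gamma_fun ((N + r) / 2 + j%:R / 2) x / G j)%R f z in
  let H := conv (gauss_pdf (N / (2 * p%:R))%R) f z in
  let e := (p%:R * (912 / Num.sqrt N + 12 * (r + p%:R) / N))%R in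
  C <= H + e%:E /\ H <= C + e%:E.
Proof.
move=> N1 r0 rpN p0 mf f01 G0 iG C H e.
have N0 : (0 < N)%R by exact: lt_le_trans ltr01 N1.
have N20 : (0 < N / 2)%R by rewrite divr_gt0.
have s0 : (0 < Num.sqrt N)%R by rewrite sqrtr_gt0.
have f0 x : 0 <= f x by have /andP[] := f01 x.
pose g j x := (log_gamma_fun ((N + r) / 2 + j%:R / 2) x / G j)%R.
have c0 j : (0 < (N + r) / 2 + j%:R / 2)%R.
  by rewrite ltr_wpDr ?divr_ge0// divr_gt0// ltr_wpDr.
have dg j : density (g j).
  split.
  + by apply: measurable_funM => //; exact: measurable_log_gamma_fun.
  + by move=> x; rewrite divr_ge0 ?log_gamma_fun_ge0// ltW.
  + by apply: integral_div => //; [exact: measurable_log_gamma_fun|exact: log_gamma_fun_ge0].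
have dh : density (gauss_pdf (N / 2)) := density_gauss_pdf N20.
pose de (j : nat) := (912 / Num.sqrt N + 12 * (r + j%:R) / N)%R.
have l1 j : (j < p)%N -> \int[mu]_x `|g j x - gauss_pdf (N / 2) x|%:E <= (de j)%:E.
  move=> jp; have rj0 : (0 <= r + j%:R)%R by rewrite addr_ge0.
  have rjN : (r + j%:R <= N)%R.
    by apply: le_trans rpN; rewrite lerD2l ler_nat ltnW.
  have [G' G'0 [iG']] := log_gamma_l1 N1 rj0 rjN.
  have cE : (N / 2 + (r + j%:R) / 2 = (N + r) / 2 + j%:R / 2)%R by field.
  rewrite cE in iG' *.
  have -> : G' = G j by apply: EFin_inj; rewrite -iG' iG.
  by [].
have sde : (\sum_(j < p) de j <= e)%R.
  rewrite (_ : e = \sum_(j < p) (912 / Num.sqrt N + 12 * (r + p%:R) / N))%R; last first.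
    by rewrite sumr_const card_ord -[RHS]mulr_natl.
  apply: ler_sum => j _; apply: lerD; first exact: lexx.
  apply: ler_wpM2r; first by rewrite invr_ge0 ltW.
  by apply: ler_wpM2l; [exact: ler0n|rewrite lerD2l ler_nat ltnW].
(* Variances add up: p times 2 / N is the inverse of N / (2p). *)
have HE : conv_iter p (fun=> gauss_pdf (N / 2)) f z = H.
  rewrite /H; case: (p) p0 => // q _.
  have -> : (N / 2 = (2 / N)^-1)%R by rewrite invf_div.
  rewrite conv_iter_gauss//; last by rewrite divr_gt0.
  congr (conv (gauss_pdf _) f z); field.
  by rewrite addrC natr1 pnatr_eq0/= gt_eqF.
have le0 (u v : \bar R) : u <= v + (0 + \sum_(j < p) de j)%:E -> u <= v + e%:E.
  by move=> uv; apply: (le_trans uv); rewrite leeD2l// lee_fin add0r.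
split; apply: le0; rewrite -HE.
  apply: conv_iter_dist => //.
  - by move=> j _; exact: dg.
  - by move=> x; rewrite leeDl.
apply: conv_iter_dist => //.
- by move=> j _; exact: dg.
- by move=> x; rewrite leeDl.
- by move=> j jp; under eq_integral do rewrite distrC; exact: l1.
Qed.

End conv_log_gamma_gauss.

(** * The posterior for fixed data *)

Section posterior_fixed_data.
Context {R : realType}.
Local Notation mu := (@lebesgue_measure R).

Lemma ln_det_invmx p (O : 'M[R]_p) : ln (\det (invmx O)) = - ln (\det O).
Proof.
have [uO|nuO] := boolP (O \in unitmx); last first.
  have d0 : \det O = 0.
    by move: nuO; rewrite unitmxE unitfE negbK => /eqP.
  by rewrite /invmx (negbTE nuO) d0 ln0// oppr0.
rewrite det_inv; have [d0|d0] := ltP 0 (\det O); first by rewrite lnV.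
by rewrite !ln0 ?oppr0// invr_le0.
Qed.

Lemma measurable_ln_det p : measurable_fun setT (fun O : 'M[R]_p => ln (\det O)).
Proof. exact: measurableT_comp (@measurable_ln R) (@measurable_det R p). Qed.

Lemma measurable_wishart_fun p b : measurable_fun setT (@wishart_fun R p b).
Proof.
apply: measurableT_comp; first exact: measurable_expR.
apply: measurable_funB; apply: measurable_funM => //.
- exact: measurable_ln_det.
- exact: measurable_trace.
Qed.

Lemma wishart_mass p b : (1 <= b)%N -> exists2 Z, 0 < Z &
  (\int[lebesgue_sym p]_(O in @psd R p) (wishart_fun b O)%:E = Z%:E)%E.
Proof.
move=> b1; have b0 : (0 < b%:R :> R) by rewrite ltr0n.
have s1 : -1 < (b%:R - 2) / 2 :> R by lra.
have p1 := @posdef1 R p.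
have [K K0 HK] := wishart_logdet_integral p1 s1.
have c0 : 0 < (b%:R - 2) / 2 + 1 :> R by lra.
have [G [G0 iG dG GE]] := conv_log_gamma_density p c0.
have m1 : measurable_fun setT (fun _ : R => 1%E : \bar R) by exact: measurable_cst.
exists (K * \prod_(j < p) G j); first by rewrite mulr_gt0// prodr_gt0.
pose z := \sum_(j < p) ln (2 * ((b%:R - 2) / 2 + 1 + j%:R / 2)) - ln (\det (1%:M : 'M[R]_p)).
rewrite EFinM -[X in (_ * X)%E]mule1 -(conv_iter_cst1 p z dG) -GE// -HK//.
rewrite integral_mkcond; apply: eq_integral => O _.
rewrite /wishart_integrand indicE patchE mulmx1; case: ifPn => _.
  by rewrite !mul1e.
by rewrite mul0e.
Qed.

Lemma integral_wishart p b : (1 <= b)%N -> exists2 Z, 0 < Z &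
  forall g : 'M[R]_p -> \bar R, measurable_fun setT g -> (forall O, 0 <= g O)%E ->
  (\int[wishart p b]_O g O = \int[lebesgue_sym p]_O
     (g O * (\1_(@psd R p) O * (Z * wishart_fun b O))%:E))%E.
Proof.
move=> b1; have [Z Z0 ZE] := @wishart_mass p b b1.
exists Z^-1; first by rewrite invr_gt0.
move=> g mg g0; apply: integral_density => //.
- apply: measurable_funM; first by apply: measurable_indic; exact: measurable_psd.
  by apply: measurable_funM => //; exact: measurable_wishart_fun.
- by move=> O; rewrite mulr_ge0// mulr_ge0 ?expR_ge0// invr_ge0 ltW.
- move=> B mB; rewrite /= /wishart [LHS]integral_mkcondr; apply: eq_integral => O _.
  by rewrite patchE /wishart_pdf ZE indicE; case: ifPn => _; rewrite ?mul1r ?mul0r.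
Qed.

Lemma sample_cov_trace n p (x : 'I_n -> 'cV[R]_p) (O : 'M[R]_p) :
  \tr (O *m (n%:R *: sample_cov x + 1%:M)) = n%:R * \tr (O *m sample_cov x) + \tr O.
Proof. by rewrite mulmxDr raddfD/= -scalemxAr mxtraceZ mulmx1. Qed.

(** Prior and likelihood multiply to a Wishart weight of exponent (n+b-2)/2 and
    matrix A = n S + I. *)
Lemma posterior_integral n p b (x : 'I_n -> 'cV[R]_p) : (1 <= b)%N ->
  posdef (n%:R *: sample_cov x + 1%:M) ->
  exists2 K, 0 < K & forall f : R -> \bar R,
    measurable_fun setT f -> (forall u, 0 <= f u)%E ->
    (\int[wishart p b]_O (f (ln (\det O)) * (expR (loglik x O))%:E) =
     K%:E * conv_log_gamma p ((n%:R + b%:R) / 2) f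
       (\sum_(j < p) ln (n%:R + b%:R + j%:R)
         - ln (\det (n%:R *: sample_cov x + 1%:M))))%E.
Proof.
move=> b1 pA; set A := _ + _ in pA *.
have b0 : (0 < b%:R :> R) by rewrite ltr0n.
have n0 : (0 <= n%:R :> R) by [].
have [Z Z0 ZE] := @integral_wishart p b b1.
pose s : R := (n%:R + b%:R - 2) / 2.
have s1 : -1 < s by rewrite /s; lra.
have [K K0 HK] := wishart_logdet_integral pA s1.
exists (Z * K); first exact: mulr_gt0.
move=> f mf f0.
have mll : measurable_fun setT (fun O : 'M[R]_p => (expR (loglik x O))%:E).
  apply/measurable_EFinP; apply: measurableT_comp; first exact: measurable_expR.
  apply: measurable_funB; apply: measurable_funM => //; first exact: measurable_ln_det.
  apply: (measurableT_comp (@measurable_trace R p)).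
  by apply: measurable_fun_mulmx => //; exact: measurable_cst.
rewrite ZE; last 2 first.
- by apply: emeasurable_funM => //; exact: (measurableT_comp mf (@measurable_ln_det p)).
- by move=> O; rewrite mule_ge0 ?lee_fin ?expR_ge0.
transitivity (\int[lebesgue_sym p]_O (Z%:E * wishart_integrand s A f O))%E.
  apply: eq_integral => O _; rewrite /wishart_integrand.
  rewrite -muleA -EFinM [RHS]muleCA [RHS]muleA -EFinM [RHS]muleCA -EFinM.
  congr (_ * _%:E)%E; rewrite [LHS]mulrCA -[RHS]mulrA; congr (_ * _).
  rewrite [LHS]mulrCA; congr (_ * _); rewrite /wishart_fun -expRD; congr expR.
  by rewrite sample_cov_trace /loglik /s; field.
rewrite ge0_integralZl//; last 3 first.
- exact: measurable_wishart_integrand.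
- by move=> O _; exact: wishart_integrand_ge0.
- by rewrite lee_fin ltW.
rewrite HK// EFinM muleA; congr (_ * conv_log_gamma p _ f (_ - _))%E.
- by rewrite /s; field.
- by apply: eq_bigr => j _; congr ln; rewrite /s; field.
Qed.

(** The posterior probability is a ratio of two integrals of the form computed by
    [posterior_integral], so the constant cancels and leaves the law of a sum of
    centered log-gamma variables. Its Gaussian approximation is off by e, and
    recentering it moves the argument of the normal distribution function. *)
Lemma posterior_bound n p b (x : 'I_n -> 'cV[R]_p) (t : R) :
  (1 <= n)%N -> (0 < p)%N -> (1 <= b)%N -> (b + p <= n)%N ->
  posdef (n%:R *: sample_cov x + 1%:M) ->
  `|posterior (wishart p b) x [set O | scaled_logdet_error x O <= t] - std_normal_cdf t| <=
  p%:R * (912 / Num.sqrt n%:R + 12 * (b%:R + p%:R) / n%:R) +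
  Num.sqrt (n%:R / (2 * p%:R)) *
  `|\sum_(j < p) ln (n%:R + b%:R + j%:R) - ln (\det (n%:R *: sample_cov x + 1%:M))
     + ln (\det (sample_cov x))|.
Proof.
move=> n1 p0 b1 bpn pA; set e := p%:R * _; set k := Num.sqrt _; set D := ln (\det (sample_cov x)).
set z := \sum_(j < p) _ - _.
set Bt := [set O | _].
have n0 : 0 < n%:R :> R by rewrite ltr0n.
have pR0 : 0 < p%:R :> R by rewrite ltr0n.
have k2 : 0 < n%:R / (2 * p%:R) :> R by rewrite divr_gt0// mulr_gt0.
have k0 : 0 < k by rewrite sqrtr_gt0.
have kk : k ^+ 2 = n%:R / (2 * p%:R) by rewrite sqr_sqrtr// ltW.
(* The event in terms of L = log det(O); Sigma being the inverse of O, its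
   log-determinant is - L. *)
pose B : set R := [set L | k * (- L - D) <= t].
have mB : measurable (B : set (measurableTypeR R)).
  rewrite (_ : B = `[(- D - t / k)%R, +oo[%classic); first exact: measurable_itv.
  have E L : (k * (- L - D) <= t) = (- D - t / k <= L).
    rewrite -subr_ge0 (_ : t - _ = k * (L - (- D - t / k))); last by field; rewrite gt_eqF.
    by rewrite pmulr_rge0// subr_ge0.
  by apply/seteqP; split => L /=; rewrite /B/= in_itv/= andbT E.
pose f1 (L : R) : \bar R := (\1_B L : R)%:E.
have mf1 : measurable_fun setT f1 by apply/measurable_EFinP; exact: measurable_indic.
have f101 L : (0 <= f1 L <= 1)%E by rewrite /f1 indicE; case: (_ \in _); rewrite !lee_fin lexx ler01.
have f10 L : (0 <= f1 L)%E by have /andP[] := f101 L.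
have m1 : measurable_fun setT (fun _ : R => 1%E : \bar R) by exact: measurable_cst.
have [K K0 HK] := posterior_integral b1 pA.
have c0 : 0 < (n%:R + b%:R) / 2 :> R by rewrite divr_gt0// ltr_wpDr.
have [G [G0 iG dG0 GE0]] := conv_log_gamma_density p c0.
pose g (j : nat) (y : R) := log_gamma_fun ((n%:R + b%:R) / 2 + j%:R / 2) y / G j.
have dG j : density (g j) by exact: dG0.
have GE f u : measurable_fun setT f -> (forall y, 0 <= f y)%E ->
    conv_log_gamma p ((n%:R + b%:R) / 2) f u = ((\prod_(j < p) G j)%:E * conv_iter p g f u)%E.
  exact: GE0.
pose P := \prod_(j < p) G j.
have P0 : 0 < P by rewrite prodr_gt0.
have C0 u : (0 <= conv_iter p g f1 u)%E.
  by apply: conv_iter_ge0 => // j y; have [_ g0 _] := dG j; exact: g0.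
have n1R : 1 <= n%:R :> R by rewrite ler1n.
have bpnR : b%:R + p%:R <= n%:R :> R by rewrite -natrD ler_nat.
have [le1 le2] : (conv_iter p g f1 z <=
      conv (gauss_pdf (n%:R / (2 * p%:R))) f1 z + e%:E /\
    conv (gauss_pdf (n%:R / (2 * p%:R))) f1 z <= conv_iter p g f1 z + e%:E)%E.
  exact: (log_gamma_iter_gauss z n1R (ler0n R b) bpnR p0 mf1 f101 G0 iG).
have HC : conv (gauss_pdf (n%:R / (2 * p%:R))) f1 z = normal_prob 0 1 `]-oo, (t + k * (z + D))].
  by rewrite -kk conv_gauss_cdf.
rewrite HC in le1 le2.
have finN : normal_prob 0 1 `]-oo, (t + k * (z + D))] \is a fin_num by exact: fin_num_measure.
have finC : conv_iter p g f1 z \is a fin_num.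
  rewrite ge0_fin_numE//; apply: (le_lt_trans le1).
  by rewrite -(fineK finN) -EFinD ltry.
have post : posterior (wishart p b) x Bt =
    fine (conv_iter p g f1 z).
  rewrite /posterior.
  have -> : (\int[wishart p b]_(O in Bt) (expR (loglik x O))%:E =
     (K * P)%:E * conv_iter p g f1 z)%E.
    rewrite EFinM -muleA -GE// -HK// [LHS]integral_mkcond; apply: eq_integral => O _.
    rewrite /f1 indicE.
    have -> : (ln (\det O) \in B) = (O \in Bt).
      apply/idP/idP; rewrite !inE /Bt /B/= /scaled_logdet_error ln_det_invmx//.
    by rewrite patchE; case: ifPn => _; rewrite ?mul1e ?mul0e.
  have -> : (\int[wishart p b]_O (expR (loglik x O))%:E = (K * P)%:E)%E.
    rewrite -[RHS]mule1 -(conv_iter_cst1 p z dG) EFinM -muleA -GE// -HK//.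
    by apply: eq_integral => O _; rewrite mul1e.
  by rewrite fineM//= mulrAC divff ?mul1r// gt_eqF// mulr_gt0.
rewrite post; set c := fine _.
have -> : c - std_normal_cdf t = (c - std_normal_cdf (t + k * (z + D))) +
   (std_normal_cdf (t + k * (z + D)) - std_normal_cdf t) by ring.
apply: (le_trans (ler_normD _ _)); apply: lerD.
  rewrite ler_distl; apply/andP; split.
    rewrite lerBlDr -lee_fin EFinD [std_normal_cdf _]/(fine _) !fineK//.
  rewrite -lee_fin EFinD !fineK//.
apply: (le_trans (std_normal_cdf_lipschitz _ _)).
by rewrite addrAC subrr add0r normrM gtr0_norm.
Qed.

End posterior_fixed_data.

(** * Deterministic bounds on log-determinants and quadratic forms *)

Section deterministic_bounds.
Context {R : realType}.

Lemma sample_cov_sym n p (x : 'I_n -> 'cV[R]_p) : (sample_cov x)^T = sample_cov x.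
Proof.
apply/matrixP => i j; rewrite !mxE !summxE; congr (_ * _).
by apply: eq_bigr => k _; rewrite !mxE; apply: eq_bigr => l _; rewrite !mxE mulrC.
Qed.

(** Both ln (1 + (b+j)/n) <= (b+j)/n and, by n S <= n S + I <= (1 + 1/(n lam)) n S,
    the ratio of the two determinants lies between 1 and (1 + 1/(n lam))^p. *)
Lemma logdet_shift_bound n p b (x : 'I_n -> 'cV[R]_p) (lam : R) :
  (1 <= n)%N -> 0 < lam -> (forall u, lam * quad 1%:M u <= quad (sample_cov x) u) ->
  posdef (n%:R *: sample_cov x + 1%:M) /\
  `|\sum_(j < p) ln (n%:R + b%:R + j%:R) - ln (\det (n%:R *: sample_cov x + 1%:M))
     + ln (\det (sample_cov x))| <=
  p%:R * (b%:R + p%:R) / n%:R + p%:R / (n%:R * lam).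
Proof.
move=> n1 lam0 Slam; set S := sample_cov x in Slam *.
have n0 : 0 < n%:R :> R by rewrite ltr0n.
have pS : posdef S.
  split; first exact: sample_cov_sym.
  by move=> u u0; apply: lt_le_trans (Slam u); rewrite mulr_gt0// quad1_gt0.
have pnS : posdef (n%:R *: S) by exact: posdefZ.
have pA : posdef (n%:R *: S + 1%:M) by apply: posdefD => //; exact: psd1.
split => //; set A := _ + 1%:M in pA *.
have dS := posdef_det_gt0 pS; have dA := posdef_det_gt0 pA; have dnS := posdef_det_gt0 pnS.
have nlam : 0 < n%:R * lam by rewrite mulr_gt0.
pose c := 1 + (n%:R * lam)^-1.
have c0 : 0 < c by rewrite addr_gt0// invr_gt0.
have low : \det (n%:R *: S) <= \det A.
  by apply: det_le_loewner => // u; rewrite quadD lerDl quad1_ge0.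
have up : \det A <= \det (c *: (n%:R *: S)).
  apply: det_le_loewner => //; first exact: posdefZ.
  move=> u; rewrite quadD [quad (c *: _) u]quadZ /c mulrDl mul1r lerD2l quadZ.
  by rewrite ler_pdivlMl// -mulrA ler_pM2l.
have lnS : ln (\det (n%:R *: S)) = p%:R * ln n%:R + ln (\det S).
  by rewrite detZ lnM ?posrE ?exprn_gt0// lnXn// mulr_natl.
have l1 : 0 <= ln (\det A) - ln (\det (n%:R *: S)) by rewrite subr_ge0 ler_ln ?posrE.
have l2 : ln (\det A) - ln (\det (n%:R *: S)) <= p%:R / (n%:R * lam).
  rewrite lerBlDr; apply: (@le_trans _ _ (ln (\det (c *: (n%:R *: S))))).
    by rewrite ler_ln ?posrE// detZ mulr_gt0// exprn_gt0.
  rewrite detZ lnM ?posrE ?exprn_gt0// lnXn// lerD2r -[leLHS]mulr_natl.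
  apply: ler_wpM2l; first exact: ler0n.
  by rewrite /c le_ln1Dx// (lt_trans (ltrN10 R))// invr_gt0.
pose s := \sum_(j < p) (ln (n%:R + b%:R + j%:R) - ln n%:R : R).
have s1 : 0 <= s.
  by apply: sumr_ge0 => j _; rewrite subr_ge0 ler_ln ?posrE// -addrA ?lerDl ?addr_ge0// ltr_wpDr// addr_ge0.
have s2 : s <= p%:R * (b%:R + p%:R) / n%:R.
  apply: (@le_trans _ _ (\sum_(j < p) ((b%:R + p%:R) / n%:R))); last first.
    by rewrite sumr_const card_ord -[leLHS]mulr_natl mulrA.
  apply: ler_sum => j _.
  have -> : n%:R + b%:R + j%:R = n%:R * (1 + (b%:R + j%:R) / n%:R) :> R.
    by field; rewrite gt_eqF.
  have bj0 : 0 <= (b%:R + j%:R) / n%:R :> R by rewrite divr_ge0// addr_ge0.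
  rewrite lnM ?posrE// ?ltr_wpDr// addrAC subrr add0r.
  apply: (@le_trans _ _ ((b%:R + j%:R) / n%:R)).
    by rewrite le_ln1Dx// (lt_le_trans (ltrN10 R)).
  by rewrite ler_pM2r ?invr_gt0// lerD2l ler_nat ltnW.
have -> : \sum_(j < p) ln (n%:R + b%:R + j%:R) - ln (\det A) + ln (\det S) =
    s - (ln (\det A) - ln (\det (n%:R *: S))).
  rewrite lnS /s sumrB sumr_const card_ord -[ln n%:R *+ p]mulr_natl; ring.
rewrite ler_norml; apply/andP; split; last by lra.
have : 0 <= p%:R * (b%:R + p%:R) / n%:R :> R by rewrite divr_ge0// mulr_ge0// addr_ge0.
by lra.
Qed.

(** Cauchy-Schwarz, in the form of the inequality 2 x y <= k x^2 + y^2 / k for each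
    product of an entry of D with u_i u_j; k = lam / |u|^2 balances the two sums. *)
Lemma frobenius_quad p (D : 'M[R]_p) (lam : R) (u : 'cV[R]_p) : 0 < lam ->
  \sum_i \sum_j D i j ^+ 2 <= lam ^+ 2 -> `|quad D u| <= lam * quad 1%:M u.
Proof.
move=> lam0 FD.
have [->|u0] := eqVneq u 0; first by rewrite !quad0 normr0 mulr0.
have r0 := quad1_gt0 u0; set r := quad 1%:M u in r0 *.
have quE : quad D u = \sum_i \sum_j u i 0 * D j i * u j 0.
  rewrite /quad mxE; apply: eq_bigr => i _; rewrite mxE mulr_suml.
  by apply: eq_bigr => j _; rewrite !mxE; ring.
apply: (@le_trans _ _ (\sum_i \sum_j
    (lam / r * (u i 0 ^+ 2 * u j 0 ^+ 2) + r / lam * D j i ^+ 2) / 2)).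
  rewrite quE; apply: (le_trans (ler_norm_sum _ _ _)); apply: ler_sum => i _.
  apply: (le_trans (ler_norm_sum _ _ _)); apply: ler_sum => j _.
  have lr0 : 0 < lam / r by rewrite divr_gt0.
  have -> : r / lam = (lam / r)^-1 by rewrite invf_div.
  move: (lam / r) lr0 (u i 0) (u j 0) (D j i) => k k0 a b d.
  have h1 : 0 <= (k * (a * b) - d) ^+ 2 by exact: sqr_ge0.
  have h2 : 0 <= (k * (a * b) + d) ^+ 2 by exact: sqr_ge0.
  have e : (k * (a ^+ 2 * b ^+ 2) + k^-1 * d ^+ 2) / 2 - a * d * b =
      (k * (a * b) - d) ^+ 2 / (2 * k) by field; rewrite gt_eqF.
  have e' : (k * (a ^+ 2 * b ^+ 2) + k^-1 * d ^+ 2) / 2 + a * d * b =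
      (k * (a * b) + d) ^+ 2 / (2 * k) by field; rewrite gt_eqF.
  rewrite ler_norml; apply/andP; split.
    by rewrite -subr_ge0 opprK [leRHS]addrC e' divr_ge0// mulr_ge0// ltW.
  by rewrite -subr_ge0 e divr_ge0// mulr_ge0// ltW.
have sumE : \sum_i \sum_j (lam / r * (u i 0 ^+ 2 * u j 0 ^+ 2) + r / lam * D j i ^+ 2) / 2 =
   (lam / r * r ^+ 2 + r / lam * \sum_i \sum_j D j i ^+ 2) / 2.
  under eq_bigr => i _.
    rewrite -mulr_suml big_split/= -!mulr_sumr.
  over.
  rewrite -mulr_suml big_split/= -!mulr_sumr; congr ((_ + _) / 2).
  by rewrite -mulr_suml expr2 /r quad1E.
rewrite sumE exchange_big/=.
rewrite ler_pdivrMr//.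
have -> : lam * r * 2 = lam / r * r ^+ 2 + r / lam * lam ^+ 2 by field; rewrite !gt_eqF.
by rewrite lerD2l ler_pM2l// divr_gt0.
Qed.

Lemma l2normE p (u : 'cV[R]_p) : l2norm u = Num.sqrt (quad 1%:M u).
Proof. by rewrite /l2norm quad1E. Qed.

(** Apply the definition of the spectral norm to u / |u|. The supremum is over a
    bounded set, as the Euclidean norm of M x is controlled by the sums of the
    absolute entries of the rows. *)
Lemma quad1_mul_le p (M : 'M[R]_p) (C : R) (u : 'cV[R]_p) : spectral_norm M <= C ->
  quad 1%:M (M *m u) <= C ^+ 2 * quad 1%:M u.
Proof.
move=> MC.
have [->|u0] := eqVneq u 0; first by rewrite mulmx0 !quad0 mulr0.
have r0 := quad1_gt0 u0.
have bounded : has_ubound [set l2norm (M *m x) | x in [set x : 'cV[R]_p | l2norm x <= 1]].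
  exists (Num.sqrt (\sum_i (\sum_j `|M i j|) ^+ 2)) => _ /= [x x1 <-].
  rewrite l2normE ler_sqrt; last by apply: sumr_ge0 => i _; exact: sqr_ge0.
  have x2 : quad 1%:M x <= 1.
    by move: x1; rewrite l2normE -[X in _ <= X]sqrtr1 ler_sqrt.
  rewrite quad1E; apply: ler_sum => i _; rewrite mxE -real_normK ?num_real//.
  apply: lerXn2r; rewrite ?nnegrE ?normr_ge0//; first by apply: sumr_ge0.
  apply: (le_trans (ler_norm_sum _ _ _)); apply: ler_sum => j _.
  rewrite normrM ler_piMr// -(@ler_pXn2r _ 2)// ?nnegrE// expr1n real_normK ?num_real//.
  apply: le_trans x2; rewrite quad1E (bigD1 j)//= lerDl.
  by apply: sumr_ge0 => k _; exact: sqr_ge0.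
have sr0 : 0 < Num.sqrt (quad 1%:M u) by rewrite sqrtr_gt0.
pose x := (Num.sqrt (quad 1%:M u))^-1 *: u.
have sx : ((Num.sqrt (quad 1%:M u))^-1) ^+ 2 = (quad 1%:M u)^-1.
  by rewrite exprVn sqr_sqrtr// ltW.
have x1 : l2norm x <= 1.
  by rewrite l2normE quad_scale sx mulVf ?gt_eqF// sqrtr1.
have : l2norm (M *m x) <= C.
  apply: le_trans MC; apply: ub_le_sup => //; by exists x.
rewrite l2normE /x -scalemxAr quad_scale sx => MxC.
have C0 : 0 <= C by apply: le_trans MxC; exact: sqrtr_ge0.
have : (quad 1%:M u)^-1 * quad 1%:M (M *m u) <= C ^+ 2.
  rewrite -[leLHS]sqr_sqrtr; last by rewrite mulr_ge0 ?quad1_ge0// invr_ge0 quad1_ge0.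
  by apply: lerXn2r => //; rewrite nnegrE.
by rewrite ler_pdivrMl// mulrC.
Qed.

(** With y = M u one has |y| <= C |u|, and quad M u is the scalar product of u and
    y. *)
Lemma quad_le_spectral p (M : 'M[R]_p) (C : R) (u : 'cV[R]_p) : 0 < C ->
  spectral_norm M <= C -> quad M u <= C * quad 1%:M u.
Proof.
move=> C0 MC; have := quad1_mul_le u MC.
set y := M *m u => yC.
have := quad1_ge0 (C *: u - y).
rewrite -[- y]scaleN1r quad_addl ?tr_scalar_mx// !quad_scale sqrrN expr1n mul1r.
have -> : (-1 *: y)^T = -1 *: y^T by exact: linearZ.
rewrite mulmx1 -scalemxAr -scalemxAl scalerA mxE.
have -> : (y^T *m u) 0 0 = quad M u.
  have -> : y^T *m u = (u^T *m y)^T by rewrite [RHS]trmx_mul trmxK.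
  by rewrite mxE /y mulmxA.
move=> h; rewrite -(ler_pM2l C0); nra.
Qed.

(** Expand the nonnegative quad M (u - C^-1 M^-1 u) and bound quad M^-1 u above by
    C |u|^2. *)
Lemma quad_ge_spectral_inv p (M : 'M[R]_p) (C : R) (u : 'cV[R]_p) : 0 < C -> posdef M ->
  spectral_norm (invmx M) <= C -> C^-1 * quad 1%:M u <= quad M u.
Proof.
move=> C0 pM MC; have iq := quad_le_spectral u C0 MC.
have sM := posdef_sym pM; have uM := posdef_unit pM.
have := psd_quad_ge0 (u + (- C^-1) *: (invmx M *m u)) (posdef_psd pM).
rewrite quad_addl// quad_scale sqrrN.
have -> : (- C^-1 *: (invmx M *m u))^T = - C^-1 *: (invmx M *m u)^T by exact: linearZ.
have E1 : (invmx M *m u)^T *m M = u^T.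
  by rewrite trmx_mul trmx_inv sM -mulmxA mulVmx// mulmx1.
have -> : quad M (invmx M *m u) = quad (invmx M) u by rewrite /quad E1 mulmxA.
have Z b (A : 'M[R]_1) : (b *: A) 0 0 = b * A 0 0 by rewrite mxE.
rewrite -!scalemxAl E1 Z.
have -> : (u^T *m u) 0 0 = quad 1%:M u by rewrite /quad mulmx1.
have : C^-1 ^+ 2 * quad (invmx M) u <= C^-1 ^+ 2 * (C * quad 1%:M u).
  by rewrite ler_pM2l// exprn_gt0// invr_gt0.
have -> : C^-1 ^+ 2 * (C * quad 1%:M u) = C^-1 * quad 1%:M u by field; rewrite gt_eqF.
by move=> h1 h2; lra.
Qed.

End deterministic_bounds.

(** * Moments of Gaussian projections *)

(** A second-order bound, valid for both signs of y: it gives the exponential moments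
    of s Y^2 up to O(s^2), which is what determines E Y^2. *)
Lemma inv_sqrt_le (R : realType) (y : R) : `|y| <= 2^-1 ->
  (Num.sqrt (1 - y))^-1 <= 1 + y / 2 + y ^+ 2.
Proof.
move=> yh; have [yl yu] : - 2^-1 <= y /\ y <= 2^-1 by move: yh; rewrite ler_norml => /andP[].
have d0 : 0 < 1 - y by lra.
have b0 : 0 < 1 + y / 2 + y ^+ 2 by have := sqr_ge0 y; lra.
rewrite -sqrtrV; last exact: ltW.
rewrite -[leRHS]ger0_norm; last exact: ltW.
rewrite -sqrtr_sqr ler_sqrt ?sqr_ge0//.
rewrite -div1r ler_pdivrMr//.
have -> : (1 + y / 2 + y ^+ 2) ^+ 2 * (1 - y) =
  1 + y ^+ 2 * (5 / 4 * (1 - y) - y ^+ 3) by field.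
rewrite lerDl mulr_ge0 ?sqr_ge0//.
have y2 : y ^+ 2 <= 4^-1.
  by rewrite -real_normK ?num_real// -[leRHS](_ : 2^-1 ^+ 2 = _); [apply: lerXn2r; rewrite ?nnegrE|field].
have : y ^+ 3 <= 8^-1.
  apply: (@le_trans _ _ (y ^+ 2 * 2^-1)); first by rewrite exprSr ler_wpM2l ?sqr_ge0.
  lra.
lra.
Qed.

Section gaussian_moments.
Context {R : realType} d (T : measurableType d) (P : probability T R).
Variables (p : nat) (S : 'M[R]_p) (pS : posdef S).
Variable X : {mfun T >-> 'cV[R]_p}.
Hypothesis XS : forall A, measurable A -> distribution P X A = multinormal_prob S A.

Lemma multinormal_pdf_ge0 x : 0 <= multinormal_pdf S x.
Proof. by rewrite mulr_ge0 ?expR_ge0// invr_ge0. Qed.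

Lemma multinormal_pdfE x : multinormal_pdf S x =
  (Num.sqrt ((2 * pi) ^+ p * \det S))^-1 * expR (- quad (invmx S) x / 2).
Proof. by []. Qed.

Lemma measurable_multinormal_pdf : measurable_fun setT (multinormal_pdf S).
Proof.
rewrite (_ : multinormal_pdf S = fun x => (Num.sqrt ((2 * pi) ^+ p * \det S))^-1 *
  expR (- quad (invmx S) x / 2)); last by apply/funext => x; rewrite multinormal_pdfE.
apply: measurable_funM => //.
by apply/measurable_EFinP; exact: measurable_expR_quad.
Qed.

Lemma integral_multinormal (f : 'cV[R]_p -> \bar R) :
  measurable_fun setT f -> (forall x, 0 <= f x)%E ->
  (\int[P]_w f (X w) = \int[lebesgue_col p]_x (f x * (multinormal_pdf S x)%:E))%E.
Proof.
move=> mf f0; rewrite -ge0_integral_distribution//.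
apply: integral_density => //; first exact: measurable_multinormal_pdf.
exact: multinormal_pdf_ge0.
Qed.

Definition proj (u x : 'cV[R]_p) : R := (u^T *m x) 0 0.

Lemma measurable_proj u : measurable_fun setT (proj u).
Proof.
by apply: measurable_fun_mxentry; apply: measurable_fun_mulmx => //; exact: measurable_cst.
Qed.

(** Both sides come from pivoting the matrix bordered by u, u^T and 1/s, on the
    corner entry and on M. *)
Lemma det_sub_outer (M : 'M[R]_p) u s : posdef M -> s != 0 ->
  \det (M - s *: (u *m u^T)) = \det M * (1 - s * quad (invmx M) u).
Proof.
move=> pM s0; have sV0 : s^-1 != 0 by rewrite invr_neq0.
have := det_block_schur M u sV0; rewrite det_block_pivot ?posdef_unit// invrK => H.
rewrite -[LHS](mulKf sV0) -H invrK; field.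
exact: s0.
Qed.

(** For s > 0 the matrix is the Schur complement of the same bordered matrix, which
    is positive definite because its other pivot is; for s < 0 a positive
    semi-definite matrix is added. *)
Lemma posdef_sub_outer (M : 'M[R]_p) u s : posdef M -> s != 0 ->
  s * quad (invmx M) u < 1 -> posdef (M - s *: (u *m u^T)).
Proof.
move=> pM s0 su.
have [sp|sn] := ltP 0 s.
  have q : quad (invmx M) u < s^-1 by rewrite -[s^-1]mulr1 ltr_pdivlMl.
  have pB : posdef (block_mx M u u^T s^-1%:M).
    apply: psd_unit_posdef; first by apply/(psd_blockE _ _ pM); exact: ltW.
    rewrite unitmxE unitfE det_block_pivot ?posdef_unit// gt_eqF// mulr_gt0 ?posdef_det_gt0//.
    by rewrite subr_gt0.
  by have [_] := posdef_block pB; rewrite invrK.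
rewrite -scaleNr; apply: posdefD => //; split.
  by rewrite linearZ/= trmx_mul trmxK.
by move=> x; rewrite -/(quad _ x) quadZ quad_outer mulr_ge0 ?sqr_ge0// oppr_ge0.
Qed.

(** The square of the projection is a quadratic form of rank one, so the moment is a
    Gaussian integral for the matrix S^-1 - s u u^T. *)
Lemma expectation_expR_proj u s : s != 0 -> s * quad S u < 1 ->
  (\int[P]_w (expR (s * proj u (X w) ^+ 2 / 2))%:E =
   ((Num.sqrt (1 - s * quad S u))^-1)%:E)%E.
Proof.
move=> s0 su.
have mf : measurable_fun setT (fun x : 'cV[R]_p => (expR (s * proj u x ^+ 2 / 2))%:E).
  apply/measurable_EFinP; apply: measurableT_comp; first exact: measurable_expR.
  apply: measurable_funM => //; apply: measurable_funM => //.
  by apply: measurable_funX; exact: measurable_proj.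
rewrite (integral_multinormal mf); last by move=> x; rewrite lee_fin expR_ge0.
have pI := posdef_inv pS.
have su' : s * quad (invmx (invmx S)) u < 1 by rewrite invmxK.
have pM := posdef_sub_outer pI s0 su'.
have dM : \det (invmx S - s *: (u *m u^T)) = (\det S)^-1 * (1 - s * quad S u).
  by rewrite det_sub_outer// det_inv invmxK.
have dS := posdef_det_gt0 pS.
have tp : 0 < (2 * pi) ^+ p :> R by rewrite exprn_gt0// mulr_gt0// pi_gt0.
pose k := (Num.sqrt ((2 * pi) ^+ p * \det S))^-1.
have y0 : 0 < 1 - s * quad S u by rewrite subr_gt0.
transitivity (\int[lebesgue_col p]_x (k%:E *
    (expR (- quad (invmx S - s *: (u *m u^T)) x / 2))%:E))%E.
  apply: eq_integral => x _; rewrite multinormal_pdfE -!EFinM; congr EFin.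
  rewrite mulrCA -expRD; congr (_ * expR _).
  by rewrite quadD -scaleNr quadZ quad_outer /proj; field.
rewrite ge0_integralZl//; last 2 first.
- exact: measurable_expR_quad.
- by rewrite lee_fin invr_ge0.
rewrite integral_gauss_quad// -EFinM dM; congr EFin; rewrite /k.
rewrite -sqrtrV; last by rewrite mulr_ge0 ?ltW.
rewrite -sqrtrM; last by rewrite invr_ge0 mulr_ge0 ?ltW.
rewrite -sqrtrV; last exact: ltW.
congr Num.sqrt; field.
by rewrite !gt_eqF.
Qed.

End gaussian_moments.

Section gaussian_low_moments.
Context {R : realType} d (T : measurableType d) (P : probability T R).
Variables (p : nat) (S : 'M[R]_p) (pS : posdef S).
Variable X : {mfun T >-> 'cV[R]_p}.
Hypothesis XS : forall A, measurable A -> distribution P X A = multinormal_prob S A.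
Variable u : 'cV[R]_p.
Let Y w := proj u (X w).
Let q := quad S u.
Let q0 : 0 <= q. Proof. exact/psd_quad_ge0/posdef_psd. Qed.

Lemma measurable_proj_rv : measurable_fun setT Y.
Proof.
have mX : measurable_fun setT X by exact: measurable_funP.
exact: (measurableT_comp (measurable_proj u) mX).
Qed.

Let mYn n : measurable_fun setT (fun w => (Y w ^+ n)%:E).
Proof. by apply/measurable_EFinP; apply: measurable_funX; exact: measurable_proj_rv. Qed.

Let mexp s : measurable_fun setT (fun w => (expR (s * Y w ^+ 2 / 2))%:E).
Proof.
apply/measurable_EFinP; apply: measurableT_comp; first exact: measurable_expR.
apply: measurable_funM => //; apply: measurable_funM => //.
by apply: measurable_funX; exact: measurable_proj_rv.
Qed.

Let Y2ge0 w : (0 <= (Y w ^+ 2)%:E)%E. Proof. by rewrite lee_fin sqr_ge0. Qed.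

(** Integrate 1 + y <= exp y at y = s Y^2 / 2 and y = - s Y^2 / 2: the exact
    exponential moments squeeze E Y^2, with no differentiation under the integral. *)
Let intY2 (s : R) : 0 < s -> s * q <= 2^-1 ->
  (\int[P]_w (Y w ^+ 2)%:E <= (q + 2 * s * q ^+ 2)%:E)%E /\
  ((q - 2 * s * q ^+ 2)%:E <= \int[P]_w (Y w ^+ 2)%:E)%E.
Proof.
move=> s0 sq; have sq0 : 0 <= s * q by rewrite mulr_ge0// ltW.
have s2 : 0 < s / 2 by rewrite divr_gt0.
have m2 : measurable_fun setT (fun w => ((s / 2)%:E * (Y w ^+ 2)%:E)%E).
  exact: emeasurable_funM.
have y1 : `|s * q| <= 2^-1 by rewrite ger0_norm.
have y1N : `|- s * q| <= 2^-1 by rewrite mulNr normrN.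
have E1 : (\int[P]_w (expR (s * Y w ^+ 2 / 2))%:E = ((Num.sqrt (1 - s * q))^-1)%:E)%E.
  by apply: (expectation_expR_proj pS XS); [rewrite gt_eqF|rewrite -/q; lra].
have E2 : (\int[P]_w (expR (- s * Y w ^+ 2 / 2))%:E = ((Num.sqrt (1 - - s * q))^-1)%:E)%E.
  by apply: (expectation_expR_proj pS XS); [rewrite lt_eqF// oppr_lt0|rewrite -/q; lra].
have H1 := inv_sqrt_le y1; have H2 := inv_sqrt_le y1N.
have c1 : (\int[P]_w (cst 1%E w) = 1 :> \bar R)%E.
  by rewrite (integral_cst P measurableT) mul1e; exact: probability_setT.
have I1 : (1 + (s / 2)%:E * \int[P]_w (Y w ^+ 2)%:E <=
    ((Num.sqrt (1 - s * q))^-1)%:E)%E.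
  rewrite -E1 -[X in (X + _)%E]c1 -ge0_integralZl//; last by rewrite lee_fin ltW.
  rewrite -ge0_integralD//; last by move=> w _; rewrite mule_ge0// lee_fin ltW.
  apply: ge0_le_integral => //.
  - by move=> w _; rewrite adde_ge0// mule_ge0// lee_fin ltW.
  - exact: emeasurable_funD.
  - move=> w _; rewrite -EFinM -EFinD lee_fin.
    by apply: le_trans (expR_ge1Dx _); rewrite lerD2l mulrAC.
have I2 : (1 <= ((Num.sqrt (1 - - s * q))^-1)%:E + (s / 2)%:E * \int[P]_w (Y w ^+ 2)%:E)%E.
  rewrite -E2 -[X in (X <= _)%E]c1 -ge0_integralZl//; last by rewrite lee_fin ltW.
  rewrite -ge0_integralD//; last by move=> w _; rewrite mule_ge0// lee_fin ltW.
  apply: ge0_le_integral => //.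
  - exact: emeasurable_funD.
  - move=> w _; rewrite -EFinM -EFinD lee_fin.
    by have := expR_ge1Dx (- s * Y w ^+ 2 / 2); lra.
have I0 : (0 <= \int[P]_w (Y w ^+ 2)%:E)%E by apply: integral_ge0.
move: I1 I2 I0; case: (\int[P]_w _)%E => [r| |]//=; last first.
  by rewrite gt0_muley ?lte_fin// addey// leye_eq.
rewrite -!EFinM -!EFinD !lee_fin => I1 I2 r0.
have hs : 0 < s^-1 by rewrite invr_gt0.
split.
  have : s / 2 * r <= s / 2 * (q + 2 * s * q ^+ 2) by move: H1; rewrite exprMn; lra.
  by rewrite ler_pM2l.
have : s / 2 * (q - 2 * s * q ^+ 2) <= s / 2 * r by move: H2; rewrite exprMn sqrrN; lra.
by rewrite ler_pM2l.
Qed.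

Lemma expectation_proj_sqr : (\int[P]_w (Y w ^+ 2)%:E = q%:E)%E.
Proof.
(* An s for which the bounds of [intY2] are within e of q. *)
have small (e : R) : 0 < e -> exists s : R, [/\ 0 < s, s * q <= 2^-1 & 2 * s * q ^+ 2 <= e].
  move=> e0; pose k := 2 * (q + 1) + 2 * q ^+ 2 / e.
  have k0 : 0 < k.
    rewrite ltr_wpDr//; first by rewrite divr_ge0 ?mulr_ge0 ?sqr_ge0// ltW.
    by rewrite mulr_gt0// ltr_wpDl.
  exists k^-1; split; first by rewrite invr_gt0.
    rewrite ler_pdivrMl// /k.
    have : 0 <= 2 * q ^+ 2 / e by rewrite divr_ge0 ?mulr_ge0 ?sqr_ge0// ltW.
    by move: q0; lra.
  rewrite -mulrA mulrCA ler_pdivrMl//.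
  have -> : k * e = 2 * (q + 1) * e + 2 * q ^+ 2 by rewrite /k; field; rewrite gt_eqF.
  rewrite lerDr; apply: mulr_ge0; last exact: ltW.
  by apply: mulr_ge0 => //; exact: addr_ge0.
apply/eqP; rewrite eq_le; apply/andP; split; apply/lee_addgt0Pr => e e0;
  have [s [s0 sq se]] := small e e0; have [h1 h2] := intY2 s0 sq.
  by apply: (le_trans h1); rewrite -EFinD lee_fin lerD2l.
rewrite -leeBlDr//; apply: le_trans h2.
by rewrite -EFinB lee_fin lerD2l lerN2.
Qed.

(** Integrate y^2 / 2 <= exp y at y = s Y^2 / 2 for s = 1 / (2q), which keeps s q away
    from 1. *)
Lemma expectation_proj_pow4 : (\int[P]_w (Y w ^+ 4)%:E <= (48 * q ^+ 2)%:E)%E.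
Proof.
have [u0|u0] := eqVneq u 0.
  have -> : (\int[P]_w (Y w ^+ 4)%:E = 0)%E.
    apply: integral0_eq => w _.
    by rewrite /Y /proj u0 trmx0 mul0mx mxE expr0n.
  by rewrite lee_fin mulr_ge0 ?sqr_ge0.
have qp : 0 < q := posdef_quad_gt0 pS u0.
pose s := (2 * q)^-1; have s0 : 0 < s by rewrite invr_gt0 mulr_gt0.
have sq : s * q = 2^-1 by rewrite /s; field; rewrite gt_eqF.
have E1 : (\int[P]_w (expR (s * Y w ^+ 2 / 2))%:E = ((Num.sqrt (1 - s * q))^-1)%:E)%E.
  by apply: (expectation_expR_proj pS XS); [rewrite gt_eqF|rewrite -/q sq; lra].
have k0 : 0 <= 8 / s ^+ 2 by rewrite divr_ge0// sqr_ge0.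
apply: (@le_trans _ _ ((8 / s ^+ 2)%:E * \int[P]_w (expR (s * Y w ^+ 2 / 2))%:E)%E).
  rewrite -ge0_integralZl//; apply: ge0_le_integral => //.
  - by move=> w _; rewrite lee_fin exprn_even_ge0.
  - exact: emeasurable_funM.
  - move=> w _; rewrite -EFinM lee_fin.
    have v0 : 0 <= s * Y w ^+ 2 / 2 by rewrite divr_ge0// mulr_ge0 ?sqr_ge0// ltW.
    have := expR_ge_deg2 v0; set E := expR _ => H.
    apply: (@le_trans _ _ (8 / s ^+ 2 * ((s * Y w ^+ 2 / 2) ^+ 2 / 2))).
      rewrite le_eqVlt; apply/orP; left; apply/eqP; field; rewrite gt_eqF//.
    by rewrite ler_wpM2l//; lra.
rewrite E1 sq -EFinM lee_fin.
have h2 : `|2^-1 : R| <= 2^-1 by rewrite ger0_norm.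
have := inv_sqrt_le h2.
have -> : 8 / s ^+ 2 = 32 * q ^+ 2 by rewrite /s; field; rewrite gt_eqF.
move=> h; apply: (@le_trans _ _ (32 * q ^+ 2 * (1 + 2^-1 / 2 + 2^-1 ^+ 2))).
  by rewrite ler_wpM2l// mulr_ge0 ?sqr_ge0.
by rewrite le_eqVlt; apply/orP; left; apply/eqP; field.
Qed.

End gaussian_low_moments.

(** * Second moments of sums of pairwise independent variables *)

Section pairwise_independence.
Context {R : realType} d (T : measurableType d) (P : probability T R).

(** Independence makes the law of the pair agree with the product of the laws on
    rectangles, hence everywhere; then Tonelli applies. *)
Lemma expectation_indep_mul n d' (U : measurableType d') (X : 'I_n -> {mfun T >-> U})
    (i j : 'I_n) (f g : U -> \bar R) :
  mutual_independence P X -> i != j ->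
  measurable_fun setT f -> measurable_fun setT g ->
  (forall x, 0 <= f x)%E -> (forall x, 0 <= g x)%E ->
  (\int[P]_w (f (X i w) * g (X j w)) =
   (\int[P]_w f (X i w)) * \int[P]_w g (X j w))%E.
Proof.
move=> indep ij mf mg f0 g0.
have mi : measurable_fun setT (X i) by exact: measurable_funP.
have mj : measurable_fun setT (X j) by exact: measurable_funP.
have mXX : measurable_fun setT (fun w => (X i w, X j w)) by exact: measurable_fun_pair.
pose mu1 := distribution P (X i); pose mu2 := distribution P (X j).
pose nu := measure_function_pushforward__canonical__measure_function_Measure P mXX.
have nuE A B : measurable A -> measurable B -> nu (A `*` B) = (mu1 A * mu2 B)%E.
  move=> mA mB; rewrite /nu/= /pushforward.
  (* Independence is stated for one event per index, so both events are put into a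
     single family. *)
  pose C k := if k == i then A else B.
  have mC k : measurable (C k) by rewrite /C; case: ifP.
  have Ci : C i = A by rewrite /C eqxx.
  have Cj : C j = B by rewrite /C eq_sym (negbTE ij).
  have := indep [set i; j]%SET C mC.
  rewrite big_setU1 ?inE//= big_set1 Ci Cj => <-; congr (P _).
  apply/seteqP; split => w /=.
    by move=> [Aw Bw] k /=; rewrite !inE => /orP[] /eqP ->; rewrite ?Ci ?Cj.
  by move=> H; split; [rewrite -Ci; apply: H; rewrite /= !inE eqxx|
                       rewrite -Cj; apply: H; rewrite /= !inE eqxx orbT].
pose F (z : U * U) : \bar R := (f z.1 * g z.2)%E.
have mF : measurable_fun setT F.
  apply: emeasurable_funM.
    exact: (measurableT_comp mf (@measurable_fst _ _ _ _)).
  exact: (measurableT_comp mg (@measurable_snd _ _ _ _)).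
have F0 z : (0 <= F z)%E by rewrite mule_ge0.
transitivity (\int[nu]_z F z)%E.
  by rewrite ge0_integral_pushforward.
transitivity (\int[mu1 \x mu2]_z F z)%E.
  apply: eq_measure_integral => A mA _; apply/esym; exact: product_measure_unique.
rewrite fubini_tonelli1//.
rewrite -(ge0_integral_distribution (X i) mf f0) -(ge0_integral_distribution (X j) mg g0).
rewrite -ge0_integralZr//; last by apply: integral_ge0.
by apply: eq_integral => x _; rewrite /fubini_F /F/= ge0_integralZl.
Qed.

(** Expand the square of the sum. To keep all the integrands nonnegative the
    cross term of (x - n q)^2 = x^2 - 2 n q x + n^2 q^2 is moved to the left. *)
Lemma variance_sum_bound n (W : 'I_n -> T -> R) (q M : R) : 0 <= q ->
  (forall i, measurable_fun setT (W i)) -> (forall i w, 0 <= W i w) ->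
  (forall i, \int[P]_w (W i w)%:E = q%:E)%E ->
  (forall i, \int[P]_w (W i w ^+ 2)%:E <= M%:E)%E ->
  (forall i j, i != j -> \int[P]_w (W i w * W j w)%:E = (q ^+ 2)%:E)%E ->
  (\int[P]_w ((\sum_i W i w - n%:R * q) ^+ 2)%:E <= (n%:R * M)%:E)%E.
Proof.
move=> q0 mW W0 EW EW2 EWW.
have mWW i j : measurable_fun setT (fun w => (W i w * W j w)%:E).
  by apply/measurable_EFinP; exact: measurable_funM.
have WW0 i j w : (0 <= (W i w * W j w)%:E)%E by rewrite lee_fin mulr_ge0.
have mS : measurable_fun setT (fun w => \sum_i W i w) by exact: measurable_sum.
have S0 w : 0 <= \sum_i W i w by rewrite sumr_ge0.
have I1 : (\int[P]_w (\sum_i W i w)%:E = (n%:R * q)%:E)%E.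
  under eq_integral do rewrite -sumEFin.
  rewrite ge0_integral_sum//; last 2 first.
  - by move=> i; exact/measurable_EFinP.
  - by move=> i w _; rewrite lee_fin.
  rewrite (eq_bigr (fun=> q%:E)); last by move=> i _; exact: EW.
  by rewrite sumEFin sumr_const card_ord mulr_natl.
have I2 : (\int[P]_w ((\sum_i W i w) ^+ 2)%:E <=
    (n%:R * M + n%:R ^+ 2 * q ^+ 2)%:E)%E.
  have -> : (\int[P]_w ((\sum_i W i w) ^+ 2)%:E =
      \sum_i \sum_j \int[P]_w (W i w * W j w)%:E)%E.
    transitivity (\sum_i \int[P]_w (\sum_j W i w * W j w)%:E)%E; last first.
      apply: eq_bigr => i _; under eq_integral do rewrite -sumEFin.
      by rewrite ge0_integral_sum.
    rewrite -ge0_integral_sum//; last 2 first.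
    - by move=> i; apply/measurable_EFinP; apply: measurable_sum => j; exact: measurable_funM.
    - by move=> i w _; rewrite lee_fin sumr_ge0// => j _; rewrite mulr_ge0.
    apply: eq_integral => w _; rewrite sumEFin; congr EFin.
    rewrite expr2 big_distrl/=; apply: eq_bigr => i _; by rewrite big_distrr.
  apply: (@le_trans _ _ (\sum_(i < n) (M + n%:R * q ^+ 2)%:E)%E).
    apply: lee_sum => i _; rewrite (bigD1 i)//= EFinD; apply: leeD.
      by under eq_integral do rewrite -expr2; exact: EW2.
    rewrite (eq_bigr (fun=> (q ^+ 2)%:E)); last first.
      by move=> j ji; apply: EWW; rewrite eq_sym.
    rewrite sumEFin lee_fin.
    apply: (@le_trans _ _ (\sum_(j < n) q ^+ 2)); last by rewrite sumr_const card_ord mulr_natl.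
    by rewrite big_mkcond/=; apply: ler_sum => j _; case: ifP => // _; rewrite sqr_ge0.
  rewrite sumEFin sumr_const card_ord lee_fin -[leLHS]mulr_natl mulrDr.
  by rewrite mulrA -expr2.
have n0 : 0 <= n%:R * q by rewrite mulr_ge0.
have mD : measurable_fun setT (fun w => ((\sum_i W i w - n%:R * q) ^+ 2)%:E).
  by apply/measurable_EFinP; apply: measurable_funX; exact: measurable_funB.
have mS2 : measurable_fun setT (fun w => ((\sum_i W i w) ^+ 2)%:E).
  by apply/measurable_EFinP; exact: measurable_funX.
have mSe : measurable_fun setT (fun w => (\sum_i W i w)%:E) by exact/measurable_EFinP.
have c1 : (\int[P]_w (cst ((n%:R * q) ^+ 2)%:E w) = ((n%:R * q) ^+ 2)%:E)%E.
  by rewrite (integral_cst P measurableT) -[RHS]mule1; congr (_ * _)%E; exact: probability_setT.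
have E : (\int[P]_w ((\sum_i W i w - n%:R * q) ^+ 2)%:E +
    (2 * (n%:R * q))%:E * \int[P]_w (\sum_i W i w)%:E =
    \int[P]_w ((\sum_i W i w) ^+ 2)%:E + ((n%:R * q) ^+ 2)%:E)%E.
  rewrite -ge0_integralZl//; last 2 first.
  - by move=> w _; rewrite lee_fin.
  - by rewrite lee_fin mulr_ge0.
  rewrite -ge0_integralD//; last 3 first.
  - by move=> w _; rewrite lee_fin sqr_ge0.
  - by move=> w _; rewrite -EFinM lee_fin !mulr_ge0.
  - exact: emeasurable_funM.
  rewrite -c1 -ge0_integralD//; last by move=> w _; rewrite lee_fin sqr_ge0.
    apply: eq_integral => w _; rewrite -!EFinM -!EFinD; congr EFin; ring.
  by move=> w _; rewrite lee_fin sqr_ge0.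
move: E; rewrite I1 -EFinM => E.
have : (\int[P]_w ((\sum_i W i w - n%:R * q) ^+ 2)%:E + (2 * (n%:R * q) * (n%:R * q))%:E <=
    (n%:R * M + n%:R ^+ 2 * q ^+ 2)%:E + ((n%:R * q) ^+ 2)%:E)%E.
  by rewrite E leeD.
have J0 : (0 <= \int[P]_w ((\sum_i W i w - n%:R * q) ^+ 2)%:E)%E.
  by apply: integral_ge0 => w _; rewrite lee_fin sqr_ge0.
move: J0; case: (\int[P]_w _)%E => [r| |] _ //.
rewrite -!EFinD !lee_fin !exprMn expr2 => H.
have -> : n%:R * M = n%:R * M + n%:R ^+ 2 * q ^+ 2 + n%:R * n%:R * q ^+ 2 -
  2 * (n%:R * q) * (n%:R * q) by ring.
by rewrite lerBrDr.
Qed.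

End pairwise_independence.

(** * Concentration of the sample covariance *)

Lemma delta_quad (R : realType) p (M : 'M[R]_p) (a b : 'I_p) :
  ((delta_mx a 0 : 'cV[R]_p)^T *m M *m (delta_mx b 0 : 'cV[R]_p)) 0 0 = M a b.
Proof. by rewrite trmx_delta -rowE -colE !mxE. Qed.

Lemma sym_polarization (R : realType) p (M : 'M[R]_p) (a b : 'I_p) : M^T = M ->
  let e i : 'cV[R]_p := delta_mx i 0 in
  M a b = (quad M (e a + e b) - quad M (e a - e b)) / 4.
Proof.
move=> sM e; have Mba : M b a = M a b by rewrite -[in LHS]sM mxE.
have E1 : quad M (e a + e b) = quad M (e a) + 2 * M a b + quad M (e b).
  by rewrite quad_addl// delta_quad Mba.
have E2 : quad M (e a - e b) = quad M (e a) - 2 * M a b + quad M (e b).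
  rewrite quad_addl// -[- e b]scaleN1r quad_scale sqrrN expr1n mul1r.
  have -> : (-1 *: e b)^T = -1 *: (e b)^T by exact: linearZ.
  rewrite -!scalemxAl; have Z (A : 'M[R]_1) : (-1 *: A) 0 0 = - A 0 0 by rewrite mxE mulN1r.
  by rewrite Z delta_quad Mba mulrN.
by rewrite E1 E2; field.
Qed.

Lemma quad1_delta_pm (R : realType) p (a b : 'I_p) (s : R) : s ^+ 2 = 1 ->
  quad 1%:M (delta_mx a 0 + s *: delta_mx b 0 : 'cV[R]_p) <= 4.
Proof.
move=> s2; rewrite quad1E.
have S (c : 'I_p) : \sum_(i < p) (i == c)%:R = 1 :> R.
  rewrite (bigD1 c)//= eqxx big1 ?addr0// => i /negbTE ->; by [].
have -> : 4 = \sum_(i < p) (2 * (i == a)%:R + 2 * (i == b)%:R) :> R.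
  by rewrite big_split/= -!mulr_sumr !S !mulr1 -natrD.
apply: ler_sum => i _; rewrite !mxE eqxx !andbT.
by case: (i == a); case: (i == b); rewrite ?(mulr0, mulr1, add0r, addr0) ?s2 ?expr0n/= ?expr1n;
  have := sqr_ge0 (1 - s); rewrite sqrrB ?sqrrD s2; lra.
Qed.

Section covariance_deviation.
Context {R : realType} d (T : measurableType d) (P : probability T R).
Variables (n p : nat) (S : 'M[R]_p) (X : 'I_n -> {mfun T >-> 'cV[R]_p}).
Hypothesis n1 : (1 <= n)%N.
Hypothesis pS : posdef S.
Hypothesis XS : iid_normal P S X.
Let Sh w := sample_cov (X ^~ w).

Let n0 : 0 < n%:R :> R. Proof. by rewrite ltr0n. Qed.

Lemma quad_sample_cov (x : 'I_n -> 'cV[R]_p) u :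
  quad (sample_cov x) u = n%:R^-1 * \sum_i proj u (x i) ^+ 2.
Proof.
rewrite quadZ; congr (_ * _).
have -> : quad (\sum_i (x i *m (x i)^T)) u = \sum_i quad (x i *m (x i)^T) u.
  by rewrite /quad mulmx_sumr mulmx_suml summxE.
apply: eq_bigr => i _; rewrite quad_outer; congr (_ ^+ 2).
by rewrite /proj !mxE; apply: eq_bigr => k _; rewrite !mxE mulrC.
Qed.

Definition quad_deviation u w : R := (quad (Sh w) u - quad S u) ^+ 2.

Lemma measurable_quad_deviation u : measurable_fun setT (quad_deviation u).
Proof.
apply: measurable_funX; apply: measurable_funB => //.
under eq_fun do rewrite quad_sample_cov.
apply: measurable_funM => //; apply: measurable_sum => i.
by apply: measurable_funX; exact: measurable_proj_rv.
Qed.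

(** [quad (Sh w) u] is the mean of n pairwise independent squared projections, each
    of expectation [quad S u]. *)
Lemma quad_deviation_bound u :
  (\int[P]_w (quad_deviation u w)%:E <= (48 * quad S u ^+ 2 / n%:R)%:E)%E.
Proof.
have [indep law] := XS; set q := quad S u.
have q0 : 0 <= q by exact/psd_quad_ge0/posdef_psd.
pose W i w := proj u (X i w) ^+ 2.
have mY i : measurable_fun setT (fun w => proj u (X i w)) by exact: measurable_proj_rv.
have mW i : measurable_fun setT (W i) by exact: measurable_funX.
have EW i : (\int[P]_w (W i w)%:E = q%:E)%E by exact: (expectation_proj_sqr pS (law i)).
have EW2 i : (\int[P]_w (W i w ^+ 2)%:E <= (48 * q ^+ 2)%:E)%E.
  under eq_integral do rewrite -exprM.
  exact: (expectation_proj_pow4 pS (law i)).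
have mf : measurable_fun setT (fun x : 'cV[R]_p => (proj u x ^+ 2)%:E).
  by apply/measurable_EFinP; apply: measurable_funX; exact: measurable_proj.
have f0 (x : 'cV[R]_p) : (0 <= (proj u x ^+ 2)%:E)%E by rewrite lee_fin sqr_ge0.
have EWW i j : i != j -> (\int[P]_w (W i w * W j w)%:E = (q ^+ 2)%:E)%E.
  move=> ij; have := expectation_indep_mul indep ij mf mf f0 f0.
  rewrite (EW i) (EW j) -EFinM -expr2 => <-.
  by apply: eq_integral => w _; rewrite EFinM.
have W0 i w : 0 <= W i w by exact: sqr_ge0.
have V := variance_sum_bound q0 mW W0 EW EW2 EWW.
have k0 : 0 <= (n%:R ^+ 2)^-1 :> R by rewrite invr_ge0 sqr_ge0.
have -> : (\int[P]_w (quad_deviation u w)%:E =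
    (n%:R ^+ 2)^-1%:E * \int[P]_w ((\sum_i W i w - n%:R * q) ^+ 2)%:E)%E.
  rewrite -ge0_integralZl//; last 2 first.
  - apply/measurable_EFinP; apply: measurable_funX; apply: measurable_funB => //.
    exact: measurable_sum.
  - by move=> w _; rewrite lee_fin sqr_ge0.
  apply: eq_integral => w _; rewrite -EFinM; congr EFin.
  rewrite /quad_deviation quad_sample_cov -/q -/(W _ _); field.
  by rewrite gt_eqF.
apply: le_trans (lee_wpmul2l _ V) _; first by rewrite lee_fin.
rewrite -EFinM lee_fin le_eqVlt; apply/orP; left; apply/eqP; field.
by rewrite gt_eqF.
Qed.

(** Markov's inequality for the mean square of the polarized entries of the error. Off
    the exceptional set its Frobenius norm is at most lam = 1/(2C), half of the
    lower bound 1/C for the form of S. *)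
Lemma sample_cov_lower_bound (C : R) : 0 < C ->
  spectral_norm S <= C -> spectral_norm (invmx S) <= C ->
  exists B, [/\ measurable B, (P B <= (768 * C ^+ 4 * p%:R ^+ 2 / n%:R)%:E)%E &
    forall w, ~ B w -> forall u, (2 * C)^-1 * quad 1%:M u <= quad (Sh w) u].
Proof.
move=> C0 SC SIC.
pose e i : 'cV[R]_p := delta_mx i 0.
(* V a b bounds the square of the entry (a, b) of the error, by polarization and
   (x - y)^2 <= 2 (x^2 + y^2). *)
pose V a b w := (quad_deviation (e a + e b) w + quad_deviation (e a - e b) w) / 8.
pose G w := \sum_a \sum_b V a b w.
have V0 a b w : 0 <= V a b w by rewrite divr_ge0// addr_ge0 ?sqr_ge0.
have G0 w : 0 <= G w by rewrite sumr_ge0// => a _; exact: sumr_ge0.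
have mV a b : measurable_fun setT (V a b).
  by apply: measurable_funM => //; apply: measurable_funD; exact: measurable_quad_deviation.
have mG : measurable_fun setT G.
  by apply: measurable_sum => a; apply: measurable_sum => b; exact: mV.
(* The vectors e_a + e_b and e_a - e_b have squared norms at most 4. *)
have qC u : quad 1%:M u <= 4 -> (\int[P]_w (quad_deviation u w)%:E <= (768 * C ^+ 2 / n%:R)%:E)%E.
  move=> u4; apply: (le_trans (quad_deviation_bound u)).
  rewrite lee_fin ler_pM2r ?invr_gt0//.
  have : quad S u <= C * 4.
    by apply: le_trans (quad_le_spectral u C0 SC) _; rewrite ler_pM2l.
  have q0 : 0 <= quad S u by exact/psd_quad_ge0/posdef_psd.
  move=> h; apply: (@le_trans _ _ (48 * (C * 4) ^+ 2)).
    by rewrite ler_pM2l// ler_sqr ?nnegrE// mulr_ge0// ltW.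
  by rewrite le_eqVlt; apply/orP; left; apply/eqP; ring.
have EV a b : (\int[P]_w (V a b w)%:E <= (192 * C ^+ 2 / n%:R)%:E)%E.
  have q1 : quad 1%:M (e a + e b) <= 4.
    by rewrite -[e b]scale1r; apply: quad1_delta_pm; rewrite expr1n.
  have q2 : quad 1%:M (e a - e b) <= 4.
    by rewrite -[- e b]scaleN1r; apply: quad1_delta_pm; rewrite sqrrN expr1n.
  have mQ u : measurable_fun setT (fun w => (quad_deviation u w)%:E).
    by apply/measurable_EFinP; exact: measurable_quad_deviation.
  have Q0 u w : (0 <= (quad_deviation u w)%:E)%E by rewrite lee_fin sqr_ge0.
  have -> : (\int[P]_w (V a b w)%:E = 8^-1%:E * (\int[P]_w (quad_deviation (e a + e b) w)%:E
     + \int[P]_w (quad_deviation (e a - e b) w)%:E))%E.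
    rewrite -ge0_integralD// -ge0_integralZl//; last 2 first.
    - exact: emeasurable_funD.
    - by move=> w _; exact: adde_ge0.
    apply: eq_integral => w _; rewrite -EFinD -EFinM; congr EFin; exact: mulrC.
  apply: le_trans (lee_wpmul2l _ (leeD (qC _ q1) (qC _ q2))) _.
    by rewrite lee_fin.
  rewrite -EFinD -EFinM lee_fin le_eqVlt; apply/orP; left; apply/eqP; field.
  by rewrite gt_eqF.
have EG : (\int[P]_w (G w)%:E <= (192 * C ^+ 2 * p%:R ^+ 2 / n%:R)%:E)%E.
  rewrite (_ : (fun w => (G w)%:E) = fun w => (\sum_a \sum_b (V a b w)%:E)%E); last first.
    by apply/funext => w; rewrite -sumEFin; apply: eq_bigr => a _; rewrite -sumEFin.
  have mVe a b : measurable_fun setT (fun w => (V a b w)%:E) by exact/measurable_EFinP.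
  have V0e a b w : (0 <= (V a b w)%:E)%E by rewrite lee_fin.
  rewrite ge0_integral_sum//; last 2 first.
  - by move=> a; exact: emeasurable_sum.
  - by move=> a w _; exact: sume_ge0.
  apply: (@le_trans _ _ (\sum_(a < p) \sum_(b < p) (192 * C ^+ 2 / n%:R)%:E)%E).
    apply: lee_sum => a _; rewrite ge0_integral_sum//.
    by apply: lee_sum => b _; exact: EV.
  under eq_bigr do rewrite sumEFin sumr_const card_ord.
  rewrite sumEFin sumr_const card_ord lee_fin -mulrnA -[leLHS]mulr_natl natrM.
  by rewrite le_eqVlt; apply/orP; left; apply/eqP; ring.
pose lam := (2 * C)^-1.
have lam0 : 0 < lam by rewrite invr_gt0 mulr_gt0.
have mB : measurable [set w | lam ^+ 2 <= G w].
  have := mG measurableT `[lam ^+ 2, +oo[%classic (measurable_itv _).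
  rewrite setTI; congr measurable; apply/seteqP; split => w /=; by rewrite in_itv/= andbT.
exists [set w | lam ^+ 2 <= G w]; split => //.
  have lam2 : 0 < lam ^+ 2 by rewrite exprn_gt0.
  have H : ((lam ^+ 2)%:E * P [set w | (lam ^+ 2 <= G w)%R] <=
      (192 * C ^+ 2 * p%:R ^+ 2 / n%:R)%:E)%E.
    apply: le_trans EG; rewrite -integral_cst//.
    apply: (@le_trans _ _ (\int[P]_(w in [set w | (lam ^+ 2 <= G w)%R]) (G w)%:E)%E).
      apply: ge0_le_integral => //.
      - by move=> w _; rewrite lee_fin ltW.
      - by apply/measurable_EFinP; exact: measurable_funTS.
    apply: ge0_subset_integral => //.
    - exact/measurable_EFinP.
    - by move=> w _; rewrite lee_fin.
  have -> : (768 * C ^+ 4 * p%:R ^+ 2 / n%:R)%:E =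
     ((lam ^+ 2)^-1%:E * (192 * C ^+ 2 * p%:R ^+ 2 / n%:R)%:E)%E.
    rewrite -EFinM; congr EFin; rewrite /lam; field.
    by rewrite !gt_eqF.
  have E : P [set w | (lam ^+ 2 <= G w)%R] =
      ((lam ^+ 2)^-1%:E * ((lam ^+ 2)%:E * P [set w | (lam ^+ 2 <= G w)%R]))%E.
    by rewrite muleA -EFinM mulVf ?mul1e// gt_eqF.
  by rewrite E; apply: lee_wpmul2l H; rewrite lee_fin invr_ge0; exact: ltW.
move=> w /= /negP; rewrite -ltNge => GB u.
have sD : (Sh w - S)^T = Sh w - S.
  by rewrite linearB/= sample_cov_sym (posdef_sym pS).
have FG : \sum_i \sum_j (Sh w - S) i j ^+ 2 <= lam ^+ 2.
  apply: le_trans (ltW GB); apply: ler_sum => a _; apply: ler_sum => b _.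
  rewrite (sym_polarization a b sD) -/(e a) -/(e b) /V /quad_deviation.
  have qD v : quad (Sh w - S) v = quad (Sh w) v - quad S v.
    by rewrite quadD -[- S]scaleN1r (quadZ (-1)) mulN1r.
  rewrite !qD; set x := quad (Sh w) _ - _; set y := quad (Sh w) _ - _.
  by clearbody x y; have := sqr_ge0 (x + y); lra.
have := frobenius_quad u lam0 FG.
rewrite quadD -[- S]scaleN1r (quadZ (-1)) mulN1r => Dq.
have Sq := quad_ge_spectral_inv u C0 pS SIC.
have CE : C^-1 = lam + lam by rewrite /lam; field; rewrite gt_eqF.
move: Dq; rewrite ler_norml => /andP[Dq _]; rewrite -/lam.
by move: Sq; rewrite CE mulrDl; lra.
Qed.

End covariance_deviation.

(** * Convergence of the expected distance *)

(** The integral of a nonnegative function is a supremum over the simple functions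
    below it, which is monotone for arbitrary functions. It is applied to suprema
    over uncountable sets and to arbitrary events. *)
Lemma ge0_le_integral_nomeas (R : realType) d (T : measurableType d)
    (mu : {measure set T -> \bar R}) (f g : T -> \bar R) :
  (forall x, 0 <= f x)%E -> (forall x, f x <= g x)%E ->
  (\int[mu]_x f x <= \int[mu]_x g x)%E.
Proof.
move=> f0 fg; rewrite !ge0_integralTE//; last by move=> x; exact: le_trans (fg x).
apply: ereal_sup_le => _ [h hf <-]; exists h => // x; exact: le_trans (fg x).
Qed.

(** If the normalizing integral is infinite, then [fine] makes it 0 and the quotient
    is 0. *)
Lemma posterior_itv (R : realType) n p (Pi : {measure set 'M[R]_p -> \bar R})
    (x : 'I_n -> 'cV[R]_p) B : 0 <= posterior Pi x B <= 1.
Proof.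
have e0 (O : 'M[R]_p) : (0 <= (expR (loglik x O))%:E)%E by rewrite lee_fin expR_ge0.
have N0 : (0 <= \int[Pi]_(O in B) (expR (loglik x O))%:E)%E by exact: integral_ge0.
have D0 : (0 <= \int[Pi]_O (expR (loglik x O))%:E)%E by exact: integral_ge0.
have ND : (\int[Pi]_(O in B) (expR (loglik x O))%:E <= \int[Pi]_O (expR (loglik x O))%:E)%E.
  rewrite [leLHS]integral_mkcond; apply: ge0_le_integral_nomeas => O.
    by rewrite patchE; case: ifP.
  by rewrite patchE; case: ifP.
rewrite /posterior; move: D0 N0 ND; case: (integral Pi setT _) => [D| |]// D0; last first.
  by rewrite /= invr0 mulr0 lexx ler01.
case: (integral Pi B _) => [N| |]//; rewrite !lee_fin => N0 ND.
rewrite divr_ge0//=; have [->|Dn] := eqVneq D 0; first by rewrite invr0 mulr0.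
by rewrite ler_pdivrMr ?mul1r// lt_neqAle eq_sym Dn.
Qed.

Lemma std_normal_cdf_itv (R : realType) (t : R) : 0 <= std_normal_cdf t <= 1.
Proof.
rewrite /std_normal_cdf fine_ge0//=.
have h : (normal_prob 0 1 `]-oo, t] <= 1%E :> \bar R)%E by exact: probability_le1.
have h0 : (0 <= normal_prob 0 1 `]-oo, t] :> \bar R)%E by [].
by rewrite -lee_fin fineK// fin_numElt (lt_le_trans _ h0) ?ltNyr//= (le_lt_trans h) ?ltry.
Qed.

(** The Kolmogorov distance between the posterior law of the scaled error and
    N(0, 1). *)
Definition cdf_distance (R : realType) n p b (x : 'I_n -> 'cV[R]_p) : R :=
  sup [set `|posterior (wishart p b) x [set O | scaled_logdet_error x O <= t] -
    std_normal_cdf t| | t in [set: R]].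

Lemma cdf_distance_le (R : realType) n p b (x : 'I_n -> 'cV[R]_p) e :
  (forall t, `|posterior (wishart p b) x [set O | scaled_logdet_error x O <= t] -
     std_normal_cdf t| <= e) -> cdf_distance b x <= e.
Proof.
move=> H; apply: ge_sup; first by apply/set0P/eqP => /seteqP[/(_ _ (ex_intro2 _ _ 0 I erefl))].
by move=> _ [t _ <-].
Qed.

Lemma cdf_distance_itv (R : realType) n p b (x : 'I_n -> 'cV[R]_p) :
  0 <= cdf_distance b x <= 1.
Proof.
have le1 t : `|posterior (wishart p b) x [set O | scaled_logdet_error x O <= t] -
     std_normal_cdf t| <= 1.
  have /andP[a0 a1] := posterior_itv (wishart p b) x [set O | scaled_logdet_error x O <= t].
  have /andP[b0 b1] := std_normal_cdf_itv t.
  by rewrite ler_norml; apply/andP; split; lra.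
rewrite cdf_distance_le// andbT.
apply: (@le_trans _ _ `|posterior (wishart p b) x [set O | scaled_logdet_error x O <= 0] -
     std_normal_cdf 0|); first exact: normr_ge0.
apply: ub_le_sup; last by exists 0.
by exists 1 => _ [t _ <-].
Qed.

(** f is at most e plus the indicator of B. *)
Lemma expectation_le_split (R : realType) d (T : measurableType d) (P : probability T R)
    (f : T -> R) (B : set T) (e e' : R) : measurable B -> 0 <= e ->
  (forall w, 0 <= f w <= 1) -> (forall w, ~ B w -> f w <= e) -> (P B <= e'%:E)%E ->
  (0 <= 'E_P[f] <= (e + e')%:E)%E.
Proof.
move=> mB e0 f01 fe PB; rewrite unlock; apply/andP; split.
  by apply: integral_ge0 => w _; rewrite lee_fin; have /andP[] := f01 w.
have mI : measurable_fun setT (fun w => (\1_B w)%:E : \bar R).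
  by apply/measurable_EFinP; exact: measurable_indic.
apply: (@le_trans _ _ (\int[P]_w (cst e%:E w + (\1_B w)%:E))%E).
  apply: ge0_le_integral_nomeas => w; first by rewrite lee_fin; have /andP[] := f01 w.
  rewrite -EFinD lee_fin indicE; have [/set_mem Bw|/negP nBw] := boolP (w \in B).
    by apply: le_trans (_ : 1 <= _); [have /andP[] := f01 w|rewrite lerDr].
  by rewrite addr0; apply: fe => Bw; apply: nBw; exact/mem_set.
rewrite ge0_integralD//.
rewrite integral_indic// setIT EFinD; apply: leeD => //.
by rewrite (integral_cst P measurableT) -[leRHS]mule1; apply: lee_wpmul2l => //; exact: probability_le1.
Qed.

Lemma expected_cdf_distance_le (R : realType) n p b (C : R) (S : 'M[R]_p)
    d (T : measurableType d) (P : probability T R) (X : 'I_n -> {mfun T >-> 'cV[R]_p}) :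
  (1 <= n)%N -> (0 < p)%N -> (1 <= b)%N -> (b + p <= n)%N -> 0 < C ->
  posdef S -> spectral_norm S <= C -> spectral_norm (invmx S) <= C ->
  iid_normal P S X ->
  (0 <= 'E_P[fun w => cdf_distance b (X ^~ w)] <=
    (p%:R * (912 / Num.sqrt n%:R + 12 * (b%:R + p%:R) / n%:R) +
     Num.sqrt (n%:R / (2 * p%:R)) *
       (p%:R * (b%:R + p%:R) / n%:R + p%:R / (n%:R * (2 * C)^-1)) +
     768 * C ^+ 4 * p%:R ^+ 2 / n%:R)%:E)%E.
Proof.
move=> n1 p0 b1 bpn C0 pS SC SIC XS.
have [B [mB PB good]] := sample_cov_lower_bound n1 pS XS C0 SC SIC.
apply: (expectation_le_split mB) PB.
- have bp0 : 0 <= b%:R + p%:R :> R by rewrite addr_ge0 ?ler0n.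
  have lam0 : 0 <= (2 * C)^-1 by rewrite invr_ge0; exact/ltW/mulr_gt0.
  apply: addr_ge0; apply: mulr_ge0.
  + exact: ler0n.
  + apply: addr_ge0; apply: divr_ge0; [exact: ler0n|exact: sqrtr_ge0| |exact: ler0n].
    by apply: mulr_ge0; [exact: ler0n|exact: bp0].
  + exact: sqrtr_ge0.
  + by apply: addr_ge0; apply: divr_ge0; rewrite ?mulr_ge0 ?ler0n.
- by move=> w; exact: cdf_distance_itv.
- move=> w Bw; apply: cdf_distance_le => t.
  have lam0 : 0 < (2 * C)^-1 by rewrite invr_gt0 mulr_gt0.
  have [pd sh] := logdet_shift_bound b n1 lam0 (good w Bw).
  apply: le_trans (posterior_bound t n1 p0 b1 bpn pd) _.
  by rewrite lerD2l ler_wpM2l ?sqrtr_ge0.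
Qed.

(** With r = sqrt(p^3/n) <= 1, each term is a constant times r: p / sqrt n <= r,
    p^2/n <= r^2 <= r, and sqrt(n/(2p)) p^2/n <= r. *)
Lemma expected_cdf_distance_rate (R : realType) (n p b B C : R) :
  1 <= n -> 1 <= p -> 0 <= b -> b <= B -> 0 < C -> p ^+ 3 / n <= 1 ->
  p * (912 / Num.sqrt n + 12 * (b + p) / n) +
  Num.sqrt (n / (2 * p)) * (p * (b + p) / n + p / (n * (2 * C)^-1)) +
  768 * C ^+ 4 * p ^+ 2 / n <=
  (912 + 13 * (B + 1) + 2 * C + 768 * C ^+ 4) * Num.sqrt (p ^+ 3 / n).
Proof.
move=> n1 p1 b0 bB C0 x1.
have n0 : 0 < n by lra.
have p0 : 0 < p by lra.
set r := Num.sqrt (p ^+ 3 / n); have r0 : 0 <= r by exact: sqrtr_ge0.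
have x0 : 0 <= p ^+ 3 / n by rewrite divr_ge0 ?exprn_ge0// ltW.
have r2 : r ^+ 2 = p ^+ 3 / n by rewrite sqr_sqrtr.
have r1 : r <= 1 by rewrite /r -[leRHS]sqrtr1 ler_wsqrtr.
have xr : p ^+ 3 / n <= r by rewrite -r2 expr2 ler_piMl.
have p23 : p ^+ 2 / n <= p ^+ 3 / n.
  by rewrite ler_pM2r ?invr_gt0// [leRHS]exprS ler_peMl ?exprn_ge0// ltW.
have a1 : p / Num.sqrt n <= r.
  have -> : p / Num.sqrt n = Num.sqrt (p ^+ 2 / n).
    by rewrite sqrtrM ?sqr_ge0// sqrtr_sqr gtr0_norm// sqrtrV// ltW.
  by rewrite ler_wsqrtr.
have B0 : 0 <= B by lra.
have a2 : p * (b + p) / n <= (B + 1) * (p ^+ 2 / n).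
  rewrite [leRHS]mulrA ler_pM2r ?invr_gt0//.
  have -> : (B + 1) * p ^+ 2 = p * ((B + 1) * p) by ring.
  rewrite ler_pM2l//; have : b <= B * p by apply: (le_trans bB); rewrite ler_peMr.
  lra.
have a3 : Num.sqrt (n / (2 * p)) * (p ^+ 2 / n) <= r.
  have e : p ^+ 2 / n = Num.sqrt ((p ^+ 2 / n) ^+ 2).
    by rewrite sqrtr_sqr ger0_norm// divr_ge0 ?exprn_ge0// ltW.
  rewrite e -sqrtrM; last by rewrite divr_ge0 ?mulr_ge0// ltW.
  apply: ler_wsqrtr.
  have -> : n / (2 * p) * (p ^+ 2 / n) ^+ 2 = p ^+ 3 / n / 2.
    by field; rewrite !gt_eqF.
  by lra.
have s0 := sqrtr_ge0 (n / (2 * p)).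
have pn : p / n <= p ^+ 2 / n.
  by rewrite ler_pM2r ?invr_gt0// expr2 ler_peMl// ltW.
have a4 : p * (b + p) / n + p / (n * (2 * C)^-1) <= (B + 1 + 2 * C) * (p ^+ 2 / n).
  have -> : p / (n * (2 * C)^-1) = 2 * C * (p / n) by field; rewrite !gt_eqF.
  have : 2 * C * (p / n) <= 2 * C * (p ^+ 2 / n) by rewrite ler_wpM2l ?mulr_ge0// ltW.
  by move=> h; rewrite [leRHS]mulrDl; exact: lerD.
have K0 : 0 <= B + 1 + 2 * C by lra.
have a5 := ler_wpM2l s0 a4.
have a6 := ler_wpM2l K0 a3.
have C4 : 0 <= 768 * C ^+ 4.
  by apply: mulr_ge0; [exact: ler0n|exact/exprn_ge0/ltW].
have a7 := ler_wpM2l C4 (le_trans p23 xr).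
have B1 : 0 <= B + 1 by lra.
have a8 := ler_wpM2l B1 (le_trans p23 xr).
have -> : p * (912 / Num.sqrt n + 12 * (b + p) / n) =
  912 * (p / Num.sqrt n) + 12 * (p * (b + p) / n) by ring.
have -> : 768 * C ^+ 4 * p ^+ 2 / n = 768 * C ^+ 4 * (p ^+ 2 / n) by rewrite !mulrA.
set X1 := p / Num.sqrt n in a1 *.
set X2 := p * (b + p) / n in a2 a4 a5 *.
set X3 := p ^+ 2 / n in p23 pn a2 a3 a4 a5 a6 a7 a8 *.
set s := Num.sqrt _ in a3 a5 a6 s0 *.
have -> : (912 + 13 * (B + 1) + 2 * C + 768 * C ^+ 4) * r = 912 * r + 12 * ((B + 1) * r) +
  (B + 1 + 2 * C) * r + 768 * C ^+ 4 * r by ring.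
have a9 : s * (X2 + p / (n * (2 * C)^-1)) <= (B + 1 + 2 * C) * r.
  by apply: (le_trans a5); rewrite mulrCA.
have a10 := le_trans a2 a8.
apply: lerD a7; apply: lerD a9; apply: lerD.
  exact: (ler_wpM2l (ler0n R 912) a1).
exact: (ler_wpM2l (ler0n R 12) a10).
Qed.

Theorem corollary3p5 (R : realType)
  (n p b : nat -> nat) (Sigma : forall k, 'M[R]_(p k))
  (d : nat -> measure_display) (T : forall k, measurableType (d k))
  (P : forall k, probability (T k) R)
  (X : forall k, 'I_(n k) -> {mfun T k >-> 'cV[R]_(p k)})
  (n_oo : n @ \oo --> \oo) (p_oo : p @ \oo --> \oo)
  (b_ge1 : forall k, (1 <= b k)%N)
  (b_O1 : (fun k => (b k)%:R : R^o) =O_\oo (cst 1 : nat -> R^o))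
  (Sigma_posdef : forall k, posdef (Sigma k))
  (Sigma_O1 : (fun k => Num.max (spectral_norm (Sigma k))
     (spectral_norm (invmx (Sigma k))) : R^o) =O_\oo (cst 1 : nat -> R^o))
  (p3n_o1 : (fun k => (p k)%:R ^+ 3 / (n k)%:R : R^o) =o_\oo
     (cst 1 : nat -> R^o))
  (X_iid : forall k, iid_normal (P k) (Sigma k) (X k)) :
  'E_(P k)[fun w => sup [set
     `|posterior (wishart (p k) (b k)) (fun i => X k i w)
         [set O | scaled_logdet_error (fun i => X k i w) O <= t]%R
       - std_normal_cdf t|%R | t in [set: R]]]%E @[k --> \oo] --> 0%E.
Proof.
have [B B0 bB] : exists2 B : R, 0 < B & \forall k \near \oo, (b k)%:R <= B.
  have /eqO_exP[B B0 H] := b_O1; exists B => //; near=> k.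
  have : `|(b k)%:R : R^o| <= B * `|1 : R^o| by near: k.
  by rewrite normr1 mulr1; apply: le_trans; exact: ler_norm.
have [C C0 SC] : exists2 C : R, 0 < C & \forall k \near \oo,
    spectral_norm (Sigma k) <= C /\ spectral_norm (invmx (Sigma k)) <= C.
  have /eqO_exP[C C0 H] := Sigma_O1; exists C => //; near=> k.
  have : `|Num.max (spectral_norm (Sigma k)) (spectral_norm (invmx (Sigma k))) : R^o|
      <= C * `|1 : R^o| by near: k.
  rewrite normr1 mulr1 => /(le_trans (ler_norm _)).
  by rewrite ge_max => /andP[].
have xP e : 0 < e -> \forall k \near \oo, (p k)%:R ^+ 3 / (n k)%:R <= e :> R.
  move=> e0; have /eqoP/(_ e e0) H := p3n_o1; near=> k.
  have : `|(p k)%:R ^+ 3 / (n k)%:R : R^o| <= e * `|1 : R^o| by near: k.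
  by rewrite normr1 mulr1; apply: le_trans; exact: ler_norm.
have n1 : \forall k \near \oo, (1 <= n k)%N.
  exact: (n_oo _ (nbhs_infty_ge 1)).
have p1 : \forall k \near \oo, (1 <= p k)%N.
  exact: (p_oo _ (nbhs_infty_ge 1)).
pose K := 912 + 13 * (B + 1) + 2 * C + 768 * C ^+ 4.
have K0 : 0 < K.
  rewrite /K; apply: ltr_wpDr.
    by apply: mulr_ge0; [exact: ler0n|exact/exprn_ge0/ltW].
  by lra.
have main e : 0 < e -> \forall k \near \oo,
    (0 <= 'E_(P k)[fun w => cdf_distance (b k) (X k ^~ w)] <= e%:E)%E.
  move=> e0; have eK : 0 < (e / K) ^+ 2 by apply: exprn_gt0; exact: divr_gt0.
  have B1i : 0 < (B + 1)^-1 by rewrite invr_gt0; lra.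
  near=> k; have n1k : (1 <= n k)%N by near: k.
  have p1k : (1 <= p k)%N by near: k.
  have bk : (b k)%:R <= B by near: k.
  have [SCk SICk] : spectral_norm (Sigma k) <= C /\ spectral_norm (invmx (Sigma k)) <= C.
    by near: k.
  have n0 : 0 < (n k)%:R :> R by rewrite ltr0n.
  have pp : 1 <= (p k)%:R :> R by rewrite ler1n.
  have x1 : (p k)%:R ^+ 3 / (n k)%:R <= (B + 1)^-1 by near: k; exact: xP.
  have x2 : (p k)%:R ^+ 3 / (n k)%:R <= (e / K) ^+ 2.
    by near: k; exact: xP.
  have bpn : (b k + p k <= n k)%N.
    rewrite -(ler_nat R) natrD.
    (* p (B + 1) <= p^3 (B + 1) <= n, because p^3 / n <= 1 / (B + 1). *)
    have : (p k)%:R * (B + 1) <= (n k)%:R.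
      rewrite -ler_pdivlMr; last by lra.
      apply: le_trans (_ : (p k)%:R ^+ 3 <= _).
        by rewrite ler_eXnr.
      by rewrite -ler_pdivrMl// mulrC.
    have : B <= (p k)%:R * B by rewrite ler_peMl// ltW.
    lra.
  have := expected_cdf_distance_le n1k p1k (b_ge1 k) bpn C0 (Sigma_posdef k) SCk SICk (X_iid k).
  move=> /andP[-> h] /=; apply: (le_trans h); rewrite lee_fin.
  apply: le_trans (expected_cdf_distance_rate _ pp _ bk C0 _) _.
  - by rewrite ler1n.
  - by rewrite ler0n.
  - apply: (le_trans x1); rewrite invf_le1; lra.
  rewrite -/K mulrC -ler_pdivlMr//.
  apply: (@le_trans _ _ (Num.sqrt ((e / K) ^+ 2))); first exact: ler_wsqrtr.
  by rewrite sqrtr_sqr ger0_norm//; exact/ltW/divr_gt0.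
apply/fine_cvgP; split.
  near=> k; have /andP[h0 h1] : (0 <= 'E_(P k)[fun w => cdf_distance (b k) (X k ^~ w)] <= 1%:E)%E.
    by near: k; exact: main.
  by rewrite fin_numElt (lt_le_trans _ h0) ?ltNyr//= (le_lt_trans h1) ?ltry.
apply/cvgrPdist_le => e e0; near=> k.
have /andP[h0 h1] : (0 <= 'E_(P k)[fun w => cdf_distance (b k) (X k ^~ w)] <= e%:E)%E.
  by near: k; exact: main.
rewrite sub0r normrN ger0_norm ?fine_ge0//.
by rewrite -lee_fin fineK// fin_numElt (lt_le_trans _ h0) ?ltNyr//= (le_lt_trans h1) ?ltry.
Unshelve. all: by end_near.
Qed.
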